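(* Suppose that the family of triangulations $\{\mathcal{T}_h\}$ is, in addition, quasi-uniform. Let $\mathbf{A}$ be the stiffness matrix of the immersed finite element (IFE) method and $\mathbf{A}^{\mathrm{std}}$ the stiffness matrix of the standard nonconforming finite element method (both defined in the context). Then the $\ell_2$ condition numbers satisfy $$\mathrm{cond}_2(\mathbf{A})\sim\mathrm{cond}_2(\mathbf{A}^{\mathrm{std}})\lesssim h^{-2},$$ with hidden constants independent of the interface location relative to the mesh.
   Context: Geometry and coefficient. $N\in\{2,3\}$; $\Omega\subset\mathbb{R}^N$ is a convex polygonal (polyhedral) domain; $\Gamma$ is a closed $C^2$-smooth $(N-1)$-dimensional manifold immersed in $\Omega$, dividing $\Omega$ into $\Omega^\pm$ with $\Gamma=\partial\Omega^-$; $n$ is the unit normal to $\Gamma$ pointing toward $\Omega^+$. $\mathbb{B}(x)$ is a symmetric positive definite $N\times N$ matrix function; $\mathbb{B}^\pm=\mathbb{B}|_{\Omega^\pm}$ has entries in $C^1(\overline{\Omega^\pm})$ and $\beta_M^\pm|y|^2\ge y^\top\mathbb{B}^\pm(x)y\ge\beta_m^\pm|y|^2$ for all $y\in\mathbb{R}^N$, $x\in\Omega^\pm$, with positive constants $\beta_m^\pm,\beta_M^\pm$. Mesh. $\{\mathcal{T}_h\}$ is a family of shape-regular simplicial triangulations of $\Omega$, independent of $\Gamma$; elements $T$ and faces $F$ (edges if $N=2$) are open; $h_T=\mathrm{diam}(T)$, $h=\max_Th_T$; $\mathcal{F}_h,\mathcal{F}_h^\circ,\mathcal{F}_h^\partial,\mathcal{F}_T$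 are the sets of all, interior, boundary faces, and faces of $T$. $\mathcal{T}_h^\Gamma=\{T:T\cap\Gamma\ne\emptyset\}$, $\mathcal{F}_h^\Gamma=\{F:F\cap\Gamma\neq\emptyset\}$, $\mathcal{T}_h^{non},\mathcal{F}_h^{non}$ their complements; $\Gamma_T=\Gamma\cap T$, $T^\pm=T\cap\Omega^\pm$. Faces contained in $\Gamma$ are excluded. (A1) For each triangle $\triangle\in\mathcal{T}_h^\Gamma$ ($N=2$) or $\triangle\in\mathcal{F}_h^\Gamma$ ($N=3$), $\Gamma\cap\partial\triangle$ is exactly two points on different edges; for $N=3$, $T\in\mathcal{T}_h^\Gamma$, $\Gamma\cap\partial T$ is exactly one closed curve. Planes. For $T\in\mathcal{T}_h^\Gamma$, $L_T$ is a plane (line if $N=2$) through $\bar x_{0,T}$ with unit normal $\bar n_T$. (A2) $L_T$ and $\Gamma$ intersect the same faces of $T$, and there is $\tilde x_T\in\Gamma_T$ with $\tilde x_T-\bar x_{0,T}\perp L_T$ and $|\bar x_{0,T}-\tilde x_T|+h_T|\bar n_T-n(\tilde x_T)|\lesssim h_T^2$. $L_T$ divides $T$ into $T_h^\pm=\{x\in T:\pm(x-\bar x_{0,T})\cdot\bar n_T>0\}$, approximating $T^\pm$. $\bar t_{i,T}$ ($1\le i\le N-1$) are orthonormal vectors perpendicular to $\bar n_T$, $\mu>0$ is fixed, $\bar x_{i,T}=\bar x_{0,T}+\mu h_T\bar t_{i,T}$, $S_T=\{\bar x_{0,T}+\sum_i\zeta_i\bar t_{i,T}:0\le\zeta_i\le\mu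 h_T\}$. (A3) The map $\mathbf{p}_{h,T}:S_T\to\Gamma$, $\mathbf{p}_{h,T}(x)=x+\varrho_h\bar n_T$ with $\varrho_h$ the smallest value such that $x+\varrho_h\bar n_T\in\Gamma$, is well-defined. $\tilde x_{0,T}=\mathbf{p}_{h,T}(\bar x_{0,T})$, $\Gamma_T^{ext}=\mathbf{p}_{h,T}(S_T)$, $\mathbb{B}_T^\pm=\mathbb{B}^\pm(\tilde x_{0,T})$. $\mathcal{B}_T$ is the smallest ball containing $T,S_T,\Gamma_T^{ext}$ if $T\in\mathcal{T}_h^\Gamma$, and $\mathcal{B}_T=T$ otherwise. (A4) There is $M$ such that for each $T\in\mathcal{T}_h^\Gamma$ at most $M$ elements $T'\in\mathcal{T}_h$ satisfy $\mathcal{B}_T\cap\mathcal{B}_{T'}\ne\emptyset$. (A5) For $T\in\mathcal{T}_h^\Gamma$, if $L_1,L_2$ are two parallel planes at smallest distance bounding $\Gamma_T$, then $\mathrm{dist}(L_1,L_2)$ is at most half the diameter of the largest ball inscribed in $T$. Functionals. $[\![v^\pm]\!]:=v^+-v^-$. On $\mathbb{P}_1(\mathbb{R}^N)\times\mathbb{P}_1(\mathbb{R}^N)$: $\mathcal{J}_{i,T}(\phi^+,\phi^-)=[\![\phi^\pm]\!](\bar x_{i,T})$ ($0\le i\le N-1$), $\mathcal{J}_{N,T}(\phi^+,\phi^-)=[\![\mathbb{B}_T^\pm\nabla\phi^\pm\cdot\bar n_T]\!]$, $\mathcal{M}_{F,T}(\phi^+,\phi^-)=|F|^{-1}(\int_F\chi_{T_h^+}\phi^++\int_F\chi_{T_h^-}\phi^-)$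 for $F\in\mathcal{F}_T$ ($\chi_{T_h^\pm}$ on $F$: characteristic function of $F\cap\partial T_h^\pm$). These $2N+2$ functionals are unisolvent. IFE space. For $T\in\mathcal{T}_h^\Gamma$: $V_h^{\mathrm{IFE}}(T)=\{v:v|_{T^\pm}=v^\pm,\ v^\pm\in\mathbb{P}_1(\mathbb{R}^N),\ \mathcal{J}_{i,T}(v^+,v^-)=0,\ i=0,\dots,N\}$ and $\mathcal{N}^{\mathrm{IFE}}_{F,T}(v)=\mathcal{M}_{F,T}(v^+,v^-)$. For $T\in\mathcal{T}_h^{non}$: $V_h^{\mathrm{IFE}}(T)=\mathbb{P}_1(T)$, $\mathcal{N}^{\mathrm{IFE}}_{F,T}(v)=|F|^{-1}\int_Fv$. $V_h^{\mathrm{IFE}}$ is the space of $v$ with $v|_T\in V_h^{\mathrm{IFE}}(T)$ for all $T$ and $\mathcal{N}^{\mathrm{IFE}}_{F,T_1^F}(v|_{T_1^F})=\mathcal{N}^{\mathrm{IFE}}_{F,T_2^F}(v|_{T_2^F})$ for all $F\in\mathcal{F}_h^\circ$, where $T_1^F,T_2^F$ are the elements sharing $F$; $V_{h,0}^{\mathrm{IFE}}=\{v\in V_h^{\mathrm{IFE}}:\int_Fv=0\ \forall F\in\mathcal{F}_h^\partial\}$. Bilinear form. For $F\in\mathcal{F}_h^\circ$, $n_F$ is a fixed unit normal pointing from $T_1^F$ to $T_2^F$, $[v]_F=v|_{T_1^F}-v|_{T_2^F}$, $\{v\}_F=(v|_{T_1^F}+v|_{T_2^F})/2$; on boundary faces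 $[v]_F=\{v\}_F=v$. $(\nabla_hv)|_{T^\pm}=\nabla v|_{T^\pm}$. For $F\in\mathcal{F}_h^\Gamma$, $\mathbf{Q}_F=\{\mathbf{q}\in L^2(T_1^F\cup T_2^F)^N:\mathbf{q}|_{T_i^F}\in\nabla_hV_h^{\mathrm{IFE}}(T_i^F),\ i=1,2\}$ and $\mathbf{r}_F:L^2(F)\to\mathbf{Q}_F$ is defined by $\int_{T_1^F\cup T_2^F}(\mathbb{B}\mathbf{r}_F(v))\cdot\mathbf{q}=\int_Fv\{(\mathbb{B}\mathbf{q})\cdot n_F\}_F$ for all $\mathbf{q}\in\mathbf{Q}_F$. Set $A_h=a_h+b_h+s_h$, $a_h(v,w)=\int_\Omega(\mathbb{B}\nabla_hv)\cdot\nabla_hw$, $b_h(v,w)=-\sum_{F\in\mathcal{F}_h^\Gamma}\int_F(\{(\mathbb{B}\nabla_hv)\cdot n_F\}_F[w]_F+\{(\mathbb{B}\nabla_hw)\cdot n_F\}_F[v]_F)$, $s_h(v,w)=8\sum_{F\in\mathcal{F}_h^\Gamma}\int_{T_1^F\cup T_2^F}(\mathbb{B}\mathbf{r}_F([v]_F))\cdot\mathbf{r}_F([w]_F)$. Matrices. $\{\phi_i\}_{i=1}^{\mathrm{ndof}}$ is the basis of $V_{h,0}^{\mathrm{IFE}}$ dual to the face degrees of freedom $\mathcal{N}^{\mathrm{IFE}}_{F,T}$ on interior faces, and $\mathbf{A}_{ij}=A_h(\phi_i,\phi_j)$. $V_{h,0}=\{v:v|_T\in\mathbb{P}_1(T)\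 \forall T,\ \int_F[v]_F=0\ \forall F\in\mathcal{F}_h\}$ is the standard nonconforming (Crouzeix--Raviart) space. $\widehat\Pi_h:V_{h,0}^{\mathrm{IFE}}\to V_{h,0}$ is $(\widehat\Pi_hv)|_T=v|_T$ for $T\in\mathcal{T}_h^{non}$ and $(\widehat\Pi_hv)|_T=\widehat\Pi_Tv$ for $T\in\mathcal{T}_h^\Gamma$, where $\widehat\Pi_Tv\in\mathbb{P}_1(T)$ satisfies $|F|^{-1}\int_F\widehat\Pi_Tv=\mathcal{N}^{\mathrm{IFE}}_{F,T}(v)$ for all $F\in\mathcal{F}_T$. $\mathbf{A}^{\mathrm{std}}_{ij}=a_h(\widehat\Pi_h\phi_i,\widehat\Pi_h\phi_j)$. $A\lesssim B$ means $A\le CB$ with $C$ independent of the mesh size and of the intersection configuration of the interface and the mesh (it may depend on the fixed data: $\Omega$, $\Gamma$, $\mathbb{B}$ including its contrast, shape regularity, quasi-uniformity, $\mu$, $M$); $A\sim B$ means $A\lesssim B$ and $B\lesssim A$.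
   Formalization: ''T_h^± approximates T^±'' is made an explicit assumption: a face not met by Γ that lies on the boundary of T^± also lies on that of T_h^±; otherwise on coarse elements (A2) allows swapped sides, for which the dual basis can fail to exist. *)

(* Defs.v *)
From HB Require Import structures.
From mathcomp Require Import all_boot all_order all_algebra.
From mathcomp Require Import all_classical all_reals all_analysis.

Set Implicit Arguments.
Unset Strict Implicit.
Unset Printing Implicit Defensive.

Import Order.TTheory GRing.Theory Num.Theory.
Import numFieldNormedType.Exports.

Local Open Scope classical_set_scope.
Local Open Scope ring_scope.

(* Points, gradients and vectors of R^N are row vectors.  The norm that the
   library puts on 'rV[R]_N is the sup norm; it induces the usual topology, but
   all metric quantities below use the Euclidean norm [enorm]. *)
Definition dot (R : realType) (n : nat) (u v : 'rV[R]_n) : R :=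
  (u *m v^T) 0 0.

Definition enorm (R : realType) (n : nat) (u : 'rV[R]_n) : R :=
  Num.sqrt (dot u u).

(* The matrix-vector product A x, for a row vector x. *)
Definition mulmv (R : realType) (m n : nat) (A : 'M[R]_(m, n))
    (x : 'rV[R]_n) : 'rV[R]_m :=
  x *m A^T.

Definition cball (R : realType) (n : nat) (c : 'rV[R]_n) (r : R) :
    set 'rV[R]_n :=
  [set x | enorm (x - c) <= r].

Definition oball (R : realType) (n : nat) (c : 'rV[R]_n) (r : R) :
    set 'rV[R]_n :=
  [set x | enorm (x - c) < r].

Definition ediam (R : realType) (n : nat) (A : set 'rV[R]_n) : R :=
  sup [set d | exists x y, [/\ A x, A y & d = enorm (x - y)]].

Definition inball_diam (R : realType) (n : nat) (A : set 'rV[R]_n) : R :=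
  sup [set d | exists c r, [/\ 0 <= r, oball c r `<=` A & d = 2 * r]].

Definition bd (T : topologicalType) (A : set T) : set T :=
  closure A `\` interior A.

(* l2 condition number; it is +oo for a singular matrix, so that an upper bound
   on it includes invertibility. *)
Definition opnorm2 (R : realType) (n : nat) (A : 'M[R]_n) : R :=
  sup [set enorm (mulmv A x) | x in [set x : 'rV[R]_n | enorm x <= 1]].

Definition cond2 (R : realType) (n : nat) (A : 'M[R]_n) : \bar R :=
  if A \in unitmx then (opnorm2 A * opnorm2 (invmx A))%:E else +oo%E.

Definition evec (R : realType) (n : nat) (i : 'I_n) : 'rV[R]_n := delta_mx 0 i.

Definition partial (R : realType) (n : nat) (i : 'I_n) (f : 'rV[R]_n -> R) :
    'rV[R]_n -> R :=
  fun x => 'D_(evec R i) f x.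

Definition grad (R : realType) (n : nat) (f : 'rV[R]_n -> R) (x : 'rV[R]_n) :
    'rV[R]_n :=
  \row_i partial i f x.

Definition C1_on (R : realType) (n : nat) (U : set 'rV[R]_n)
    (f : 'rV[R]_n -> R) : Prop :=
  forall (i : 'I_n) (x : 'rV[R]_n), U x ->
    derivable f x (evec R i) /\ {for x, continuous (partial i f)}.

Definition C2_on (R : realType) (n : nat) (U : set 'rV[R]_n)
    (f : 'rV[R]_n -> R) : Prop :=
  C1_on U f /\ forall i : 'I_n, C1_on U (partial i f).

(* f belongs to C^1 of the closure of the open set U: f and its first partial
   derivatives in U extend continuously to the closure, f being its own
   extension. *)
Definition C1_closure (R : realType) (n : nat) (U : set 'rV[R]_n)
    (f : 'rV[R]_n -> R) : Prop :=
  [/\ C1_on U f,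
      {within closure U, continuous f} &
      forall i : 'I_n, exists g : 'rV[R]_n -> R,
        {within closure U, continuous g} /\
        forall x, U x -> g x = partial i f x].

Definition polyhedral_domain (R : realType) (n : nat) (A : set 'rV[R]_n) :
    Prop :=
  [/\ A !=set0,
      exists r : R, A `<=` cball 0 r &
      exists (k : nat) (a : 'I_k -> 'rV[R]_n) (b : 'I_k -> R),
        A = [set x | forall i, dot (a i) x < b i]].

(* Signs are booleans, with [true] for + and [false] for -. *)
Record interface_problem (R : realType) (N : nat) := InterfaceProblem {
  dom : set 'rV[R]_N;
  sub : bool -> set 'rV[R]_N;
  itf : set 'rV[R]_N;
  nrm : 'rV[R]_N -> 'rV[R]_N;
  coef : bool -> 'rV[R]_N -> 'M[R]_N  (* extended to the closure of [sub s] *)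
}.

(* Near each of its points the interface is the zero set of a C^2 submersion f
   that is negative in the - part and positive in the + part, so the unit normal
   pointing toward the + part is the normalized gradient of f. *)
Definition C2_interface (R : realType) (N : nat) (P : interface_problem R N) :
    Prop :=
  forall x, itf P x ->
    exists (U : set 'rV[R]_N) (f : 'rV[R]_N -> R),
      [/\ open U, U x, C2_on U f &
          forall y, U y ->
            [/\ itf P y <-> f y = 0,
                sub P true y <-> 0 < f y,
                sub P false y <-> f y < 0,
                grad f y != 0 &
                itf P y -> nrm P y = (enorm (grad f y))^-1 *: grad f y]].

Definition valid_problem (R : realType) (N : nat) (P : interface_problem R N) :
    Prop :=
  [/\ polyhedral_domain (dom P),
      [/\ open (sub P false), sub P false !=set0, sub P false `<=` dom P &
          sub P true = dom P `\` closure (sub P false)],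
      [/\ itf P = bd (sub P false), compact (itf P), itf P `<=` dom P &
          C2_interface P] &
      forall s : bool,
        [/\ forall x, sub P s x -> (coef P s x)^T = coef P s x,
            forall i j : 'I_N, C1_closure (sub P s) (fun x => coef P s x i j) &
            exists bm bM : R, [/\ 0 < bm, 0 < bM &
              forall x y, sub P s x ->
                bm * enorm y ^+ 2 <= dot y (mulmv (coef P s x) y)
                  <= bM * enorm y ^+ 2]]].

Record mesh (R : realType) (N : nat) := Mesh {
  nvert : nat;
  pt : 'I_nvert -> 'rV[R]_N;
  cells : {set {set 'I_nvert}}
}.
Arguments pt {R N} m _.

(* Integral over R^k as iterated one-dimensional Lebesgue integrals; by Fubini it
   is the k-dimensional Lebesgue integral for the bounded, boundedly supported
   measurable functions integrated below. *)
Fixpoint iter_integral (R : realType) (k : nat) : ('rV[R]_k -> R) -> R :=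
  match k return ('rV[R]_k -> R) -> R with
  | 0 => fun f => f 0
  | k'.+1 => fun f =>
      \int[lebesgue_measure]_(t in [set: R])
        iter_integral (fun y : 'rV[R]_k' =>
                         f (row_mx (t%:M : 'rV[R]_1) y : 'rV[R]_(1 + k')))
  end.

Definition ref_simplex (R : realType) (k : nat) : set 'rV[R]_k :=
  [set y | (forall i, 0 < y 0 i) /\ \sum_i y 0 i < 1].
Arguments ref_simplex : clear implicits.

Section Simplices.
Variables (R : realType) (N : nat) (m : mesh R N).
Local Notation V := 'I_(nvert m).

Definition osimplex (S : {set V}) : set 'rV[R]_N :=
  [set x | exists l : V -> R,
     [/\ forall v, v \in S -> 0 < l v, \sum_(v in S) l v = 1 &
         x = \sum_(v in S) l v *: pt m v]].

Definition csimplex (S : {set V}) : set 'rV[R]_N :=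
  [set x | exists l : V -> R,
     [/\ forall v, v \in S -> 0 <= l v, \sum_(v in S) l v = 1 &
         x = \sum_(v in S) l v *: pt m v]].

(* The relative boundary. *)
Definition simplex_bd (S : {set V}) : set 'rV[R]_N := csimplex S `\` osimplex S.

Definition aff_indep (S : {set V}) : Prop :=
  forall l : V -> R, \sum_(v in S) l v = 0 ->
    \sum_(v in S) l v *: pt m v = 0 -> forall v, v \in S -> l v = 0.

(* Integral over the k-simplex spanned by S (#|S| = k + 1) with respect to the
   k-dimensional surface measure, which is the Lebesgue measure if k = N: pull
   back by the affine parametrization y |-> p_0 + y E over the reference simplex,
   where the rows of E are the edge vectors p_i - p_0, and multiply by the area
   factor sqrt (det (E E^T)). *)
Definition svert (S : {set V}) : seq 'rV[R]_N := [seq pt m v | v <- enum S].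

Definition sedge (S : {set V}) : 'M[R]_(#|S|.-1, N) :=
  \matrix_(i < #|S|.-1) ((svert S)`_i.+1 - (svert S)`_0).

Definition sint (S : {set V}) (f : 'rV[R]_N -> R) : R :=
  Num.sqrt (\det (sedge S *m (sedge S)^T)) *
  iter_integral (fun y : 'rV[R]_#|S|.-1 =>
    \1_(ref_simplex R #|S|.-1) y * f ((svert S)`_0 + y *m sedge S)).

Definition smeas (S : {set V}) : R := sint S (fun=> 1).

Definition hT (T : {set V}) : R := ediam (osimplex T).

Definition mesh_size : R := \big[Num.max/0]_(T in cells m) hT T.

Definition faces_of (T : {set V}) : {set {set V}} :=
  [set F : {set V} | F \subset T & #|F| == N].

Definition star (F : {set V}) : {set {set V}} :=
  [set T in cells m | F \subset T].

Definition faces : {set {set V}} := \bigcup_(T in cells m) faces_of T.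
Definition int_faces : {set {set V}} := [set F in faces | #|star F| == 2%N].
Definition bnd_faces : {set {set V}} := [set F in faces | #|star F| == 1%N].

Definition triangulation (A : set 'rV[R]_N) : Prop :=
  [/\ forall T, T \in cells m -> #|T| = N.+1 /\ aff_indep T,
      closure A = [set x | exists2 T, T \in cells m & csimplex T x] &
      forall T T', T \in cells m -> T' \in cells m ->
        csimplex T `&` csimplex T' = csimplex (T :&: T')].

Definition shape_regular (sigma : R) : Prop :=
  forall T, T \in cells m -> hT T <= sigma * inball_diam (osimplex T).

Definition quasi_uniform (tau : R) : Prop :=
  forall T, T \in cells m -> mesh_size <= tau * hT T.

End Simplices.

(* [fc1 F], [fc2 F] are the elements sharing the interior face F and [fnrm F] is
   the fixed unit normal from the first to the second; for a boundary face,
   [fc1 F] is its element. *)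
Record face_orientation (R : realType) (N : nat) (m : mesh R N) :=
  FaceOrientation {
  fc1 : {set 'I_(nvert m)} -> {set 'I_(nvert m)};
  fc2 : {set 'I_(nvert m)} -> {set 'I_(nvert m)};
  fnrm : {set 'I_(nvert m)} -> 'rV[R]_N
}.

Definition valid_orientation (R : realType) (N : nat) (m : mesh R N)
    (o : face_orientation m) : Prop :=
  (forall F, F \in bnd_faces m -> star F = [set fc1 o F]%SET) /\
  (forall F, F \in int_faces m ->
    [/\ star F = [set fc1 o F; fc2 o F]%SET,
        enorm (fnrm o F) = 1,
        forall a b, a \in F -> b \in F -> dot (fnrm o F) (pt m a - pt m b) = 0 &
        forall a c, a \in F -> c \in fc2 o F :\: F ->
          0 < dot (fnrm o F) (pt m c - pt m a)]).

(* For an interface element T: a point [px T] of the plane L_T, its unit normal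
   [pn T] and its tangent vectors [ptan T i]. *)
Record planes (R : realType) (N : nat) (m : mesh R N) := Planes {
  px : {set 'I_(nvert m)} -> 'rV[R]_N;
  pn : {set 'I_(nvert m)} -> 'rV[R]_N;
  ptan : {set 'I_(nvert m)} -> 'I_N.-1 -> 'rV[R]_N
}.

(* The polynomial q.1 + q.2 . x, whose gradient is q.2. *)
Definition P1 (R : realType) (N : nat) : Type := (R * 'rV[R]_N)%type.

Definition peval (R : realType) (N : nat) (q : P1 R N) (x : 'rV[R]_N) : R :=
  q.1 + dot q.2 x.

Section IFE.
Variables (R : realType) (N : nat) (P : interface_problem R N) (mu : R).
Variables (m : mesh R N) (L : planes m) (o : face_orientation m).
Local Notation V := 'I_(nvert m).
Local Notation pN := 'rV[R]_N.

Definition cut (S : {set V}) : bool := `[< osimplex S `&` itf P !=set0 >].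

Definition itf_cells : {set {set V}} := [set T in cells m | cut T].
Definition itf_faces : {set {set V}} := [set F in faces m | cut F].

(* Both the elements and the faces are open simplices. *)
Definition two_points_on_edges (S : {set V}) : Prop :=
  exists (a b : pN) (e e' : {set V}),
    [/\ [/\ e \subset S, e' \subset S, #|e| = 2%N, #|e'| = 2%N & e != e'],
        a != b, osimplex e a, osimplex e' b &
        itf P `&` simplex_bd S = [set a; b]].

Definition closed_curve (A : set pN) : Prop :=
  exists g : R -> pN,
    [/\ {within `[0, 1], continuous g}, g 0 = g 1,
        {in `[0, 1[ &, injective g} & A = g @` `[0, 1]].

Definition assumption_A1 : Prop :=
  (N = 2%N -> forall T, T \in itf_cells -> two_points_on_edges T) /\
  (N = 3%N ->
     (forall F, F \in itf_faces -> two_points_on_edges F) /\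
     (forall T, T \in itf_cells -> closed_curve (itf P `&` simplex_bd T))).

Definition no_face_in_interface : Prop :=
  forall F, F \in faces m -> ~ (osimplex F `<=` itf P).

Definition plane (T : {set V}) : set pN :=
  [set x | dot (x - px L T) (pn L T) = 0].

Definition cellh (T : {set V}) (s : bool) : set pN :=
  [set x | osimplex T x /\
           0 < (if s then 1 else -1) * dot (x - px L T) (pn L T)].

Definition cellpart (T : {set V}) (s : bool) : set pN :=
  osimplex T `&` sub P s.

Definition valid_planes : Prop :=
  forall T, T \in itf_cells ->
    [/\ enorm (pn L T) = 1,
        forall i j, dot (ptan L T i) (ptan L T j) = (i == j)%:R &
        forall i, dot (ptan L T i) (pn L T) = 0].

Definition assumption_A2 (c : R) : Prop :=
  forall T, T \in itf_cells ->
    (forall F, F \in faces_of T ->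
       osimplex F `&` plane T !=set0 <-> osimplex F `&` itf P !=set0) /\
    exists xt : pN,
      [/\ osimplex T xt, itf P xt,
          forall d, dot d (pn L T) = 0 -> dot (xt - px L T) d = 0 &
          enorm (px L T - xt) + hT T * enorm (pn L T - nrm P xt)
            <= c * hT T ^+ 2].

(* [cellh T s] approximates [cellpart T s]: a face of T that does not meet the
   interface lies on the boundary of [cellh T s] if it lies on that of
   [cellpart T s].  Without this the sides could be swapped on coarse elements,
   where the normal of the plane is only controlled up to O(h_T). *)
Definition consistent_sides : Prop :=
  forall T, T \in itf_cells -> forall F, F \in faces_of T -> ~~ cut F ->
    forall s, osimplex F `<=` bd (cellpart T s) ->
              osimplex F `<=` bd (cellh T s).

Definition xbar (T : {set V}) (i : 'I_N.-1) : pN :=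
  px L T + (mu * hT T) *: ptan L T i.

Definition ST (T : {set V}) : set pN :=
  [set x | exists z : 'I_N.-1 -> R,
     (forall i, 0 <= z i <= mu * hT T) /\
     x = px L T + \sum_i z i *: ptan L T i].

(* rho is the smallest number, in absolute value, such that x + rho n_T lies on
   the interface. *)
Definition smallest_shift (T : {set V}) (x : pN) (rho : R) : Prop :=
  itf P (x + rho *: pn L T) /\
  forall rho', itf P (x + rho' *: pn L T) -> `|rho| <= `|rho'|.

Definition assumption_A3 : Prop :=
  forall T, T \in itf_cells -> forall x, ST T x ->
    exists! rho : R, smallest_shift T x rho.

Definition proj_itf (T : {set V}) (x : pN) : pN :=
  x + xget 0 [set rho | smallest_shift T x rho] *: pn L T.

Definition coefT (T : {set V}) (s : bool) : 'M[R]_N :=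
  coef P s (proj_itf T (px L T)).

Definition patch_content (T : {set V}) : set pN :=
  osimplex T `|` ST T `|` proj_itf T @` ST T.

Definition smallest_ball (A : set pN) : set pN :=
  let cr := xget (0, 0) [set cr : pN * R | A `<=` cball cr.1 cr.2 /\
              forall c r, A `<=` cball c r -> cr.2 <= r] in
  cball cr.1 cr.2.

Definition patch (T : {set V}) : set pN :=
  if T \in itf_cells then smallest_ball (patch_content T) else osimplex T.

Definition assumption_A4 (M : nat) : Prop :=
  forall T, T \in itf_cells ->
    (#|[set T' in cells m | `[< patch T `&` patch T' !=set0 >]]| <= M)%N.

(* The set A lies between the parallel planes e . x = a and e . x = b. *)
Definition slab (A : set pN) (e : pN) (a b : R) : Prop :=
  [/\ enorm e = 1, a <= b & forall x, A x -> a <= dot e x <= b].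

Definition assumption_A5 : Prop :=
  forall T, T \in itf_cells -> forall e a b,
    slab (itf P `&` osimplex T) e a b ->
    (forall e' a' b', slab (itf P `&` osimplex T) e' a' b' ->
       b - a <= b' - a') ->
    b - a <= inball_diam (osimplex T) / 2.

(* A pair (phi^+, phi^-) of polynomials is a function bool -> P1 R N. *)
Definition Jpoint (x : pN) (z : bool -> P1 R N) : R :=
  peval (z true) x - peval (z false) x.

Definition Jflux (T : {set V}) (z : bool -> P1 R N) : R :=
  dot (mulmv (coefT T true) (z true).2) (pn L T) -
  dot (mulmv (coefT T false) (z false).2) (pn L T).

Definition Mface (F T : {set V}) (z : bool -> P1 R N) : R :=
  (smeas F)^-1 *
  (sint F (fun x => \1_(bd (cellh T true)) x * peval (z true) x) +
   sint F (fun x => \1_(bd (cellh T false)) x * peval (z false) x)).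

(* The local function equal to z s on the s-part of T is represented by z, with
   z true = z false if T is not an interface element. *)
Definition VT (T : {set V}) (z : bool -> P1 R N) : Prop :=
  if T \in itf_cells then
    [/\ Jpoint (px L T) z = 0, forall i, Jpoint (xbar T i) z = 0 &
        Jflux T z = 0]
  else z true = z false.

Definition dofT (F T : {set V}) (z : bool -> P1 R N) : R :=
  if T \in itf_cells then Mface F T z
  else (smeas F)^-1 * sint F (peval (z true)).

(* Piecewise linear functions, which may jump across faces and across the
   interface. *)
Definition bfun : Type := {set V} -> bool -> P1 R N.

Definition bfun0 : bfun := fun _ _ => (0, 0).

(* The sign of the part whose closure contains x.  It is used for values inside
   the elements and for traces on the faces, whose points outside the interface
   are interior to a part or, on the boundary of the domain, adherent to the
   + part. *)
Definition side (x : pN) : bool := `[< closure (sub P true) x >].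

Definition coefx (x : pN) : 'M[R]_N := coef P (side x) x.

Definition bval (v : bfun) (T : {set V}) (x : pN) : R := peval (v T (side x)) x.

Definition Vh (v : bfun) : Prop :=
  (forall T, T \in cells m -> VT T (v T)) /\
  (forall F, F \in int_faces m ->
     dofT F (fc1 o F) (v (fc1 o F)) = dofT F (fc2 o F) (v (fc2 o F))).

Definition Vh0 (v : bfun) : Prop :=
  Vh v /\ forall F, F \in bnd_faces m -> sint F (bval v (fc1 o F)) = 0.

Definition jump (v : bfun) (F : {set V}) (x : pN) : R :=
  if F \in int_faces m then bval v (fc1 o F) x - bval v (fc2 o F) x
  else bval v (fc1 o F) x.

(* Piecewise constant vector fields. *)
Definition vfield : Type := {set V} -> bool -> pN.

Definition vfield0 : vfield := fun _ _ => 0.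

Definition vval (q : vfield) (T : {set V}) (x : pN) : pN := q T (side x).

Definition gradh (v : bfun) : vfield := fun T s => (v T s).2.

Definition flux_avg (q : vfield) (F : {set V}) (x : pN) : R :=
  let flux T := dot (mulmv (coefx x) (vval q T x)) (fnrm o F) in
  if F \in int_faces m then (flux (fc1 o F) + flux (fc2 o F)) / 2
  else flux (fc1 o F).

Definition wint (T : {set V}) (q r : vfield) : R :=
  sint T (fun x => dot (mulmv (coefx x) (vval q T x)) (vval r T x)).

Definition QF (F : {set V}) (q : vfield) : Prop :=
  forall T, T \in star F ->
    exists2 z, VT T z & forall s, q T s = (z s).2.

Definition lift (F : {set V}) (g : pN -> R) : vfield :=
  xget vfield0 [set r : vfield | QF F r /\
    forall q, QF F q ->
      \sum_(T in star F) wint T r q =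
      sint F (fun x => g x * flux_avg q F x)].

Definition ah (v w : bfun) : R :=
  \sum_(T in cells m) wint T (gradh v) (gradh w).

Definition bh (v w : bfun) : R :=
  - \sum_(F in itf_faces)
      sint F (fun x => flux_avg (gradh v) F x * jump w F x +
                       flux_avg (gradh w) F x * jump v F x).

Definition sh (v w : bfun) : R :=
  8 * \sum_(F in itf_faces) \sum_(T in star F)
        wint T (lift F (jump v F)) (lift F (jump w F)).

Definition Ah (v w : bfun) : R := ah v w + bh v w + sh v w.

Definition ndof : nat := #|int_faces m|.

Definition ife_basis (i : 'I_ndof) : bfun :=
  xget bfun0 [set v : bfun | Vh0 v /\
    forall F, F \in int_faces m ->
      dofT F (fc1 o F) (v (fc1 o F)) = (F == enum_val i)%:R].

Definition stiff_ife : 'M[R]_ndof :=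
  \matrix_(i, j) Ah (ife_basis i) (ife_basis j).

Definition CR0 (v : bfun) : Prop :=
  (forall T, T \in cells m -> v T true = v T false) /\
  (forall F, F \in faces m -> sint F (jump v F) = 0).

Definition Pihat (v : bfun) : bfun :=
  xget bfun0 [set w : bfun | CR0 w /\
    forall T, T \in cells m ->
      if T \in itf_cells then
        forall F, F \in faces_of T ->
          (smeas F)^-1 * sint F (bval w T) = dofT F T (v T)
      else w T = v T].

Definition stiff_std : 'M[R]_ndof :=
  \matrix_(i, j) ah (Pihat (ife_basis i)) (Pihat (ife_basis j)).

(* The mesh and the planes satisfy the standing assumptions, with the constants
   on which the hidden constants may depend. *)
Definition admissible (sigma tau c : R) (M : nat) : Prop :=
  [/\ [/\ triangulation m (dom P), shape_regular m sigma &
          quasi_uniform m tau],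
      valid_orientation o,
      no_face_in_interface /\ valid_planes,
      consistent_sides &
      [/\ assumption_A1, assumption_A2 c, assumption_A3, assumption_A4 M &
          assumption_A5]].

End IFE.

(* Main.v *)
(* Let w be the function of V_{h,0} whose mean on each interior face is the degree
   of freedom x_F.  Both stiffness matrices are compared with the energy
     D(x) = sum_T |T| |grad w|^2.
   On an interface element a function of the immersed space is z^- + alpha d^+,
   where d is the signed distance to the plane and alpha is fixed by the flux
   condition; the Crouzeix-Raviart interpolant of d^+ has gradient theta n with
   0 <= theta <= 1, so grad w = grad z^- + alpha theta n, and the flux condition
   becomes
     alpha [(1 - theta) n.B^+n + theta n.B^-n] = n.(B^- - B^+) grad w.
   Hence the gradients of the immersed function and of w have comparable sizes, for
   every position of the interface, and the two functions differ by O(h |grad w|).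
   This gives a_h ~ D on the immersed space.  The lifting term s_h absorbs b_h by
   Young's inequality (an element has at most 4 faces), and s_h <= C D because the
   jumps across a face are bounded pointwise by the gradients.

   For the bound by h^-2, D <= C h^(N-2) |x|^2 is an inverse estimate.  The Poincare
   inequality h^N |x|^2 <= C D follows from the identity
     sum_T |T| sum_a lambda_a^T(0) x_{F_a}^2 = 0,
   lambda_a^T being the barycentric coordinate of T that vanishes on F_a: the
   contributions of the two elements of an interior face are opposite signed volumes,
   and x_F = 0 on the boundary.

   Condition numbers of symmetric forms comparable to each other are compared through
   the Cauchy-Schwarz inequality, without eigenvalues. *)

Require Import Defs.
From HB Require Import structures.
From mathcomp Require Import all_boot all_order all_algebra fingroup perm.
From mathcomp Require Import all_classical all_reals all_analysis.
From mathcomp Require Import measurable_realfun ring lra.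

Set Implicit Arguments.
Unset Strict Implicit.
Unset Printing Implicit Defensive.

Import Order.TTheory GRing.Theory Num.Theory.
Import numFieldNormedType.Exports.

Local Open Scope classical_set_scope.
Local Open Scope ring_scope.

(** * Euclidean norm and condition numbers *)

(** The obstacle is uniformity: an element may be cut into a tiny and a large piece, and no constant
    may depend on their ratio. It disappears because theta is the volume fraction of the + side of
    the plane, so the bracket multiplying alpha is a convex combination of two numbers lying between
    the ellipticity constants. That such a theta exists in [0, 1] amounts to the divergence theorem
    for d^+. It is obtained here from closed formulas: the averages of d^+ over segments and
    triangles are divided differences of iterated primitives of the positive part, and the symmetry
    and three-point identities of divided differences give the claim for N = 2 and N = 3.

    The basis functions, their interpolants and the liftings are specified by choice, so each must
    be shown to exist before anything is known about it. On a cut element existence comes from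
    solving the scalar equation for alpha.

    On a boundary face the zero condition concerns the true trace, whereas the degree of freedom is
    split by the plane. The two agree because such a face touches only the + part and, by
    [consistent_sides], only the + side of the plane. *)

Section Dot.
Variables (R : realType) (n : nat).
Implicit Types (u v w : 'rV[R]_n) (a b : R) (A : 'M[R]_n).

Lemma dotE u v : dot u v = \sum_i u 0 i * v 0 i.
Proof. by rewrite /dot mxE; apply: eq_bigr => i _; rewrite mxE. Qed.

Lemma dotC u v : dot u v = dot v u.
Proof. by rewrite !dotE; apply: eq_bigr => i _; rewrite mulrC. Qed.

Lemma dotDl u v w : dot (u + v) w = dot u w + dot v w.
Proof. by rewrite /dot mulmxDl mxE. Qed.

Lemma dotDr u v w : dot w (u + v) = dot w u + dot w v.
Proof. by rewrite !(dotC w) dotDl. Qed.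

Lemma dotZl a u v : dot (a *: u) v = a * dot u v.
Proof. by rewrite /dot -scalemxAl mxE. Qed.

Lemma dotZr a u v : dot v (a *: u) = a * dot v u.
Proof. by rewrite !(dotC v) dotZl. Qed.

Lemma dotNl u v : dot (- u) v = - dot u v.
Proof. by rewrite -scaleN1r dotZl mulN1r. Qed.

Lemma dotNr u v : dot v (- u) = - dot v u.
Proof. by rewrite !(dotC v) dotNl. Qed.

Lemma dotBl u v w : dot (u - v) w = dot u w - dot v w.
Proof. by rewrite dotDl dotNl. Qed.

Lemma dotBr u v w : dot w (u - v) = dot w u - dot w v.
Proof. by rewrite dotDr dotNr. Qed.

Lemma dot0l u : dot 0 u = 0.
Proof. by rewrite /dot mul0mx mxE. Qed.

Lemma dot0r u : dot u 0 = 0.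
Proof. by rewrite dotC dot0l. Qed.

Lemma dot_suml (I : Type) (r : seq I) (Q : pred I) (F : I -> 'rV[R]_n) u :
  dot (\sum_(i <- r | Q i) F i) u = \sum_(i <- r | Q i) dot (F i) u.
Proof.
apply: (big_morph (fun x => dot x u)) => [x y|]; first by rewrite dotDl.
by rewrite dot0l.
Qed.

Lemma dot_sumr (I : Type) (r : seq I) (Q : pred I) (F : I -> 'rV[R]_n) u :
  dot u (\sum_(i <- r | Q i) F i) = \sum_(i <- r | Q i) dot u (F i).
Proof. by rewrite dotC dot_suml; apply: eq_bigr => i _; rewrite dotC. Qed.

Lemma dot_ge0 u : 0 <= dot u u.
Proof. by rewrite dotE sumr_ge0 // => i _; rewrite -expr2 sqr_ge0. Qed.

Lemma dot_eq0 u : (dot u u == 0) = (u == 0).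
Proof.
apply/eqP/eqP => [|->]; last by rewrite dot0l.
rewrite dotE => /eqP; rewrite psumr_eq0; last first.
  by move=> i _; rewrite -expr2 sqr_ge0.
move=> /allP h; apply/rowP => i; rewrite mxE.
by have := h i (mem_index_enum _); rewrite /= mulf_eq0 orbb => /eqP.
Qed.

Lemma enorm_ge0 u : 0 <= enorm u.
Proof. exact: sqrtr_ge0. Qed.

Lemma enorm_sq u : enorm u ^+ 2 = dot u u.
Proof. by rewrite /enorm sqr_sqrtr // dot_ge0. Qed.

Lemma enorm0 : enorm (0 : 'rV[R]_n) = 0.
Proof. by rewrite /enorm dot0l sqrtr0. Qed.

Lemma enorm_eq0 u : (enorm u == 0) = (u == 0).
Proof. by rewrite -dot_eq0 -enorm_sq sqrf_eq0. Qed.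

Lemma enormZ a u : enorm (a *: u) = `|a| * enorm u.
Proof.
by rewrite /enorm dotZl dotZr mulrA -expr2 sqrtrM ?sqr_ge0 // sqrtr_sqr.
Qed.

Lemma enormN u : enorm (- u) = enorm u.
Proof. by rewrite /enorm dotNl dotNr opprK. Qed.

Lemma enormBC u v : enorm (u - v) = enorm (v - u).
Proof. by rewrite -opprB enormN. Qed.

End Dot.

(** The minimizer t = -b / c settles c > 0. For c <= 0 a suitable t makes the quadratic negative
    unless b = c = 0. *)
Lemma discr_le0 (R : realFieldType) (a b c : R) :
  (forall t, 0 <= a + 2 * b * t + c * t ^+ 2) -> b ^+ 2 <= a * c.
Proof.
move=> h.
have a0 : 0 <= a by have := h 0; rewrite mulr0 expr0n /= mulr0 !addr0.
have [c0|c0|c0] := ltgtP c 0.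
- exfalso.
  (* Chosen so that - c t = 2 |b| + a + 1 - c, hence c t^2 outweighs the other two terms once t >=
     1. *)
  pose t := (2 * `|b| + a + 1) / (- c) + 1.
  have nc : 0 < - c by rewrite oppr_gt0.
  have t1 : 1 <= t.
    rewrite /t lerDr divr_ge0 ?ltW //.
    by have b0 := normr_ge0 b; lra.
  have e : - c * t = 2 * `|b| + a + 1 - c.
    by rewrite /t mulrDr mulr1 mulrC divfK // gt_eqF.
  have := h t; apply/negP; rewrite -ltNge.
  have : 2 * b * t <= 2 * `|b| * t.
    by rewrite ler_wpM2r ?ler_wpM2l ?ler_norm //; lra.
  have b0 := normr_ge0 b.
  nra.
- have := h (- b / c); have -> : a + 2 * b * (- b / c) + c * (- b / c) ^+ 2
     = (a * c - b ^+ 2) / c by field; rewrite gt_eqF.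
  by rewrite pmulr_lge0 ?invr_gt0 // subr_ge0.
- subst c; rewrite mulr0.
  suff -> : b = 0 by rewrite expr0n.
  apply/eqP/negP => /negP b0.
  have := h (- (a + 1) / (2 * b)); rewrite mul0r addr0.
  have -> : 2 * b * (- (a + 1) / (2 * b)) = - (a + 1) by field.
  by apply/negP; rewrite -ltNge; lra.
Qed.

Section Norms.
Variables (R : realType) (n : nat).
Implicit Types (u v w : 'rV[R]_n) (a b : R) (A : 'M[R]_n).

Lemma dot_cs_sq u v : dot u v ^+ 2 <= dot u u * dot v v.
Proof.
apply: discr_le0 => t.
have := dot_ge0 (u + t *: v).
rewrite dotDl !dotDr !dotZl !dotZr (dotC v u); set p := dot u u; set q := dot u v.
set r := dot v v => h; apply: le_trans h _; rewrite le_eqVlt; apply/orP; left.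
by apply/eqP; ring.
Qed.

Lemma dot_cs u v : `|dot u v| <= enorm u * enorm v.
Proof.
rewrite -(@ler_pXn2r _ 2) ?nnegrE ?mulr_ge0 ?enorm_ge0 //.
by rewrite real_normK ?num_real // exprMn !enorm_sq dot_cs_sq.
Qed.

Lemma dot_le u v : dot u v <= enorm u * enorm v.
Proof. exact: le_trans (ler_norm _) (dot_cs u v). Qed.

Lemma enormD u v : enorm (u + v) <= enorm u + enorm v.
Proof.
rewrite -(@ler_pXn2r _ 2) ?nnegrE ?addr_ge0 ?enorm_ge0 //.
rewrite enorm_sq dotDl !dotDr (dotC v u) sqrrD !enorm_sq.
have := dot_le u v; lra.
Qed.

Lemma enormB u v : enorm (u - v) <= enorm u + enorm v.
Proof. by rewrite -[enorm v]enormN enormD. Qed.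

Lemma enormB_trans v u w : enorm (u - w) <= enorm (u - v) + enorm (v - w).
Proof. by rewrite -(subrKA v) enormD. Qed.

(** Test with u / |u|. A norm bound is thereby reduced to linear inequalities, which pass easily to
    the closure of a set. *)
Lemma enorm_le_of_dot u a : 0 <= a ->
  (forall v, enorm v = 1 -> dot u v <= a) -> enorm u <= a.
Proof.
move=> a0 h; have [->|u0] := eqVneq u 0; first by rewrite enorm0.
have e0 : 0 < enorm u by rewrite lt_neqAle enorm_ge0 andbT eq_sym enorm_eq0.
have := h ((enorm u)^-1 *: u); rewrite enormZ ger0_norm ?invr_ge0 ?enorm_ge0 //.
rewrite mulVf ?gt_eqF // dotZr -enorm_sq expr2 mulrA mulVf ?gt_eqF // mul1r.
exact.
Qed.

Lemma mulmvD A u v : mulmv A (u + v) = mulmv A u + mulmv A v.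
Proof. by rewrite /mulmv mulmxDl. Qed.

Lemma mulmvZ A a u : mulmv A (a *: u) = a *: mulmv A u.
Proof. by rewrite /mulmv scalemxAl. Qed.

Lemma mulmv0 A : mulmv A 0 = 0.
Proof. by rewrite /mulmv mul0mx. Qed.

Lemma mulmvB A u v : mulmv A (u - v) = mulmv A u - mulmv A v.
Proof. by rewrite mulmvD -scaleN1r mulmvZ scaleN1r. Qed.

Lemma mulmvA A B u : mulmv (A *m B) u = mulmv A (mulmv B u).
Proof. by rewrite /mulmv trmx_mul mulmxA. Qed.

Lemma mulmv1 u : mulmv 1%:M u = u.
Proof. by rewrite /mulmv trmx1 mulmx1. Qed.

Lemma dot_mulmv A u v : dot (mulmv A u) v = dot u (mulmv A^T v).
Proof. by rewrite /dot /mulmv trmxK trmx_mul mulmxA. Qed.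

Lemma dot_mulmvE A u v :
  dot (mulmv A u) v = \sum_i \sum_j u 0 j * A i j * v 0 i.
Proof.
rewrite dotE; apply: eq_bigr => i _; rewrite mxE mulr_suml.
by apply: eq_bigr => j _; rewrite mxE.
Qed.

End Norms.

(** * Quadratic forms and the comparison of condition numbers *)

Definition psd_form (R : realType) n (A : 'M[R]_n) :=
  A^T = A /\ forall x : 'rV[R]_n, 0 <= dot (mulmv A x) x.

Section Condition.
Variables (R : realType) (n : nat).
Implicit Types (u v x y : 'rV[R]_n) (A B : 'M[R]_n).

Lemma psd_cs A u v : psd_form A ->
  dot (mulmv A u) v ^+ 2 <= dot (mulmv A u) u * dot (mulmv A v) v.
Proof.
move=> [As A0]; apply: discr_le0 => t.
have := A0 (u + t *: v).
have e : dot (mulmv A v) u = dot (mulmv A u) v by rewrite dot_mulmv As dotC.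
rewrite mulmvD mulmvZ dotDl !dotDr !dotZl !dotZr e.
move: (dot (mulmv A u) u) (dot (mulmv A u) v) (dot (mulmv A v) v) => p q r h.
by apply: le_trans h _; rewrite le_eqVlt; apply/orP; left; apply/eqP; ring.
Qed.

(** Cauchy-Schwarz for the form at x and y = A x gives |y|^4 <= (A x . x)(A y . y) <= K^2 |x|^2
    |y|^2. This step replaces the spectral theorem. *)
Lemma psd_bound A K : 0 <= K -> psd_form A ->
  (forall x, dot (mulmv A x) x <= K * enorm x ^+ 2) ->
  forall x, enorm (mulmv A x) <= K * enorm x.
Proof.
move=> K0 hA hK x.
set y := mulmv A x.
have h : enorm y ^+ 2 ^+ 2 <= (K * enorm x ^+ 2) * (K * enorm y ^+ 2).
  rewrite [X in X ^+ 2 <= _]enorm_sq.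
  apply: le_trans (psd_cs x y hA) _.
  by apply: ler_pM => //; apply: (hA.2).
have [->|y0] := eqVneq (enorm y) 0; first by rewrite mulr_ge0 ?enorm_ge0.
have yp : 0 < enorm y by rewrite lt_neqAle eq_sym y0 enorm_ge0.
rewrite -(@ler_pXn2r _ 2) ?nnegrE ?mulr_ge0 ?enorm_ge0 //.
rewrite -(@ler_pM2r _ (enorm y ^+ 2)) ?exprn_gt0 //.
apply: le_trans (le_trans h _); first by rewrite -expr2.
by rewrite le_eqVlt; apply/orP; left; apply/eqP; ring.
Qed.

Lemma opnorm2_set_ubound A K : 
  (forall x, enorm (mulmv A x) <= K * enorm x) -> 0 <= K ->
  ubound [set enorm (mulmv A x) | x in [set x : 'rV[R]_n | enorm x <= 1]] K.
Proof.
move=> h K0 _ [x /= x1 <-]; apply: le_trans (h x) _.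
by rewrite -[leRHS]mulr1 ler_wpM2l.
Qed.

Lemma opnorm2_le A K : 0 <= K ->
  (forall x, enorm (mulmv A x) <= K * enorm x) -> opnorm2 A <= K.
Proof.
move=> K0 h; apply: ge_sup; last exact: opnorm2_set_ubound.
by exists (enorm (mulmv A 0)); exists 0 => //=; rewrite enorm0.
Qed.

Lemma mulmv_bounded A : exists2 K, 0 <= K &
  forall x, enorm (mulmv A x) <= K * enorm x.
Proof.
pose K2 := \sum_i dot (row i A) (row i A).
have K20 : 0 <= K2 by apply: sumr_ge0 => i _; apply: dot_ge0.
exists (Num.sqrt K2) => [|x]; first exact: sqrtr_ge0.
rewrite -(@ler_pXn2r _ 2) ?nnegrE ?mulr_ge0 ?sqrtr_ge0 ?enorm_ge0 //.
rewrite exprMn (sqr_sqrtr K20) !enorm_sq mulr_suml dotE.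
apply: ler_sum => i _.
have -> : mulmv A x 0 i = dot (row i A) x.
  by rewrite /mulmv mxE dotE; apply: eq_bigr => j _; rewrite !mxE mulrC.
by rewrite -expr2 dot_cs_sq.
Qed.

Lemma enorm_mulmv_le A x : enorm (mulmv A x) <= opnorm2 A * enorm x.
Proof.
have [K K0 hK] := mulmv_bounded A.
have [x0|x0] := eqVneq (enorm x) 0.
  have /eqP -> : x == 0 by rewrite -enorm_eq0 x0.
  by rewrite mulmv0 enorm0 mulr0.
have xp : 0 < enorm x by rewrite lt_neqAle eq_sym x0 enorm_ge0.
rewrite -ler_pdivrMr // mulrC.
have -> : (enorm x)^-1 * enorm (mulmv A x) = enorm (mulmv A ((enorm x)^-1 *: x)).
  by rewrite mulmvZ enormZ ger0_norm // invr_ge0 ltW.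
apply: ub_le_sup; first by exists K; apply: opnorm2_set_ubound.
exists ((enorm x)^-1 *: x) => //=.
by rewrite enormZ ger0_norm ?invr_ge0 ?(ltW xp) // mulVf.
Qed.

Lemma opnorm2_ge0 A : 0 <= opnorm2 A.
Proof.
have [K K0 hK] := mulmv_bounded A.
apply: (@le_trans _ _ (enorm (mulmv A 0))); first exact: enorm_ge0.
apply: ub_le_sup; first by exists K; apply: opnorm2_set_ubound.
by exists 0 => //=; rewrite enorm0.
Qed.

Lemma unitmx_coercive A : (forall x, x != 0 -> 0 < dot (mulmv A x) x) ->
  A \in unitmx.
Proof.
move=> h; rewrite -unitmx_tr -row_free_unit -kermx_eq0.
apply/negP => /negP /rowV0Pn [v /sub_kermxP vA v0].
by have := h v v0; rewrite /mulmv vA dot0l ltxx.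
Qed.

Lemma psd_upper A x : psd_form A ->
  dot (mulmv A x) x <= opnorm2 A * enorm x ^+ 2.
Proof.
move=> _; apply: le_trans (dot_le _ _) _.
by rewrite expr2 mulrA ler_wpM2r ?enorm_ge0 // enorm_mulmv_le.
Qed.

Lemma psd_inv A : A \in unitmx -> psd_form A -> psd_form (invmx A).
Proof.
move=> uA [As A0]; split; first by rewrite trmx_inv As.
move=> x; have := A0 (mulmv (invmx A) x).
by rewrite -mulmvA mulmxV // mulmv1 dotC.
Qed.

(** Cauchy-Schwarz for the form of the inverse B, at A x and x: since B A x = x it reads |x|^4 <= (A
    x . x)(B x . x), and the last factor is at most |B| |x|^2. *)
Lemma psd_lower A x : A \in unitmx -> psd_form A ->
  enorm x ^+ 2 <= opnorm2 (invmx A) * dot (mulmv A x) x.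
Proof.
move=> uA hA; set B := invmx A.
have hB := psd_inv uA hA.
have [->|x0] := eqVneq x 0.
  by rewrite enorm0 expr0n /= dot0r mulr0.
have e : mulmv B (mulmv A x) = x by rewrite -mulmvA mulVmx // mulmv1.
have := psd_cs (mulmv A x) x hB; rewrite e -enorm_sq.
have -> : dot x (mulmv A x) = dot (mulmv A x) x by rewrite dotC.
move=> h; have xp : 0 < enorm x ^+ 2.
  by rewrite exprn_gt0 // lt_neqAle enorm_ge0 eq_sym enorm_eq0 x0.
rewrite -(@ler_pM2r _ (enorm x ^+ 2)) // -expr2; apply: le_trans h _.
rewrite [leRHS]mulrAC mulrC ler_wpM2r ?(hA.2) //.
exact: psd_upper.
Qed.

(** For x = A^-1 y coercivity gives k |x|^2 <= x . y, hence k |x| <= |y|. This bounds the form of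
    the inverse, and [psd_bound] turns it into a bound on the norm. *)
Lemma inv_bound A k : 0 < k -> psd_form A ->
  (forall x, k * enorm x ^+ 2 <= dot (mulmv A x) x) ->
  A \in unitmx /\ opnorm2 (invmx A) <= k^-1.
Proof.
move=> k0 hA hk.
have uA : A \in unitmx.
  apply: unitmx_coercive => x x0; apply: lt_le_trans (hk x).
  by rewrite mulr_gt0 // exprn_gt0 // lt_neqAle enorm_ge0 eq_sym enorm_eq0 x0.
split => //; apply: opnorm2_le; first by rewrite invr_ge0 ltW.
apply: psd_bound; [by rewrite invr_ge0 ltW|exact: psd_inv|].
move=> y; set x := mulmv (invmx A) y.
have e : mulmv A x = y by rewrite -mulmvA mulmxV // mulmv1.
have := hk x; rewrite e dotC => h.
have h2 : dot x y <= enorm x * enorm y := dot_le x y.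
have [x0|x0] := eqVneq (enorm x) 0.
  rewrite (le_trans h2) // x0 mul0r mulr_ge0 ?invr_ge0 ?(ltW k0) //.
  by rewrite exprn_ge0 // enorm_ge0.
have xp : 0 < enorm x by rewrite lt_neqAle eq_sym x0 enorm_ge0.
have h3 : k * enorm x <= enorm y.
  rewrite -(ler_pM2r xp) -mulrA -expr2; apply: le_trans h _.
  by rewrite mulrC.
have h4 : enorm x <= k^-1 * enorm y.
  by rewrite -(ler_pM2l k0) mulrA mulfV ?gt_eqF // mul1r.
apply: le_trans h2 _; rewrite expr2 mulrA ler_wpM2r ?enorm_ge0 //.
Qed.

Lemma cond2_le A B c1 c2 : 0 < c1 -> 0 < c2 -> psd_form A -> psd_form B ->
  (forall x, c1 * dot (mulmv B x) x <= dot (mulmv A x) x) ->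
  (forall x, dot (mulmv A x) x <= c2 * dot (mulmv B x) x) ->
  (cond2 A <= (c2 / c1)%:E * cond2 B)%E.
Proof.
move=> c10 c20 hA hB h1 h2.
rewrite {2}/cond2; case: ifPn => uB; last by rewrite gt0_muley ?leey // lte_fin divr_gt0.
(* In dimension 0 the norm of the inverse of B is 0, while the division below needs it positive. *)
case: (posnP n) => [n0|n0].
  have cA : opnorm2 A <= 0.
    apply: opnorm2_le => // x; rewrite mul0r.
    suff -> : mulmv A x = 0 by rewrite enorm0.
    by apply/rowP => -[i hi]; exfalso; move: hi; rewrite n0.
  have uA : A \in unitmx.
    by apply: unitmx_coercive => x; case/rV0Pn => -[i hi]; exfalso; move: hi; rewrite n0.
  rewrite /cond2 uA -EFinM lee_fin.
  apply: (@le_trans _ _ 0); last first.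
    by rewrite mulr_ge0 ?divr_ge0 ?(ltW c10) ?(ltW c20) // mulr_ge0 // opnorm2_ge0.
  by rewrite mulr_le0_ge0 // opnorm2_ge0.
have b0 : 0 < opnorm2 (invmx B).
  have x0 : (delta_mx 0 (Ordinal n0) : 'rV[R]_n) != 0.
    by apply/rV0Pn; exists (Ordinal n0); rewrite mxE !eqxx oner_neq0.
  have := psd_lower (delta_mx 0 (Ordinal n0)) uB hB.
  rewrite lt_neqAle opnorm2_ge0 andbT => h; apply/eqP => e0.
  move: h; rewrite -e0 mul0r => /le_gtF /negP; apply.
  by rewrite exprn_gt0 // lt_neqAle enorm_ge0 eq_sym enorm_eq0 x0.
have [uA iA] : A \in unitmx /\ opnorm2 (invmx A) <= (c1 / opnorm2 (invmx B))^-1.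
  apply: inv_bound => // [|x]; first by rewrite divr_gt0.
  apply: le_trans (h1 x); rewrite -mulrA ler_wpM2l ?(ltW c10) //.
  by rewrite mulrC ler_pdivrMr // mulrC psd_lower.
have oA : opnorm2 A <= c2 * opnorm2 B.
  apply: opnorm2_le; first by rewrite mulr_ge0 ?opnorm2_ge0 ?ltW.
  apply: psd_bound => //; first by rewrite mulr_ge0 ?opnorm2_ge0 ?ltW.
  by move=> x; apply: le_trans (h2 x) _; rewrite -mulrA ler_wpM2l ?(ltW c20) // psd_upper.
rewrite /cond2 uA -EFinM lee_fin.
apply: le_trans (ler_pM (opnorm2_ge0 _) (opnorm2_ge0 _) oA iA) _.
rewrite invf_div le_eqVlt; apply/orP; left; apply/eqP; field.
by rewrite !gt_eqF.
Qed.

Lemma cond2_bound A c1 c2 : 0 < c1 -> 0 <= c2 -> psd_form A ->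
  (forall x, c1 * enorm x ^+ 2 <= dot (mulmv A x) x) ->
  (forall x, dot (mulmv A x) x <= c2 * enorm x ^+ 2) ->
  (cond2 A <= (c2 / c1)%:E)%E.
Proof.
move=> c10 c20 hA h1 h2; have [uA iA] := inv_bound c10 hA h1.
rewrite /cond2 uA lee_fin; apply: ler_pM => //; rewrite ?opnorm2_ge0 //.
by apply: opnorm2_le => //; apply: psd_bound.
Qed.

(** Coercivity makes the Gram matrix of b in the standard basis invertible. The result is used to
    build the liftings one element at a time. *)
Lemma riesz_rV (b : 'rV[R]_n -> 'rV[R]_n -> R) (l : 'rV[R]_n -> R) :
  (forall a u v w, b (a *: u + v) w = a * b u w + b v w) ->
  (forall a u v w, b w (a *: u + v) = a * b w u + b w v) ->
  (forall a u v, l (a *: u + v) = a * l u + l v) ->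
  (forall u, u != 0 -> 0 < b u u) ->
  exists r, forall v, b r v = l v.
Proof.
move=> bl br ll b0.
have l0 : l 0 = 0 by have := ll (-1) 0 0; rewrite scaler0 addr0 mulN1r addNr.
have br0 u : b u 0 = 0 by have := br (-1) 0 0 u; rewrite scaler0 addr0 mulN1r addNr.
have bl0 u : b 0 u = 0 by have := bl (-1) 0 0 u; rewrite scaler0 addr0 mulN1r addNr.
have lsum x : l x = \sum_i x 0 i * l (delta_mx 0 i).
  rewrite {1}[x]row_sum_delta; elim/big_rec2: _ => [//|i y1 y2 _ <-].
  by rewrite ll.
have blsum x w : b x w = \sum_i x 0 i * b (delta_mx 0 i) w.
  rewrite {1}[x]row_sum_delta; elim/big_rec2: _ => [//|i y1 y2 _ <-].
  by rewrite bl.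
have brsum x w : b w x = \sum_i x 0 i * b w (delta_mx 0 i).
  rewrite {1}[x]row_sum_delta; elim/big_rec2: _ => [//|i y1 y2 _ <-].
  by rewrite br.
pose G : 'M[R]_n := \matrix_(i, j) b (delta_mx 0 j) (delta_mx 0 i).
have bG x y : dot (mulmv G x) y = b x y.
  rewrite dot_mulmvE exchange_big /= blsum; apply: eq_bigr => j _.
  rewrite brsum mulr_sumr; apply: eq_bigr => i _; rewrite mxE; ring.
have uG : G \in unitmx by apply: unitmx_coercive => x x0; rewrite bG b0.
exists (mulmv (invmx G) (\row_i l (delta_mx 0 i))) => v.
rewrite -bG -mulmvA mulmxV // mulmv1 dotE lsum; apply: eq_bigr => i _.
by rewrite mxE mulrC.
Qed.

End Condition.

(** * Iterated integrals *)

Section Measurability.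
Variable R : realType.

(* The library has no sigma-algebra on row vectors: Borel measurability is tested
   on all coordinatewise measurable maps into R^k. *)
Definition rvmeas (k : nat) (f : 'rV[R]_k -> R) : Prop :=
  forall d (Z : measurableType d) (g : Z -> 'rV[R]_k),
    (forall i, measurable_fun setT (fun z => g z 0 i)) ->
    measurable_fun setT (fun z => f (g z)).

Definition rvmset (k : nat) (A : set 'rV[R]_k) : Prop :=
  forall d (Z : measurableType d) (g : Z -> 'rV[R]_k),
    (forall i, measurable_fun setT (fun z => g z 0 i)) ->
    measurable (g @^-1` A).

Lemma rvmset_indic k (A : set 'rV[R]_k) : rvmset A -> rvmeas (\1_A).
Proof.
move=> mA d Z g mg.
rewrite (_ : (fun z => \1_A (g z)) = \1_(g @^-1` A)); last first.
  by apply/funext => z; rewrite !indicE; congr (_%:R); apply/idP/idP; rewrite !inE.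
exact/measurable_indic/mA.
Qed.

(** An open set is the union of the countably many boxes with rational center and radius 1/(n+1)
    that it contains, and the preimage of a box is a finite intersection of conditions on
    coordinates. *)
Lemma rvmset_open k (A : set 'rV[R]_k) : open A -> rvmset A.
Proof.
move=> oA d Z g mg.
pose box (p : 'rV[rat]_k * nat) : set 'rV[R]_k :=
  [set y | forall i, `|y 0 i - ratr (p.1 0 i)| < p.2.+1%:R^-1].
have -> : A = \bigcup_(p in [set p | box p `<=` A]) box p.
  apply/seteqP; split=> [x Ax|x [p pA px]]; last exact: pA.
  have : nbhs x A by exact: open_nbhs_nbhs.
  rewrite -nbhs_ballE => -[e /= e0 eA].
  have [n ne] : exists n : nat, n.+1%:R^-1 < e / 2.
    exists (Num.truncn (e / 2)^-1); rewrite invf_plt ?posrE ?divr_gt0 //.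
    by apply: truncnS_gt.
  have q_ i : {q : rat | ratr q \in `]x 0 i - n.+1%:R^-1, x 0 i + n.+1%:R^-1[}.
    apply/cid; have [|q hq] := @rat_in_itvoo R (x 0 i - n.+1%:R^-1) (x 0 i + n.+1%:R^-1).
      by rewrite ltrD2l gtrN // invr_gt0.
    by exists q.
  exists (\row_i projT1 (q_ i), n).
    move=> y /= hy; apply: eA; split=> // i j; rewrite ord1.
    have := projT2 (q_ j); have := hy j; rewrite /= mxE /ball /=.
    move: (ratr _) => q h3; rewrite in_itv /= -ltr_distlC => h1.
    rewrite -(subrKA q); apply: le_lt_trans (ler_normD _ _) _.
    rewrite [ltRHS](splitr e) ltrD // ?(lt_trans _ ne) //; last by rewrite distrC.
  by move=> i /=; rewrite mxE; have := projT2 (q_ i); rewrite in_itv /= -ltr_distlC.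
rewrite preimage_bigcup bigcup_mkcond; apply: countable_bigcupT_measurable => [|p].
  exact: countableP.
case: ifPn => // _.
have -> : g @^-1` box p =
    \bigcap_(i in [set: 'I_k]) [set z | `|g z 0 i - ratr (p.1 0 i)| < p.2.+1%:R^-1].
  by apply/seteqP; split=> [z hz i _|z hz i]; [exact: hz|exact: (hz i I)].
apply: fin_bigcap_measurable => // i _.
have mi : measurable_fun setT (fun z => `|g z 0 i - ratr (p.1 0 i)|).
  by apply: measurableT_comp => //; apply: measurable_funB.
rewrite -[X in measurable X]setTI.
have -> : [set z | `|g z 0 i - ratr (p.1 0 i)| < p.2.+1%:R^-1] =
   (fun z => `|g z 0 i - ratr (p.1 0 i)|) @^-1` `]-oo, p.2.+1%:R^-1[.
  by apply/seteqP; split=> z /=; rewrite in_itv.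
exact: mi.
Qed.

Lemma rvmsetC k (A : set 'rV[R]_k) : rvmset A -> rvmset (~` A).
Proof. by move=> mA d Z g mg; rewrite preimage_setC; apply: measurableC; apply: mA. Qed.

Lemma rvmsetI k (A B : set 'rV[R]_k) : rvmset A -> rvmset B -> rvmset (A `&` B).
Proof.
by move=> mA mB d Z g mg; rewrite preimage_setI; apply: measurableI; [apply: mA|apply: mB].
Qed.

Lemma rvmset_closed k (A : set 'rV[R]_k) : closed A -> rvmset A.
Proof.
by move=> cA; rewrite -[A]setCK; apply: rvmsetC; apply: rvmset_open; apply: closed_openC.
Qed.

Lemma rvmeas_cst k (c : R) : rvmeas (fun _ : 'rV[R]_k => c).
Proof. by move=> d Z g mg; apply: measurable_cst. Qed.

Lemma rvmeas_coord k (i : 'I_k) : rvmeas (fun y : 'rV[R]_k => y 0 i).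
Proof. by move=> d Z g mg; apply: mg. Qed.

Lemma rvmeasD k (f g : 'rV[R]_k -> R) :
  rvmeas f -> rvmeas g -> rvmeas (fun y => f y + g y).
Proof. by move=> mf mg d Z h mh; apply: measurable_funD; [apply: mf|apply: mg]. Qed.

Lemma rvmeasM k (f g : 'rV[R]_k -> R) :
  rvmeas f -> rvmeas g -> rvmeas (fun y => f y * g y).
Proof. by move=> mf mg d Z h mh; apply: measurable_funM; [apply: mf|apply: mg]. Qed.

Lemma rvmeas_sum k (I : Type) (r : seq I) (f : I -> 'rV[R]_k -> R) :
  (forall i, rvmeas (f i)) -> rvmeas (fun y => \sum_(i <- r) f i y).
Proof.
move=> mf; elim: r => [|i r ih].
  by under eq_fun do rewrite big_nil; apply: rvmeas_cst.
under eq_fun do rewrite big_cons.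
exact: (rvmeasD (mf i) ih).
Qed.

Lemma rvmeas_comp1 k (f : 'rV[R]_k -> R) (h : R -> R) :
  measurable_fun setT h -> rvmeas f -> rvmeas (fun y => h (f y)).
Proof. by move=> mh mf d Z g mg; apply: measurableT_comp => //; apply: mf. Qed.

Lemma rvmeas_comp k l (f : 'rV[R]_k -> R) (h : 'rV[R]_l -> 'rV[R]_k) :
  rvmeas f -> (forall i, rvmeas (fun y => h y 0 i)) -> rvmeas (fun y => f (h y)).
Proof. by move=> mf mh d Z g mg; apply: mf => i; apply: mh. Qed.

Lemma rvmset_comp k l (A : set 'rV[R]_k) (h : 'rV[R]_l -> 'rV[R]_k) :
  rvmset A -> (forall i, rvmeas (fun y => h y 0 i)) -> rvmset (h @^-1` A).
Proof. by move=> mA mh d Z g mg; apply: (mA _ _ (fun z => h (g z))) => i; apply: mh. Qed.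

Lemma rvmset_lt k (f g : 'rV[R]_k -> R) :
  rvmeas f -> rvmeas g -> rvmset [set y | f y < g y].
Proof.
move=> mf mg d Z h mh; have := measurable_fun_ltr (mf _ _ _ mh) (mg _ _ _ mh).
move=> /(_ measurableT [set true] I); rewrite setTI.
by congr measurable; apply/seteqP; split => z.
Qed.

Lemma rvmeas_if k (A : set 'rV[R]_k) (f g : 'rV[R]_k -> R) :
  rvmset A -> rvmeas f -> rvmeas g ->
  rvmeas (fun y => if `[< A y >] then f y else g y).
Proof.
move=> mA mf mg.
have -> : (fun y => if `[< A y >] then f y else g y) =
  (fun y => \1_A y * f y + \1_(~` A) y * g y).
  apply/funext => y; rewrite !indicE; case: asboolP => h.
    by rewrite mem_set // memNset ?mul1r ?mul0r ?addr0 //=; apply.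
  by rewrite memNset // mem_set ?mul1r ?mul0r ?add0r //=.
apply: rvmeasD; apply: rvmeasM => //; apply: rvmset_indic => //.
exact: rvmsetC.
Qed.

(** The coefficient is continuous only relative to the closure of one part. Superlevel sets relative
    to K are traces of open sets on K, and the indicator discards the rest. *)
Lemma rvmeas_within k (K : set 'rV[R]_k) (f : 'rV[R]_k -> R) :
  closed K -> {within K, continuous f} -> rvmeas (fun y => \1_K y * f y).
Proof.
move=> cK cf d Z g mg.
have mK : measurable (g @^-1` K) by apply: rvmset_closed.
have mf : measurable_fun (g @^-1` K) (fun z => f (g z)).
  move=> mD; apply: (measurability _ (RGenOInfty.measurableE R)) => //.
  move=> _ [_ [a ->] <-].
  have oI : open (`]a, +oo[%classic : set R) by apply: interval_open.
  have oP : forall A : set R, open A -> open ((f : subspace K -> R) @^-1` A).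
    by apply/continuousP.
  have oS := oP `]a, +oo[%classic oI.
  have [U oU eU] := (open_subspaceP _ _).1 oS.
  have -> : g @^-1` K `&` (fun z => f (g z)) @^-1` `]a, +oo[ = g @^-1` K `&` g @^-1` U.
    apply/seteqP; split=> z [Kz h]; split=> //.
      have : (U `&` K) (g z) by rewrite eU; split.
      by case.
    have : (f @^-1` `]a, +oo[ `&` K) (g z) by rewrite -eU; split.
    by case.
  by apply: measurableI => //; apply: rvmset_open.
rewrite (_ : (fun z => _) = (fun z => f (g z)) \_ (g @^-1` K)); last first.
  apply/funext => z; rewrite patchE indicE; case: ifPn => h.
    by rewrite mem_set ?mul1r //; move: h; rewrite inE.
  by rewrite memNset ?mul0r //; move: h => /negP h1 h2; apply: h1; rewrite inE.
by apply/(measurable_restrictT _ _).1.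
Qed.

End Measurability.

(** * Bounded functions supported in the unit interval *)

Section UnitInterval.
Variable R : realType.
Local Notation mu := (@lebesgue_measure R).
Implicit Types (h : R -> R) (K : R).

Lemma lebesgue01 : mu (`[0, 1] : set R) = 1%E.
Proof. by rewrite lebesgue_measure_itv /= lte_fin ltr01 oppr0 adde0. Qed.

Lemma lebesgue01_fin : (mu (`[0%R, 1%R] : set R) < +oo)%E.
Proof. by rewrite lebesgue01 ltry. Qed.

Lemma off01_patch h : (forall t, h t != 0 -> 0 <= t <= 1) -> h = h \_ `[0, 1].
Proof.
move=> h0; apply/funext => t; rewrite patchE; case: ifPn => //.
rewrite notin_setE /= in_itv /= => nt.
by apply/eqP; apply: contra_notT nt; apply: h0.
Qed.

Lemma integrable01 h K : measurable_fun setT h -> (forall t, `|h t| <= K) ->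
  (forall t, h t != 0 -> 0 <= t <= 1) -> mu.-integrable setT (EFin \o h).
Proof.
move=> mh hK h0; rewrite (off01_patch h0) -restrict_EFin -integrable_mkcond //.
apply: measurable_bounded_integrable => //; first exact: lebesgue01_fin.
  exact: measurable_funTS.
by exists K; split; [exact: num_real|move=> x Kx t _; apply: le_trans (hK t) (ltW Kx)].
Qed.

Lemma Rintegral01_le h K : measurable_fun setT h -> (forall t, `|h t| <= K) ->
  (forall t, h t != 0 -> 0 <= t <= 1) -> `|\int[mu]_x h x| <= K.
Proof.
move=> mh hK h0; have ih := integrable01 mh hK h0.
apply: le_trans (le_normr_Rintegral measurableT ih) _.
have -> : (fun x => `|h x|) = (fun x => `|h x|) \_ `[0, 1].
  apply: off01_patch => t; rewrite normr_eq0; exact: h0.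
rewrite -Rintegral_mkcond.
have -> : K = \int[mu]_(x in `[0, 1]) K.
  by rewrite Rintegral_cst //= lebesgue01 mulr1.
have i1 : mu.-integrable `[0, 1] (EFin \o h) by apply: integrableS ih.
apply: le_Rintegral => //; first exact: (integrable_norm i1).
apply: measurable_bounded_integrable => //; first exact: lebesgue01_fin.
by exists `|K|; split; [exact: num_real|move=> x Kx t _; apply: ltW].
Qed.

(** Adding K on the unit interval makes the integrand nonnegative, so Tonelli gives measurability in
    the parameter; the added integral is a constant and is subtracted again. *)
Lemma Rintegral01_param d (Z : measurableType d) (h : Z * R -> R) K :
  measurable_fun setT h -> (forall p, `|h p| <= K) ->
  (forall p, h p != 0 -> 0 <= p.2 <= 1) ->
  measurable_fun setT (fun z => \int[mu]_t h (z, t)).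
Proof.
move=> mh hK h0.
pose g (p : Z * R) : R := h p + K * \1_(`[0, 1] : set R) p.2.
have m1 : measurable_fun setT (fun p : Z * R => K * \1_(`[0, 1] : set R) p.2).
  by apply: measurable_funM => //; apply: measurableT_comp => //; apply: measurable_indic.
have mg : measurable_fun setT g by apply: measurable_funD.
have g0 p : (0 <= (EFin \o g) p)%E.
  rewrite lee_fin /g; have [hp|hp] := eqVneq (h p) 0.
    have K0 : 0 <= K by apply: le_trans (hK p).
    by rewrite hp add0r mulr_ge0.
  rewrite indicE mem_set ?mulr1 /= ?in_itv /= ?h0 //.
  by have := hK p; rewrite ler_norml => /andP[? _]; lra.
have mG : measurable_fun setT (EFin \o g) by apply/measurable_EFinP.
have mF := @measurable_fun_fubini_tonelli_F _ _ Z _ R mu _ mG g0.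
have -> : (fun z => \int[mu]_t h (z, t)) =
   (fun z => fine (fubini_F mu (EFin \o g) z) - \int[mu]_t (K * \1_(`[0, 1] : set R) t)).
  apply/funext => z.
  have mz : measurable_fun setT (fun t => h (z, t)).
    by apply: (measurableT_comp mh); apply: measurable_pair1.
  have i1 : mu.-integrable setT (EFin \o (fun t => h (z, t))).
    by apply: (integrable01 mz) => t; [apply: hK|apply: h0].
  have m2 : measurable_fun setT (fun t : R => K * \1_(`[0, 1] : set R) t).
    by apply: measurable_funM => //; apply: measurable_indic.
  have i2 : mu.-integrable setT (EFin \o (fun t => K * \1_(`[0, 1] : set R) t)).
    apply: (@integrable01 _ `|K|) => // t.
      by rewrite normrM ler_piMr // indicE; case: (_ \in _); rewrite ?normr1 ?normr0.
    by rewrite indicE; case: (boolP (_ \in _)); rewrite ?mulr0 ?eqxx // inE /= in_itv.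
  by rewrite -[fine _]/(\int[mu]_t g (z, t)) RintegralD // addrK.
by apply: measurable_funB => //; apply: measurableT_comp.
Qed.

End UnitInterval.

Section IterIntegral.
Variable R : realType.
Local Notation mu := (@lebesgue_measure R).

Definition in_cube (k : nat) (y : 'rV[R]_k) := forall i, 0 <= y 0 i <= 1.

Definition consr (k : nat) (t : R) (y : 'rV[R]_k) : 'rV[R]_k.+1 :=
  row_mx (t%:M : 'rV[R]_1) y : 'rV[R]_(1 + k).

Lemma consr0 k t (y : 'rV[R]_k) : consr t y 0 ord0 = t.
Proof.
rewrite /consr (_ : ord0 = lshift k (ord0 : 'I_1)); last exact/val_inj.
by apply: (etrans (@row_mxEl R 1 1 k t%:M y 0 ord0)); rewrite mxE eqxx mulr1n.
Qed.

Lemma consrS k t (y : 'rV[R]_k) i : consr t y 0 (lift ord0 i) = y 0 i.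
Proof.
rewrite /consr (_ : lift ord0 i = rshift 1 i); last exact/val_inj.
exact: (@row_mxEr R 1 1 k t%:M y 0 i).
Qed.

Lemma iter_integralS k (f : 'rV[R]_k.+1 -> R) :
  iter_integral f = \int[mu]_t iter_integral (fun y => f (consr t y)).
Proof. by []. Qed.

(** The parameter space is arbitrary because the induction moves the outermost variable of
    integration into it, replacing Z by Z * R. *)
Lemma iter_integral_param k : forall d (Z : measurableType d)
    (G : Z -> 'rV[R]_k -> R) (K : R),
  (forall d' (W : measurableType d') (p : W -> Z) (g : W -> 'rV[R]_k),
     measurable_fun setT p -> (forall i, measurable_fun setT (fun w => g w 0 i)) ->
     measurable_fun setT (fun w => G (p w) (g w))) ->
  (forall z y, `|G z y| <= K) -> (forall z y, G z y != 0 -> in_cube y) ->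
  measurable_fun setT (fun z => iter_integral (G z)) /\
  forall z, `|iter_integral (G z)| <= K.
Proof.
elim: k => [|k ih] d Z G K mG GK G0.
  split=> [|z]; last exact: GK.
  by apply: (mG _ _ id (fun _ => 0)) => // -[].
pose H (p : Z * R) y := G p.1 (consr p.2 y).
have [mH HK] : measurable_fun setT (fun z => iter_integral (H z)) /\
    forall z, `|iter_integral (H z)| <= K.
  apply: ih => [d' W p g mp mg|z y|z y h i].
  - apply: mG; first exact: (measurableT_comp measurable_fst mp).
    move=> i; case: (unliftP ord0 i) => [j|] ->.
      by under eq_fun do rewrite consrS; apply: mg.
    by under eq_fun do rewrite consr0; apply: (measurableT_comp measurable_snd mp).
  - exact: GK.
  - by have := G0 _ _ h (lift ord0 i); rewrite consrS.
(* Outside the unit interval the slice vanishes identically, and the induction hypothesis with bound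
   0 shows that its integral is 0. *)
have H0 (p : Z * R) : iter_integral (H p) != 0 -> 0 <= p.2 <= 1.
  apply: contra_neqP => np.
  have -> : H p = fun=> 0.
    apply/funext => y; apply/eqP; apply: contra_notT np => h.
    by have := G0 _ _ h ord0; rewrite consr0.
  have : `|iter_integral (fun _ : 'rV[R]_k => 0 : R)| <= 0.
    have [] // := ih _ unit (fun _ _ => 0) 0.
    - by move=> z y; rewrite normr0.
    - by move=> z y; rewrite eqxx.
    - by move=> _ /(_ tt).
  by rewrite normr_le0 => /eqP.
split=> [|z]; first exact: (Rintegral01_param mH HK H0).
apply: (@Rintegral01_le _ (fun t => iter_integral (H (z, t)))).
- by apply: (measurableT_comp mH); apply: measurable_pair1.
- by move=> t; apply: HK.
- by move=> t; apply: H0.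
Qed.

(** This class is stable under fixing the first variable and guarantees integrability at each level
    of the iterated integral. *)
Definition nice k (f : 'rV[R]_k -> R) : Prop :=
  [/\ rvmeas f, exists K, forall y, `|f y| <= K & forall y, f y != 0 -> in_cube y].

Lemma nice_cons k (f : 'rV[R]_k.+1 -> R) t :
  nice f -> nice (fun y => f (consr t y)).
Proof.
move=> [mf [K fK] f0]; split.
- apply: rvmeas_comp mf _ => i; case: (unliftP ord0 i) => [j|] ->.
    by under eq_fun do rewrite consrS; apply: rvmeas_coord.
  by under eq_fun do rewrite consr0; apply: rvmeas_cst.
- by exists K => y; apply: fK.
- by move=> y /f0 h i; have := h (lift ord0 i); rewrite consrS.
Qed.

Lemma nice_outer k (f : 'rV[R]_k.+1 -> R) : nice f ->
  mu.-integrable setT (EFin \o (fun t => iter_integral (fun y => f (consr t y)))).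
Proof.
move=> [mf [K fK] f0].
have mG d' (W : measurableType d') (p : W -> R) (g : W -> 'rV[R]_k) :
     measurable_fun setT p -> (forall i, measurable_fun setT (fun w => g w 0 i)) ->
     measurable_fun setT (fun w => f (consr (p w) (g w))).
  move=> mp mg; apply: mf => i; case: (unliftP ord0 i) => [j|] ->.
    by under eq_fun do rewrite consrS; apply: mg.
  by under eq_fun do rewrite consr0; apply: mp.
have [mI IK] : measurable_fun setT (fun t => iter_integral (fun y => f (consr t y))) /\
    forall t, `|iter_integral (fun y => f (consr t y))| <= K.
  apply: (@iter_integral_param _ _ R) => //.
  by move=> t y /f0 h i; have := h (lift ord0 i); rewrite consrS.
apply: integrable01 mI IK _ => t; apply: contra_neqP => nt.
have -> : (fun y => f (consr t y)) = fun=> 0.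
  apply/funext => y; apply/eqP; apply: contra_notT nt => h.
  by have := f0 _ h ord0; rewrite consr0.
have : `|iter_integral (fun _ : 'rV[R]_k => 0 : R)| <= 0.
  have [] // := @iter_integral_param k _ unit (fun _ _ => 0) 0.
  - by move=> z y; rewrite normr0.
  - by move=> z y; rewrite eqxx.
  - by move=> _ /(_ tt).
by rewrite normr_le0 => /eqP.
Qed.

Lemma iter_integralD k (f g : 'rV[R]_k -> R) : nice f -> nice g ->
  iter_integral (fun y => f y + g y) = iter_integral f + iter_integral g.
Proof.
elim: k f g => [//|k ih] f g nf ng; rewrite !iter_integralS -RintegralD //.
- by congr Rintegral; apply/funext => t; rewrite ih //; apply: nice_cons.
- exact: nice_outer.
- exact: nice_outer.
Qed.

Lemma iter_integralZ k (c : R) (f : 'rV[R]_k -> R) : nice f ->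
  iter_integral (fun y => c * f y) = c * iter_integral f.
Proof.
elim: k f => [//|k ih] f nf; rewrite !iter_integralS -RintegralZl //.
- by congr Rintegral; apply/funext => t; rewrite ih //; apply: nice_cons.
- exact: nice_outer.
Qed.

Lemma le_iter_integral k (f g : 'rV[R]_k -> R) : nice f -> nice g ->
  (forall y, f y <= g y) -> iter_integral f <= iter_integral g.
Proof.
elim: k f g => [|k ih] f g nf ng fg; first exact: fg.
rewrite !iter_integralS; apply: le_Rintegral => //; [exact: nice_outer|exact: nice_outer|].
by move=> t _; apply: ih => [||y]; [exact: nice_cons|exact: nice_cons|apply: fg].
Qed.

(** A hyperplane is negligible. Slicing along the first variable leaves a proper hyperplane in every
    slice if e has another nonzero coordinate; otherwise at most the single slice t = - c / e0 is
    exceptional. The case e = 0 with c != 0 is the empty hyperplane. *)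
Lemma iter_integral_hyperplane k (f g : 'rV[R]_k -> R) (c : R) (e : 'rV[R]_k) :
  nice f -> nice g -> (c != 0) || (e != 0) ->
  (forall y, c + dot e y != 0 -> f y = g y) ->
  iter_integral f = iter_integral g.
Proof.
elim: k f g c e => [|k ih] f g c e nf ng ce fg.
  apply: fg; rewrite (_ : e = 0) ?dot0l ?addr0; last by apply/rowP => -[].
  by move: ce; rewrite (_ : e = 0) ?eqxx ?orbF //; apply/rowP => -[].
pose e0 := e 0 ord0; pose e' : 'rV[R]_k := \row_i e 0 (lift ord0 i).
have de t y : dot e (consr t y) = e0 * t + dot e' y.
  rewrite !dotE big_ord_recl consr0; congr (_ + _).
  by apply: eq_bigr => i _; rewrite consrS mxE.
have key t : (c + e0 * t != 0) || (e' != 0) ->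
    iter_integral (fun y => f (consr t y)) = iter_integral (fun y => g (consr t y)).
  move=> h; apply: (ih _ _ _ _ _ _ h) => [||y hy]; [exact: nice_cons|exact: nice_cons|].
  by apply: fg; rewrite de addrA.
rewrite !iter_integralS.
have [e'0|e'n0] := eqVneq e' 0; last first.
  by congr Rintegral; apply/funext => t; apply: key; rewrite e'n0 orbT.
have [e00|e0n0] := eqVneq e0 0.
  congr Rintegral; apply/funext => t; apply: key; rewrite e00 mul0r addr0.
  move: ce; rewrite (_ : e = 0) ?eqxx ?orbF; first by move=> ->.
  apply/rowP => i; rewrite mxE; case: (unliftP ord0 i) => [j|] -> //.
  by move: e'0 => /rowP/(_ j); rewrite !mxE.
have ae : ae_eq mu setT (EFin \o (fun t => iter_integral (fun y => f (consr t y))))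
                        (EFin \o (fun t => iter_integral (fun y => g (consr t y)))).
  exists [set - c / e0]; split => //; first exact: lebesgue_measure_set1.
  move=> t /= h; apply/eqP; apply: contra_notT h => h _.
  congr EFin; apply: key; apply/orP; left; apply: contra_neq h => h.
  have -> : c = - (e0 * t) by apply/eqP; rewrite -addr_eq0 h.
  by rewrite opprK mulrC mulKf.
have [/measurable_int m1 m2] := (nice_outer nf, nice_outer ng).
by congr fine; apply: ae_eq_integral => //; exact: (measurable_int _ m2).
Qed.

End IterIntegral.

(** * Integrals over the reference simplex *)

Section FTC.
Variable R : realType.
Local Notation mu := (@lebesgue_measure R).
Implicit Types (x h c e L : R).

Definition posp x : R := Num.max x 0.
(** The successive primitives (x^+)^2 / 2 and (x^+)^3 / 6 of the positive part. *)
Definition posp1 x : R := x * posp x / 2.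
Definition posp2 x : R := x ^+ 2 * posp x / 6.

Lemma posp_case x : (0 <= x /\ posp x = x) \/ (x <= 0 /\ posp x = 0).
Proof.
rewrite /posp; case: (leP 0 x) => h; [left|right]; split => //; last exact: ltW.
Qed.

Lemma posp_id x : 0 <= x -> posp x = x.
Proof. by rewrite /posp; case: leP. Qed.

Lemma posp_0 x : x <= 0 -> posp x = 0.
Proof. by rewrite /posp; case: ltgtP => // <-. Qed.

Lemma posp_lip x y : `|posp x - posp y| <= `|x - y|.
Proof.
rewrite ler_norml; case: (posp_case x) => -[? ->]; case: (posp_case y) => -[? ->];
  case: (ler0P (x - y)) => ?; apply/andP; split; lra.
Qed.

Lemma posp_diff x y : x <= y -> 0 <= posp y - posp x <= y - x.
Proof.
by move=> ?; case: (posp_case x) => -[? ->]; case: (posp_case y) => -[? ->];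
  apply/andP; split; lra.
Qed.

(* In particular F' = f; the remainder is explicit so that no differentiability of
   the positive part at 0 is needed. *)
Definition quad_primitive (F f : R -> R) := forall x h,
  `|F (x + h) - F x - h * f x| <= (`|x| + `|h| + 1) * h ^+ 2.

Lemma posp1_primitive : quad_primitive posp1 posp.
Proof.
move=> x h; apply: (@le_trans _ _ (h ^+ 2)); last first.
  rewrite ler_peMl ?sqr_ge0 // -[leLHS]add0r lerD ?addr_ge0 //.
rewrite /posp1 ler_norml.
by case: (posp_case x) => -[? ->]; case: (posp_case (x + h)) => -[? ->];
  apply/andP; split; nra.
Qed.

Lemma posp2_primitive : quad_primitive posp2 posp1.
Proof.
move=> x h; rewrite /posp2 /posp1.
have hx : `|x| * h ^+ 2 >= `|x * h ^+ 2| by rewrite normrM (ger0_norm (sqr_ge0 h)).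
have hh : `|h| * h ^+ 2 >= `|h ^+ 3| by rewrite exprS normrM (ger0_norm (sqr_ge0 h)).
have h0 := sqr_ge0 h; rewrite !mulrDl.
move: hx hh; move: (`|x| * _) (`|h| * _) => X H; rewrite !ler_norml => /andP[? ?] /andP[? ?].
case: (posp_case x) => -[? ->]; case: (posp_case (x + h)) => -[? ->].
- by apply/andP; split; lra.
- have : 0 <= x * (- (x + h)) by nra.
  have : 0 <= x * x * (- (x + h)) by nra.
  have : x <= - h by lra. 
  have : x ^+ 2 <= h ^+ 2 by nra.
  by move=> *; apply/andP; split; nra.
- have : 0 <= (x + h) * (- x) by nra.
  have : (x + h) ^+ 2 <= h ^+ 2 by nra.
  by move=> *; apply/andP; split; nra.
- by apply/andP; split; lra.
Qed.

Lemma quad_is_derive (F : R -> R) t l K :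
  (forall h, `|h| <= 1 -> `|F (t + h) - F t - h * l| <= K * h ^+ 2) ->
  is_derive t 1 F l.
Proof.
move=> hK.
have K0 : 0 <= K by have := hK 1; rewrite normr1 lexx expr1n mulr1 => /(_ isT); apply: le_trans.
have c : (fun h : R => h^-1 *: (F (h *: (1:R) + t) - F t)) @ 0^' --> l.
  apply/cvgrPdist_le => /= e e0.
  near=> h.
  have h0 : h != 0 by near: h; exact: nbhs_dnbhs_neq.
  have h1 : `|h| <= 1 by near: h; apply: dnbhs0_le.
  have h2 : `|h| <= e / (K + 1).
    by near: h; apply: dnbhs0_le; rewrite divr_gt0 // ltr_wpDl.
  rewrite -(@ler_pM2r _ `|h|) ?normr_gt0 // -normrM mulrBl /GRing.scale /=.
  rewrite mulrAC mulVf // mul1r mulr1 distrC (addrC h) (mulrC l).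
  apply: le_trans (hK h h1) _; rewrite -[h ^+ 2]ger0_norm ?sqr_ge0 // normrX expr2 mulrA.
  rewrite ler_wpM2r //.
  apply: (@le_trans _ _ (K * (e / (K + 1)))); first by rewrite ler_wpM2l.
  by rewrite mulrA ler_pdivrMr ?ltr_wpDl // mulrDr mulr1 mulrC lerDl ltW.
have d : derivable F t 1 by apply/cvg_ex; exists l.
by split => //; apply/cvg_lim.
Unshelve. all: by end_near. Qed.

(** The fundamental theorem of calculus along a line, multiplied by the slope e so that e = 0 is
    included. *)
Lemma integral_line (F f : R -> R) c e L : quad_primitive F f -> continuous f ->
  0 <= L -> e * (\int[mu]_(t in `[0, L]) f (c + t * e)) = F (c + L * e) - F c.
Proof.
move=> Ff cf; rewrite le_eqVlt => /predU1P[<-|L0].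
  by rewrite mul0r addr0 subrr set_itv1 Rintegral_set1 mulr0.
have [->|e0] := eqVneq e 0; first by rewrite mul0r mulr0 addr0 subrr.
pose G t := F (c + t * e) / e.
have dG (t : R) : is_derive t (1 : R) G (f (c + t * e)).
  apply: (@quad_is_derive _ _ _ ((`|c + t * e| + `|e| + 1) * `|e|)) => h h1.
  rewrite -(@ler_pM2r _ `|e|) ?normr_gt0 // -normrM !mulrBl !divfK //.
  rewrite (_ : h * f (c + t * e) * e = (h * e) * f (c + t * e)); last by ring.
  rewrite (_ : c + (t + h) * e = (c + t * e) + h * e); last by ring.
  apply: le_trans (Ff _ _) _.
  rewrite exprMn (_ : _ * _ * h ^+ 2 * `|e| = (`|c + t * e| + `|e| + 1) * (h ^+ 2 * e ^+ 2)); last first.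
    by rewrite -[e ^+ 2]ger0_norm ?sqr_ge0 // normrX; ring.
  apply: ler_wpM2r; first by rewrite mulr_ge0 ?sqr_ge0.
  by rewrite lerD2r lerD2l normrM ler_piMl.
have ca : continuous (fun t : R => c + t * e).
  by move=> t; apply: cvgD; [exact: cvg_cst|apply: cvgMl; exact: cvg_id].
have cG : continuous G.
  by move=> t; apply: differentiable_continuous; apply/derivable1_diffP; apply: ex_derive.
have -> : \int[mu]_(t in `[0, L]) f (c + t * e) = G L - G 0.
  rewrite /Rintegral (@continuous_FTC2 _ (fun t => f (c + t * e)) G) //.
  - by apply: continuous_subspaceT => t; exact: (continuous_comp (ca t) (cf _)).
  - split; first by move=> t _; apply: ex_derive.
      by apply: cvg_at_right_filter; apply: cG.
    by apply: cvg_at_left_filter; apply: cG.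
  - by move=> t _; rewrite derive1E; apply: derive_val.
by rewrite /G mul0r addr0 mulrBr !(mulrC e) !divfK.
Qed.

Lemma posp_continuous : continuous posp.
Proof.
move=> x; apply/cvgrPdist_le => /= e e0; near=> y.
by apply: le_trans (posp_lip _ _) _; near: y; apply: cvgr_dist_le => //; exact: cvg_id.
Unshelve. all: by end_near. Qed.

Lemma posp1_continuous : continuous posp1.
Proof.
move=> x; apply: cvgMl; apply: cvgM; first exact: cvg_id.
exact: posp_continuous.
Qed.

End FTC.

(* Sealed, so that conversion never unfolds Lebesgue integrals. *)
HB.lock Definition rint (R : realType) (k : nat) (f : 'rV[R]_k -> R) : R :=
  iter_integral (fun y => \1_(ref_simplex R k) y * f y).

Section SimplexIntegral.
Variable R : realType.
Local Notation mu := (@lebesgue_measure R).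

Lemma rvmset_ref k : rvmset (ref_simplex R k).
Proof.
have -> : ref_simplex R k =
   \bigcap_(i in [set: 'I_k]) [set y | 0 < y 0 i] `&` [set y | \sum_i y 0 i < 1].
  by apply/seteqP; split=> y [h1 h2]; split=> // i; [move=> _|]; apply: h1.
apply: rvmsetI; last by apply: rvmset_lt; [apply: rvmeas_sum => i; apply: rvmeas_coord|apply: rvmeas_cst].
move=> d Z g mg; rewrite preimage_bigcap.
apply: fin_bigcap_measurable => // i _.
have h := rvmset_lt (@rvmeas_cst R k 0) (rvmeas_coord i).
exact: (h d Z g mg).
Qed.

Lemma ref_cube k y : ref_simplex R k y -> in_cube y.
Proof.
move=> [h1 h2] i; rewrite (ltW (h1 i)) /= ltW //; apply: le_lt_trans h2.
by rewrite (bigD1 i) //= lerDl sumr_ge0 // => j _; apply: ltW.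
Qed.

(* Only the restriction of the integrand to the reference simplex matters. *)
Definition rnice k (f : 'rV[R]_k -> R) : Prop :=
  rvmeas (fun y => \1_(ref_simplex R k) y * f y) /\
  exists K, forall y, ref_simplex R k y -> `|f y| <= K.

Lemma rnice_nice k f : @rnice k f -> nice (fun y => \1_(ref_simplex R k) y * f y).
Proof.
move=> [mf [K fK]]; split=> //.
  exists `|K| => y; rewrite indicE; case: (boolP (y \in _)); rewrite ?inE => h.
    by rewrite mul1r; apply: le_trans (fK y h) (ler_norm _).
  by rewrite mul0r normr0.
move=> y; rewrite indicE; case: (boolP (y \in _)); rewrite ?mul0r ?eqxx // inE => h _.
exact: ref_cube.
Qed.

Lemma rniceI k (f : 'rV[R]_k -> R) K : rvmeas f ->
  (forall y, ref_simplex R k y -> `|f y| <= K) -> rnice f.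
Proof.
move=> mf fK; split; last by exists K.
by apply: rvmeasM => //; apply: rvmset_indic; apply: rvmset_ref.
Qed.

Lemma rnice_cst k c : rnice (fun _ : 'rV[R]_k => c).
Proof. by apply: (@rniceI _ _ `|c|); first exact: rvmeas_cst. Qed.

Lemma rniceD k (f g : 'rV[R]_k -> R) : rnice f -> rnice g -> rnice (fun y => f y + g y).
Proof.
move=> [mf [K fK]] [mg [K' gK]]; split.
  by under eq_fun do rewrite mulrDr; apply: (rvmeasD mf mg).
by exists (K + K') => y h; apply: le_trans (ler_normD _ _) (lerD (fK _ h) (gK _ h)).
Qed.

Lemma rniceM k (f g : 'rV[R]_k -> R) : rnice f -> rnice g -> rnice (fun y => f y * g y).
Proof.
move=> [mf [K fK]] [mg [K' gK]]; split.
  have -> : (fun y => \1_(ref_simplex R k) y * (f y * g y)) =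
    (fun y => (\1_(ref_simplex R k) y * f y) * (\1_(ref_simplex R k) y * g y)).
    apply/funext => y; rewrite indicE; case: (_ \in _); rewrite ?mul1r ?mul0r //.
  exact: (rvmeasM mf mg).
by exists (K * K') => y h; rewrite normrM ler_pM ?fK ?gK.
Qed.

Lemma rniceZ k c (f : 'rV[R]_k -> R) : rnice f -> rnice (fun y => c * f y).
Proof. by apply: rniceM; apply: rnice_cst. Qed.

Lemma rniceN k (f : 'rV[R]_k -> R) : rnice f -> rnice (fun y => - f y).
Proof. by move=> nf; under eq_fun do rewrite -mulN1r; apply: rniceZ. Qed.

Lemma rniceB k (f g : 'rV[R]_k -> R) : rnice f -> rnice g -> rnice (fun y => f y - g y).
Proof. by move=> nf ng; apply: rniceD => //; apply: rniceN. Qed.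

Lemma rnice_sum k (I : Type) (r : seq I) (f : I -> 'rV[R]_k -> R) :
  (forall i, rnice (f i)) -> rnice (fun y => \sum_(i <- r) f i y).
Proof.
move=> nf; elim: r => [|i r ih].
  by under eq_fun do rewrite big_nil; apply: rnice_cst.
under eq_fun do rewrite big_cons.
exact: (rniceD (nf i) ih).
Qed.

Lemma rnice_eq k (f g : 'rV[R]_k -> R) :
  (forall y, ref_simplex R k y -> f y = g y) -> rnice f -> rnice g.
Proof.
move=> fg [mf [K fK]]; split; last by exists K => y h; rewrite -fg ?fK.
suff <- : (fun y => \1_(ref_simplex R k) y * f y) = (fun y => \1_(ref_simplex R k) y * g y) by [].
apply/funext => y; rewrite indicE; case: (boolP (y \in _)); rewrite ?mul0r //.
by rewrite inE => /fg ->.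
Qed.

Lemma rnice_coord k (i : 'I_k) : rnice (fun y : 'rV[R]_k => y 0 i).
Proof.
apply: (@rniceI _ _ 1); first exact: rvmeas_coord.
by move=> y /ref_cube/(_ i)/andP[h1 h2]; rewrite ger0_norm.
Qed.

Lemma rnice_dot k (e : 'rV[R]_k) : rnice (fun y => dot y e).
Proof.
under eq_fun do rewrite dotE.
by apply: rnice_sum => i; apply: rniceM; [apply: rnice_coord|apply: rnice_cst].
Qed.

Lemma rint_eq k (f g : 'rV[R]_k -> R) :
  (forall y, ref_simplex R k y -> f y = g y) -> rint f = rint g.
Proof.
move=> fg; rewrite !rint.unlock; congr iter_integral; apply/funext => y.
by rewrite indicE; case: (boolP (y \in _)); rewrite ?mul0r // inE => /fg ->.
Qed.

Lemma rintD k (f g : 'rV[R]_k -> R) : rnice f -> rnice g ->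
  rint (fun y => f y + g y) = rint f + rint g.
Proof.
move=> nf ng; rewrite !rint.unlock -iter_integralD; [|exact: rnice_nice..].
by congr iter_integral; apply/funext => y; rewrite mulrDr.
Qed.

Lemma rintZ k c (f : 'rV[R]_k -> R) : rnice f -> rint (fun y => c * f y) = c * rint f.
Proof.
move=> nf; rewrite !rint.unlock -iter_integralZ; [|exact: rnice_nice..].
by congr iter_integral; apply/funext => y; rewrite mulrCA.
Qed.

Lemma rintN k (f : 'rV[R]_k -> R) : rnice f -> rint (fun y => - f y) = - rint f.
Proof.
move=> nf; rewrite -[RHS]mulN1r -rintZ //.
by apply: rint_eq => y _; rewrite mulN1r.
Qed.

Lemma rintB k (f g : 'rV[R]_k -> R) : rnice f -> rnice g ->
  rint (fun y => f y - g y) = rint f - rint g.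
Proof. by move=> nf ng; rewrite rintD ?rintN //; apply: rniceN. Qed.

Lemma rint_cst k (c : R) : rint (fun _ : 'rV[R]_k => c) = c * rint (fun _ : 'rV[R]_k => 1).
Proof.
by rewrite -rintZ; [apply: rint_eq => y _; rewrite mulr1|apply: rnice_cst].
Qed.

Lemma rint_sum k (I : Type) (r : seq I) (f : I -> 'rV[R]_k -> R) :
  (forall i, rnice (f i)) ->
  rint (fun y => \sum_(i <- r) f i y) = \sum_(i <- r) rint (f i).
Proof.
move=> nf; elim: r => [|i r ih].
  rewrite big_nil; under [X in rint X]eq_fun do rewrite big_nil.
  by rewrite rint_cst mul0r.
rewrite big_cons -ih -rintD //; last exact: rnice_sum.
by apply: rint_eq => y _; rewrite big_cons.
Qed.

Lemma le_rint k (f g : 'rV[R]_k -> R) : rnice f -> rnice g ->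
  (forall y, ref_simplex R k y -> f y <= g y) -> rint f <= rint g.
Proof.
move=> nf ng fg; rewrite !rint.unlock; apply: le_iter_integral; [exact: rnice_nice|exact: rnice_nice|].
move=> y; rewrite indicE; case: (boolP (y \in _)); rewrite ?mul0r // !mul1r inE.
exact: fg.
Qed.

Lemma rint_ge0 k (f : 'rV[R]_k -> R) : rnice f ->
  (forall y, ref_simplex R k y -> 0 <= f y) -> 0 <= rint f.
Proof.
move=> nf f0; apply: (@le_trans _ _ (rint (fun _ : 'rV[R]_k => 0))).
  by rewrite rint_cst mul0r.
by apply: le_rint => //; apply: rnice_cst.
Qed.

Lemma rint_abs_le k (f : 'rV[R]_k -> R) K : rnice f ->
  (forall y, ref_simplex R k y -> `|f y| <= K) ->
  `|rint f| <= K * rint (fun _ : 'rV[R]_k => 1).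
Proof.
move=> nf fK; rewrite -rint_cst ler_norml -rintN; last exact: rnice_cst.
apply/andP; split; apply: le_rint; rewrite ?rintN //; do ?exact: rnice_cst.
- by move=> y /fK; rewrite ler_norml => /andP[].
- by move=> y /fK; rewrite ler_norml => /andP[].
Qed.

Lemma rint_hyperplane k (f g : 'rV[R]_k -> R) (c : R) (e : 'rV[R]_k) :
  rnice f -> rnice g -> (c != 0) || (e != 0) ->
  (forall y, ref_simplex R k y -> c + dot e y != 0 -> f y = g y) ->
  rint f = rint g.
Proof.
move=> nf ng ce fg; rewrite !rint.unlock; apply: (iter_integral_hyperplane (rnice_nice nf) (rnice_nice ng) ce).
move=> y hy; rewrite indicE; case: (boolP (y \in _)); rewrite ?mul0r // inE => h.
by rewrite fg.
Qed.

Lemma rint1_gt0 k : 0 < rint (fun _ : 'rV[R]_k => 1).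
Proof.
rewrite rint.unlock.
(* The open cube of side 1/(k+1) lies in the reference simplex, since k/(k+1) < 1, and contributes
   r^k. *)
pose r : R := k.+1%:R^-1.
have r0 : 0 < r by rewrite invr_gt0.
have r1 : r <= 1 by rewrite invf_le1 // ler1n.
pose box j (y : 'rV[R]_j) : R := \prod_i \1_(`]0, r[ : set R) (y 0 i).
have boxE j (y : 'rV[R]_j) : box j y = if `[< forall i, 0 < y 0 i < r >] then 1 else 0.
  case: asboolP => h.
    by apply: big1 => i _; rewrite indicE mem_set //= in_itv /= h.
  have [i hi] : exists i, ~ (0 < y 0 i < r) by apply/existsNP.
  by rewrite /box (bigD1 i) //= indicE memNset ?mul0r //= in_itv.
have nbox j : nice (box j).
  split.
  - move=> d Z g mg; rewrite /box.
    have : forall i, measurable_fun setT (fun z => \1_(`]0, r[ : set R) (g z 0 i) : R).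
      by move=> i; apply: measurableT_comp => //; apply: measurable_indic.
    move=> h; elim: (index_enum _) => [|i s ih].
      by under eq_fun do rewrite big_nil; apply: measurable_cst.
    by under eq_fun do rewrite big_cons; apply: measurable_funM => //; apply: h.
  - by exists 1 => y; rewrite boxE; case: ifP; rewrite ?normr1 ?normr0.
  - move=> y; rewrite boxE; case: asboolP; rewrite ?eqxx // => h _ i.
    by case/andP: (h i) => h1 h2; rewrite (ltW h1) (le_trans (ltW h2)).
have ibox j : iter_integral (box j) = r ^+ j.
  elim: j => [|j ih]; first by rewrite /= /box big_ord0.
  rewrite iter_integralS.
  transitivity (\int[mu]_t (r ^+ j * \1_(`]0, r[ : set R) t)).
    congr Rintegral; apply/funext => t.
    rewrite mulrC -ih -iter_integralZ //; congr iter_integral; apply/funext => y.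
    by rewrite /box big_ord_recl consr0; congr (_ * _); apply: eq_bigr => i _; rewrite consrS.
  rewrite RintegralZl //; last first.
    apply: (@integrable01 _ _ 1).
    - exact: measurable_indic.
    - by move=> t; rewrite indicE; case: (_ \in _); rewrite ?normr1 ?normr0.
    - move=> t; rewrite indicE; case: (boolP (t \in _)); rewrite ?eqxx // inE /= in_itv /= => /andP[h1 h2] _.
      by rewrite (ltW h1) (le_trans (ltW h2)).
  rewrite exprSr; congr (_ * _).
  have -> : \int[mu]_x \1_(`]0, r[ : set R) x = fine (mu (`]0%R, r[ : set R)).
    by rewrite /Rintegral integral_indic // setIT.
  rewrite lebesgue_measure_itv /= lte_fin r0.
  by rewrite oppr0 addr0.
apply: (@lt_le_trans _ _ (r ^+ k)); first exact: exprn_gt0.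
rewrite -ibox; apply: le_iter_integral => [//||y].
  exact/rnice_nice/rnice_cst.
rewrite boxE mulr1 indicE; case: asboolP => // h; rewrite mem_set //; split => [i|].
  by case/andP: (h i).
apply: (@le_lt_trans _ _ (\sum_(i < k) r)).
  by apply: ler_sum => i _; case/andP: (h i) => _ /ltW.
rewrite sumr_const card_ord -mulr_natl /r ltr_pdivrMr // mul1r ltr_nat //.
Qed.

End SimplexIntegral.

(** * Averages of the positive part of an affine function *)

Section PositivePart.
Variable R : realType.
Local Notation mu := (@lebesgue_measure R).
Implicit Types (a b c e L t u : R).

Lemma integrable_itv (g : R -> R) L : continuous g ->
  mu.-integrable `[0, L] (EFin \o g).
Proof.
move=> cg; apply: continuous_compact_integrable; first exact: segment_compact.
exact: continuous_subspaceT.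
Qed.

Lemma Rintegral_oo (g : R -> R) L : continuous g ->
  \int[mu]_u (\1_(`]0, L[ : set R) u * g u) = \int[mu]_(u in `[0, L]) g u.
Proof.
move=> cg.
have -> : (fun u => \1_(`]0, L[ : set R) u * g u) = g \_ `]0, L[.
  apply/funext => u; rewrite patchE indicE; case: ifPn => h.
    by rewrite mul1r.
  by rewrite mul0r.
rewrite -Rintegral_mkcond.
have i1 := @integrable_itv g L cg.
rewrite Rintegral_itv_bndo_bndc; last first.
  by apply: integrableS i1 => //; apply: subset_itv; rewrite bnd_simp.
rewrite Rintegral_itv_obnd_cbnd //.
by apply: integrableS i1 => //; apply: subset_itv; rewrite bnd_simp.
Qed.

Definition pair_rv a b : 'rV[R]_2 := \row_i (if i == ord0 then a else b).

(** The integrals over the reference segment and triangle of the positive part of the affine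
    function with vertex values a, b (, c). They are not normalized: the triangle has measure
    1/2. *)
Definition H1 a b : R := rint (fun y : 'rV[R]_1 => posp (a + dot y (const_mx (b - a)))).
Definition H2 a b c : R :=
  rint (fun y : 'rV[R]_2 => posp (a + dot y (pair_rv (b - a) (c - a)))).

Lemma line_continuous a e : continuous (fun t : R => a + t * e).
Proof. by move=> t; apply: cvgD; [exact: cvg_cst|apply: cvgMl; exact: cvg_id]. Qed.

Lemma posp_line_continuous a e : continuous (fun t : R => posp (a + t * e)).
Proof. by move=> t; apply: (continuous_comp (@line_continuous a e t)); apply: posp_continuous. Qed.

Lemma posp1_line_continuous a e : continuous (fun t : R => posp1 (a + t * e)).
Proof. by move=> t; apply: (continuous_comp (@line_continuous a e t)); apply: posp1_continuous. Qed.

Lemma indic_eq (T T' : Type) (A : set T) (B : set T') x y :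
  (A x <-> B y) -> \1_A x = \1_B y :> R.
Proof.
move=> h; rewrite !indicE; congr (_%:R); congr nat_of_bool.
by apply/idP/idP; rewrite !inE => /h.
Qed.

(** Hermite-Genocchi: [H1] is the first divided difference of [posp1], written without division. *)
Lemma H1_formula a b : (b - a) * H1 a b = posp1 b - posp1 a.
Proof.
have -> : H1 a b = \int[mu]_(t in `[0, 1]) posp (a + t * (b - a)).
  rewrite -(Rintegral_oo _ (@posp_line_continuous a (b - a))) /H1 rint.unlock iter_integralS.
  congr Rintegral; apply/funext => t /=; congr (_ * _).
    apply: indic_eq; rewrite /ref_simplex /= big_ord1 in_itv /= consr0; split.
      by move=> [/(_ ord0)]; rewrite consr0 => -> ->.
    by move=> /andP[h1 h2]; split=> // i; rewrite ord1 consr0.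
  by rewrite dotE big_ord1 consr0 mxE.
have -> := integral_line a (b - a) (@posp1_primitive R) (@posp_continuous R) ler01.
by rewrite mul1r (addrC a) subrK.
Qed.

Lemma rnice_posp k a (e : 'rV[R]_k) : rnice (fun y : 'rV[R]_k => posp (a + dot y e)).
Proof.
have [mf [K fK]] := rniceD (rnice_cst k a) (rnice_dot e).
apply: (@rniceI _ _ _ K).
  apply: rvmeas_comp1; first by apply: continuous_measurable_fun; apply: posp_continuous.
  apply: rvmeasD; first exact: rvmeas_cst.
  under eq_fun do rewrite dotE.
  apply: (@rvmeas_sum _ _ _ _ (fun i y => y 0 i * e 0 i)) => i.
  exact: (rvmeasM (rvmeas_coord i) (@rvmeas_cst R k (e 0 i))).
move=> y /fK; apply: le_trans.
by have := posp_lip (a + dot y e) 0; rewrite (posp_id (lexx 0)) !subr0.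
Qed.

(** [H2] is the second divided difference of [posp2], multiplied out. Integrating first along the
    slices of the triangle leaves two integrals of [posp1] over edges, each of which is a difference
    of values of [posp2]. *)
Lemma H2_formula a b c : (c - a) * (b - a) * (b - c) * H2 a b c =
  (b - a) * (posp2 b - posp2 c) - (b - c) * (posp2 b - posp2 a).
Proof.
(* The slice of the open triangle at t is the segment ]0, 1 -
   t[, which is empty unless t lies in ]0, 1[. *)
have inner t : iter_integral (fun y : 'rV[R]_1 => \1_(ref_simplex R 2) (consr t y) *
      posp (a + dot (consr t y) (pair_rv (b - a) (c - a)))) =
    \1_(`]0, 1[ : set R) t * \int[mu]_(u in `[0, 1 - t]) posp ((a + t * (b - a)) + u * (c - a)).
  rewrite iter_integralS -(Rintegral_oo _ (@posp_line_continuous _ _)).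
  have [t01|t01] := boolP (t \in `]0, 1[); last first.
    rewrite indicE memNset ?mul0r; last by apply/negP.
    rewrite -[RHS](Rintegral_set0 mu (fun=> 0)) [RHS]Rintegral_mkcond.
    congr Rintegral; apply/funext => u /=; rewrite patchE in_set0 indicE memNset ?mul0r //.
    move=> [h1 h2]; apply/negP: t01; apply/negPn.
    have := h1 ord0; have := h1 ord_max; move: h2.
    rewrite (_ : ord_max = lift ord0 ord0 :> 'I_2); last exact/val_inj.
    by rewrite big_ord_recl big_ord1 !consrS !consr0 in_itv /= => *; apply/andP; split; lra.
  rewrite indicE mem_set // mul1r; congr Rintegral; apply/funext => u /=; congr (_ * _).
    apply: indic_eq; rewrite /ref_simplex /= big_ord_recl big_ord1 in_itv /= consrS !consr0.
    move: t01; rewrite in_itv /= => /andP[t0 t1]; split.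
      move=> [/(_ ord_max)]; rewrite (_ : ord_max = lift ord0 ord0 :> 'I_2); last exact/val_inj.
      by rewrite consrS consr0 => -> h; lra.
    move=> /andP[h1 h2]; split; last by lra.
    move=> i; case: (unliftP ord0 i) => [j|] ->; rewrite ?consr0 // consrS ord1 consr0 //.
  congr posp; rewrite dotE big_ord_recl big_ord1 consrS !consr0 !mxE /=; ring.
have H2E : H2 a b c = \int[mu]_t (\1_(`]0, 1[ : set R) t *
    \int[mu]_(u in `[0, 1 - t]) posp ((a + t * (b - a)) + u * (c - a))).
  rewrite /H2 rint.unlock iter_integralS; congr Rintegral; apply/funext => t; exact: inner.
have nH : mu.-integrable setT (EFin \o (fun t => \1_(`]0, 1[ : set R) t *
    \int[mu]_(u in `[0, 1 - t]) posp ((a + t * (b - a)) + u * (c - a)))).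
  have := nice_outer (rnice_nice (rnice_posp a (pair_rv (b - a) (c - a)))).
  by under eq_fun do rewrite inner.
have e1 : (c - a) * H2 a b c = 
    (\int[mu]_(t in `[0, 1]) posp1 (c + t * (b - c))) -
    (\int[mu]_(t in `[0, 1]) posp1 (a + t * (b - a))).
  rewrite H2E -RintegralZl // -RintegralB //; try exact/integrable_itv/posp1_line_continuous.
  rewrite -(@Rintegral_oo (fun t => posp1 (c + t * (b - c)) - posp1 (a + t * (b - a)))); last first.
    by move=> t; apply: cvgB; apply: posp1_line_continuous.
  congr Rintegral; apply/funext => t /=; rewrite mulrCA !indicE.
  case: (boolP (t \in _)); rewrite ?mul0r // !mul1r inE /= in_itv /= => /andP[t0 t1].
  rewrite (integral_line _ _ (@posp1_primitive R) (@posp_continuous R)); last by lra.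
  by congr (posp1 _ - _); ring.
have l1 := integral_line c (b - c) (@posp2_primitive R) (@posp1_continuous R) ler01.
have l2 := integral_line a (b - a) (@posp2_primitive R) (@posp1_continuous R) ler01.
rewrite mul1r [in posp2 (_ + _)]addrC subrK in l1.
rewrite mul1r [in posp2 (_ + _)]addrC subrK in l2.
rewrite -l1 -l2; move: (H2 a b c) e1 => X e1.
rewrite (_ : _ * X = (b - a) * (b - c) * ((c - a) * X)); last by ring.
rewrite e1; move: (Rintegral _ _ _) (Rintegral _ _ _) => X1 X2; ring.
Qed.

Lemma H1_sym a b : H1 a b = H1 b a.
Proof.
have [->//|ab] := eqVneq a b.
have h : b - a != 0 by rewrite subr_eq0 eq_sym.
apply: (mulfI h); by rewrite H1_formula -(opprB a b) mulNr H1_formula opprB.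
Qed.

(** Both sides equal (b - a)(c - a) times the second divided difference of [posp1]. Applied to
    vertex values, it says that differences of facet averages are proportional to differences of
    vertex values. *)
Lemma H1_triple a b c :
  (H1 b c - H1 a c) * (c - a) = (H1 b c - H1 a b) * (b - a).
Proof.
have [->|ab] := eqVneq a b; first by rewrite !subrr mul0r mulr0.
have [->|ac] := eqVneq a c; first by rewrite (H1_sym b c) !subrr mul0r mulr0.
have [->|bc] := eqVneq b c; first by [].
have [h1 h2 h3] : [/\ b - a != 0, c - a != 0 & c - b != 0].
  by rewrite !subr_eq0 ![_ == a]eq_sym ab ac eq_sym.
have e1 : H1 a b = (posp1 b - posp1 a) / (b - a) by rewrite -H1_formula mulrC mulKf.
have e2 : H1 a c = (posp1 c - posp1 a) / (c - a) by rewrite -H1_formula mulrC mulKf.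
have e3 : H1 b c = (posp1 c - posp1 b) / (c - b) by rewrite -H1_formula mulrC mulKf.
rewrite e1 e2 e3; field; rewrite h1 h2 h3 //.
Qed.

Definition dist3 a b c a' b' c' := `|a - a'| + `|b - b'| + `|c - c'|.

Lemma pair_rv_dot y a b : dot y (pair_rv a b) = y 0 ord0 * a + y 0 ord_max * b.
Proof.
rewrite dotE big_ord_recl big_ord1 !mxE /=.
by rewrite (_ : lift ord0 ord0 = ord_max :> 'I_2) //; exact/val_inj.
Qed.

Lemma ref2 (y : 'rV[R]_2) : ref_simplex R 2 y ->
  [/\ 0 < y 0 ord0, 0 < y 0 ord_max & y 0 ord0 + y 0 ord_max < 1].
Proof.
move=> [h1 h2]; split=> //; move: h2; rewrite big_ord_recl big_ord1.
by rewrite (_ : lift ord0 ord0 = ord_max :> 'I_2) //; exact/val_inj.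
Qed.

Lemma H2_lip a b c a' b' c' :
  `|H2 a b c - H2 a' b' c'| <= dist3 a b c a' b' c' * rint (fun _ : 'rV[R]_2 => 1).
Proof.
rewrite /H2 -rintB; try exact: rnice_posp.
apply: rint_abs_le => [|y /ref2[y0 y1 ys]].
  by apply: rniceB; apply: rnice_posp.
apply: le_trans (posp_lip _ _) _; rewrite !pair_rv_dot.
move: y0 y1 ys; move: (y 0 ord0) (y 0 ord_max) => s t s0 t0 st.
have -> : a + (s * (b - a) + t * (c - a)) - (a' + (s * (b' - a') + t * (c' - a')))
  = (1 - s - t) * (a - a') + s * (b - b') + t * (c - c') by ring.
apply: le_trans (ler_normD _ _) _; rewrite lerD //; last by rewrite normrM ler_piMl // ger0_norm; lra.
apply: le_trans (ler_normD _ _) _; rewrite lerD // normrM ler_piMl // ger0_norm; lra.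
Qed.

Lemma avoid_finite (s : seq R) x e : 0 < e -> exists2 x', `|x - x'| <= e & x' \notin s.
Proof.
move=> e0; pose f (i : nat) := x + e / i.+1%:R.
have fi i j : f i = f j -> i = j.
  move=> /addrI /(mulfI (lt0r_neq0 e0)) /invr_inj /eqP.
  by rewrite eqr_nat => /eqP [].
have fe i : `|x - f i| <= e.
  rewrite /f opprD addNKr normrN ger0_norm; last by rewrite divr_ge0 // ltW.
  by rewrite ler_pdivrMr // ler_peMr ?(ltW e0) // ler1n.
suff [i _ hi] : exists2 i, (i < (size s).+1)%N & f i \notin s by exists (f i).
apply/not_exists2P => h.
have : {subset [seq f i | i <- iota 0 (size s).+1] <= s}.
  move=> y /mapP[i]; rewrite mem_iota /= add0n => hi ->.
  by have [/(_ hi)//|/negP] := h i; rewrite negbK.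
move=> /uniq_leq_size; rewrite map_inj_uniq ?iota_uniq; last exact: fi.
by rewrite size_map size_iota ltnn => /(_ isT).
Qed.

Lemma le0_all_eps (x K : R) : (forall e, 0 < e -> x <= K * e) -> x <= 0.
Proof.
move=> h; rewrite leNgt; apply/negP => x0.
have K1 : 0 < `|K| + 1 by rewrite ltr_wpDl.
have e0 : 0 < x / (2 * (`|K| + 1)) by rewrite divr_gt0 // mulr_gt0.
have := h _ e0; apply/negP; rewrite -ltNge mulrA ltr_pdivrMr ?mulr_gt0 //.
rewrite mulrC ltr_pM2l // (le_lt_trans (ler_norm K)) //.
have := normr_ge0 K; lra.
Qed.

(* The closed formula for H2 involves divisions by differences of its arguments;
   coinciding arguments are reached by continuity. *)
Lemma lip3_eq0 (Q : R -> R -> R -> R) K :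
  (forall a b c a' b' c', `|Q a b c - Q a' b' c'| <= K * dist3 a b c a' b' c') ->
  (forall a b c, a != b -> a != c -> b != c -> Q a b c = 0) ->
  forall a b c, Q a b c = 0.
Proof.
move=> lQ hQ a b c; apply/eqP; rewrite -normr_le0.
have K0 : 0 <= K.
  have := lQ 0 0 0 1 0 0; rewrite /dist3 subrr sub0r normrN normr1 normr0 !addr0 mulr1.
  by apply: le_trans.
apply: (@le0_all_eps _ (K * 2)) => e e0.
have [b' hb'] := avoid_finite [:: a] b e0; rewrite inE => ab.
have [c' hc'] := avoid_finite [:: a; b'] c e0; rewrite !inE negb_or => /andP[ac bc].
have := lQ a b c a b' c'; rewrite (hQ a b' c') ?subr0 1?eq_sym // => /le_trans; apply.
rewrite -mulrA ler_wpM2l // /dist3 subrr normr0 add0r; lra.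
Qed.

Lemma H2_val a b c : a != b -> a != c -> b != c ->
  H2 a b c = ((b - a) * (posp2 b - posp2 c) - (b - c) * (posp2 b - posp2 a)) /
             ((c - a) * (b - a) * (b - c)).
Proof.
move=> ab ac bc; rewrite -H2_formula mulrC mulKf //.
by rewrite !mulf_neq0 // subr_eq0 // eq_sym.
Qed.

Lemma subrr4 (x y z w : R) : x - y - (z - w) = (x - z) - (y - w).
Proof. ring. Qed.

(** Divided differences are symmetric: field arithmetic for distinct arguments, continuity for the
    others. The two transpositions generate all permutations. *)
Lemma H2_swap a b c : H2 a b c = H2 b a c /\ H2 a b c = H2 a c b.
Proof.
have [K hK] : exists K, forall a b c a' b' c',
    `|H2 a b c - H2 a' b' c'| <= K * dist3 a b c a' b' c'.
  by exists (rint (fun _ : 'rV[R]_2 => 1)) => *; rewrite mulrC H2_lip.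
split; apply/eqP; rewrite -subr_eq0; apply/eqP.
- pose Q a b c := H2 a b c - H2 b a c; rewrite -/(Q a b c).
  apply: (@lip3_eq0 _ (K + K)) => {a b c}.
    move=> a b c a' b' c'; rewrite /Q.
    rewrite subrr4.
    apply: le_trans (ler_normB _ _) _; rewrite mulrDl lerD //.
    by apply: le_trans (hK _ _ _ _ _ _) _; rewrite /dist3 [`|b - _| + _]addrC.
  move=> a b c ab ac bc; rewrite /Q !H2_val // 1?eq_sym //.
  have [ba ca cb] : [/\ b != a, c != a & c != b] by rewrite ![_ == a]eq_sym ab ac eq_sym.
  by field; rewrite !subr_eq0 ?ab ?ac ?bc ?ba ?ca ?cb.
- pose Q a b c := H2 a b c - H2 a c b; rewrite -/(Q a b c).
  apply: (@lip3_eq0 _ (K + K)) => {a b c}.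
    move=> a b c a' b' c'; rewrite /Q.
    rewrite subrr4.
    apply: le_trans (ler_normB _ _) _; rewrite mulrDl lerD //.
    by apply: le_trans (hK _ _ _ _ _ _) _; rewrite /dist3 addrAC.
  move=> a b c ab ac bc; rewrite /Q !H2_val // 1?eq_sym //.
  have [ba ca cb] : [/\ b != a, c != a & c != b] by rewrite ![_ == a]eq_sym ab ac eq_sym.
  by field; rewrite !subr_eq0 ?ab ?ac ?bc ?ba ?ca ?cb.
Qed.

(** The coincidence cases of [H2_triple], where symmetry alone suffices. *)
Lemma triple_degenerate (h : R -> R -> R -> R) (e : R) :
  (forall x y z, h x y z = h y x z) ->
  [/\ forall b c, (h b c e - h b c e) * (c - b) = (h b c e - h b b e) * (b - b),
      forall b c, (h b c e - h c c e) * (c - c) = (h b c e - h c b e) * (b - c) &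
      forall a c, (h c c e - h a c e) * (c - a) = (h c c e - h a c e) * (c - a)].
Proof.
move=> s; split=> [b c|b c|//]; first by rewrite !subrr mul0r mulr0.
by rewrite (s b c) !subrr mul0r mulr0.
Qed.

(** The analogue of [H1_triple] one order higher: both sides equal (b - a)(c - a) times a third
    divided difference of [posp2]. *)
Lemma H2_triple a b c e :
  (H2 b c e - H2 a c e) * (c - a) = (H2 b c e - H2 a b e) * (b - a).
Proof.
have [t1 t2 t3] := triple_degenerate e (fun x y z => (H2_swap x y z).1).
have [->|ab] := eqVneq a b; first exact: t1.
have [->|ac] := eqVneq a c; first exact: t2.
have [->|bc] := eqVneq b c; first exact: t3.
apply/eqP; rewrite -subr_eq0 -normr_le0.
pose I1 := rint (fun _ : 'rV[R]_2 => 1).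
apply: (@le0_all_eps _ (2 * (I1 * `|c - a|) + 2 * (I1 * `|b - a|))) => d d0.
(* The fourth argument may coincide with one of the others, so the identity is proved at a nearby e'
   and transferred by the Lipschitz bound on [H2]. *)
have [e' he'] := avoid_finite [:: a; b; c] e d0; rewrite !inE !negb_or => /and3P[ea eb ec].
have z : (H2 b c e' - H2 a c e') * (c - a) - (H2 b c e' - H2 a b e') * (b - a) = 0.
  rewrite !H2_val // 1?eq_sym //.
  have [ba ca cb] : [/\ b != a, c != a & c != b] by rewrite ![_ == a]eq_sym ab ac eq_sym.
  have [ae be ce] : [/\ a != e', b != e' & c != e'] by rewrite ![_ == e']eq_sym.
  by field; rewrite !subr_eq0 ?ab ?ac ?bc ?ba ?ca ?cb ?ea ?eb ?ec ?ae ?be ?ce.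
have l x y : `|H2 x y e - H2 x y e'| <= I1 * d.
  apply: le_trans (H2_lip _ _ _ _ _ _) _.
  by rewrite /dist3 !subrr normr0 !add0r mulrC ler_wpM2l // ltW // rint1_gt0.
rewrite -[X in `|X|]subr0 -z.
move: {z} (l b c) (l a c) (l a b).
move: (H2 b c e) (H2 a c e) (H2 a b e) (H2 b c e') (H2 a c e') (H2 a b e').
move=> X Y Z X' Y' Z' lX lY lZ.
have -> : (X - Y) * (c - a) - (X - Z) * (b - a) -
   ((X' - Y') * (c - a) - (X' - Z') * (b - a)) =
  ((X - X') - (Y - Y')) * (c - a) - ((X - X') - (Z - Z')) * (b - a) by ring.
apply: le_trans (ler_normB _ _) _; rewrite !normrM mulrDl lerD //.
  rewrite (_ : _ * d = (I1 * d + I1 * d) * `|c - a|); last by ring.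
  by apply: ler_wpM2r => //; apply: le_trans (ler_normB _ _) _; rewrite lerD.
rewrite (_ : _ * d = (I1 * d + I1 * d) * `|b - a|); last by ring.
by apply: ler_wpM2r => //; apply: le_trans (ler_normB _ _) _; rewrite lerD.
Qed.

End PositivePart.

Section Moments.
Variable R : realType.

Lemma H1_posE (a b : R) : 0 <= a -> 0 <= b ->
  H1 a b = a * rint (fun _ : 'rV[R]_1 => 1) + (b - a) * rint (fun y : 'rV[R]_1 => y 0 ord0).
Proof.
move=> a0 b0; rewrite -rint_cst -rintZ; last exact: rnice_coord.
rewrite -rintD; [|exact: rnice_cst|by apply: rniceZ; apply: rnice_coord].
apply: rint_eq => y [h1 h2]; move: (h1 ord0) h2; rewrite big_ord1 => y0 y1.
rewrite dotE big_ord1 mxE posp_id 1?mulrC //; nra.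
Qed.

Lemma H2_posE (a b c : R) : 0 <= a -> 0 <= b -> 0 <= c ->
  H2 a b c = a * rint (fun _ : 'rV[R]_2 => 1) +
    (b - a) * rint (fun y : 'rV[R]_2 => y 0 ord0) +
    (c - a) * rint (fun y : 'rV[R]_2 => y 0 ord_max).
Proof.
move=> a0 b0 c0; rewrite -rint_cst -!rintZ; try exact: rnice_coord.
rewrite -rintD; [|exact: rnice_cst|by apply: rniceZ; apply: rnice_coord].
rewrite -rintD; [|apply: rniceD; first exact: rnice_cst|]; try by apply: rniceZ; apply: rnice_coord.
apply: rint_eq => y /ref2[y0 y1 ys]; rewrite pair_rv_dot posp_id; first by ring.
move: y0 y1 ys; move: (y 0 ord0) (y 0 ord_max) => s t *.
have -> : a + (s * (b - a) + t * (c - a)) = (1 - s - t) * a + s * b + t * c by ring.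
by rewrite !addr_ge0 ?mulr_ge0 //; lra.
Qed.

(** For nonnegative vertex values the positive part is inactive and [H1] is linear in the moments.
    Its closed formula at two sets of data therefore determines them. The triangle is treated
    likewise with three sets. *)
Lemma rint_moment1 : rint (fun _ : 'rV[R]_1 => 1) = 1 /\
  forall i, rint (fun y : 'rV[R]_1 => y 0 i) = 2^-1.
Proof.
have f1 := H1_formula (0 : R) 1; have f2 := H1_formula (1 : R) 2.
have e1 : H1 0 1 = 2^-1 :> R by rewrite /posp1 !posp_id // in f1; lra.
have e2 : H1 1 2 = 3 / 2 :> R by rewrite /posp1 !posp_id // in f2; lra.
rewrite H1_posE // subr0 mul0r add0r mul1r in e1.
rewrite H1_posE // mul1r e1 in e2; split; first by lra.
by move=> i; rewrite ord1 e1.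
Qed.

Lemma rint_moment2 : rint (fun _ : 'rV[R]_2 => 1) = 2^-1 /\
  forall i, rint (fun y : 'rV[R]_2 => y 0 i) = 6^-1.
Proof.
have f1 := H2_formula (0 : R) 1 2; have f2 := H2_formula (0 : R) 2 1.
have f3 := H2_formula (1 : R) 2 3.
rewrite H2_posE // /posp2 !posp_id // in f1.
rewrite H2_posE // /posp2 !posp_id // in f2.
rewrite H2_posE // /posp2 !posp_id // in f3.
move: f1 f2 f3.
set I := rint (fun=> 1); set I0 := rint (fun y => y 0 ord0); set I1 := rint _.
move=> f1 f2 f3; have [e0 e1] : I0 = 6^-1 /\ I1 = 6^-1 by split; lra.
split; first by lra.
move=> i; case: (unliftP ord0 i) => [j|] ->; last exact: e0.
transitivity I1; last exact: e1.
by rewrite ord1; apply: rint_eq => y _; congr (y _ _); exact/val_inj.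
Qed.

Lemma rint_moment k (i : 'I_k) : k = 1%N \/ k = 2%N ->
  rint (fun y : 'rV[R]_k => y 0 i) = k.+1%:R^-1 * rint (fun _ : 'rV[R]_k => 1).
Proof.
case=> h; subst k; first by have [-> ->] := rint_moment1; rewrite mulr1.
by have [-> ->] := rint_moment2; lra.
Qed.

Lemma rint_H1 k (a b : R) (e : 'rV[R]_k) : k = 1%N -> (forall i, e 0 i = b - a) ->
  rint (fun y : 'rV[R]_k => posp (a + dot y e)) = H1 a b.
Proof.
move=> h; subst k => he; apply: rint_eq => y _; congr (posp (_ + dot y _)).
by apply/rowP => i; rewrite mxE he.
Qed.

Lemma rint_H2 k (a b c : R) (e : 'rV[R]_k) : k = 2%N ->
  (forall i, e 0 i = if i == 0%N :> nat then b - a else c - a) ->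
  rint (fun y : 'rV[R]_k => posp (a + dot y e)) = H2 a b c.
Proof.
move=> h; subst k => he; apply: rint_eq => y _; congr (posp (_ + dot y _)).
by apply/rowP => i; rewrite mxE he.
Qed.

(** Raising one vertex value raises the positive part pointwise by at most b - a times the
    barycentric coordinate of that vertex, whose integral is 1/2. These bounds become 0 <= theta <=
    1. *)
Lemma H1_mono (a b c : R) : a <= b -> 0 <= H1 b c - H1 a c <= (b - a) / 2.
Proof.
move=> ab; rewrite !(H1_sym _ c).
rewrite /H1 -rintB; try exact: rnice_posp.
have h y : ref_simplex R 1 y ->
  0 <= posp (c + dot y (const_mx (b - c))) - posp (c + dot y (const_mx (a - c))) <= (b - a) * y 0 ord0.
  move=> [/(_ ord0) y0 _]; rewrite !dotE !big_ord1 !mxE.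
  have := @posp_diff _ (c + y 0 ord0 * (a - c)) (c + y 0 ord0 * (b - c)).
  have -> : c + y 0 ord0 * (b - c) - (c + y 0 ord0 * (a - c)) = (b - a) * y 0 ord0 by ring.
  by apply; rewrite lerD2l; apply: ler_wpM2l; [exact: ltW|lra].
have n1 := rniceB (rnice_posp c (const_mx (b - c) : 'rV[R]_1)) (rnice_posp c (const_mx (a - c))).
apply/andP; split; first by apply: rint_ge0 => // y /h /andP[].
have [_ e] := rint_moment1.
rewrite -[2^-1](e ord0) -rintZ; last exact: rnice_coord.
by apply: le_rint => [//||y /h /andP[]//]; apply: rniceZ; apply: rnice_coord.
Qed.

Lemma H2_mono (a b c e : R) : a <= b -> 0 <= H2 b c e - H2 a c e <= (b - a) / 6.
Proof.
move=> ab; rewrite !(H2_swap _ c _).1.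
rewrite /H2 -rintB; try exact: rnice_posp.
have h y : ref_simplex R 2 y ->
  0 <= posp (c + dot y (pair_rv (b - c) (e - c))) - posp (c + dot y (pair_rv (a - c) (e - c))) <= (b - a) * y 0 ord0.
  move=> /ref2[y0 _ _]; rewrite !pair_rv_dot.
  set u := c + _; set v := c + _.
  have <- : u - v = (b - a) * y 0 ord0 by rewrite /u /v; ring.
  by apply: posp_diff; rewrite lerD2l lerD2r; apply: ler_wpM2l; [exact: ltW|lra].
have n1 := rniceB (rnice_posp c (pair_rv (b - c) (e - c))) (rnice_posp c (pair_rv (a - c) (e - c))).
apply/andP; split; first by apply: rint_ge0 => // y /h /andP[].
have [_ m] := rint_moment2.
rewrite -[6^-1](m ord0) -rintZ; last exact: rnice_coord.
by apply: le_rint => [//||y /h /andP[]//]; apply: rniceZ; apply: rnice_coord.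
Qed.

End Moments.

Section SimplexIntegrals.
Variables (R : realType) (N : nat) (m : mesh R N).
Local Notation V := 'I_(nvert m).
Implicit Types (S T F : {set V}) (q : P1 R N) (f g : 'rV[R]_N -> R).

Definition spar S (y : 'rV[R]_#|S|.-1) : 'rV[R]_N := (svert S)`_0 + y *m sedge S.

Arguments spar : clear implicits.

Definition jac S : R := Num.sqrt (\det (sedge S *m (sedge S)^T)).

Lemma sintE S f : sint S f = jac S * rint (fun y => f (spar S y)).
Proof. by rewrite rint.unlock. Qed.

Lemma jac_ge0 S : 0 <= jac S.
Proof. exact: sqrtr_ge0. Qed.

Definition snice S f := rnice (fun y : 'rV[R]_#|S|.-1 => f (spar S y)).

Lemma svert_nth S i : (i < #|S|)%N ->
  exists2 v, v \in S & (svert S)`_i = pt m v /\ index v (enum S) = i.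
Proof.
move=> hi; have S0 : (0 < size (enum S))%N by rewrite -cardE; case: #|S| hi.
have [v0 _] : exists v, v \in enum S by case: (enum S) S0 => // v s _; exists v; rewrite mem_head.
exists (nth v0 (enum S) i); first by rewrite -mem_enum mem_nth // -cardE.
by rewrite (nth_map v0) -?cardE // index_uniq -?cardE ?enum_uniq.
Qed.

Lemma pt_svert S v : v \in S -> pt m v = (svert S)`_(index v (enum S)).
Proof.
by move=> vS; rewrite (nth_map v) ?index_mem ?mem_enum // nth_index ?mem_enum.
Qed.

Lemma sum_svert S (E : zmodType) (G : nat -> 'rV[R]_N -> E) :
  \sum_(v in S) G (index v (enum S)) (pt m v) = \sum_(i < #|S|) G i (svert S)`_i.
Proof.
rewrite big_enum_val /=; case: (pickP (mem S)) => [v0 v0S|S0]; last first.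
  have e0 : #|S| = 0%N by apply: eq_card0.
  by rewrite !big1 // => -[i hi]; exfalso; rewrite e0 in hi.
apply: eq_bigr => i _; rewrite (enum_val_nth v0).
rewrite index_uniq ?enum_uniq -?cardE ?ltn_ord //.
by rewrite (nth_map v0) // -cardE ltn_ord.
Qed.

Lemma sum_card_recl S (E : zmodType) (G : nat -> E) : (0 < #|S|)%N ->
  \sum_(i < #|S|) G i = G 0%N + \sum_(i < #|S|.-1) G i.+1.
Proof.
by move=> S0; have e : #|S| = #|S|.-1.+1; [by rewrite prednK|rewrite [in LHS]e big_ord_recl].
Qed.

(** The barycentric coordinates of [spar S y]: the first enumerated vertex receives the remainder,
    and vertex i + 1 the coordinate i of y. The default 0 is not reached by vertices of S. *)
Definition sweight S (y : 'rV[R]_#|S|.-1) (v : V) : R :=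
  if index v (enum S) is i.+1 then (if insub i is Some j then y 0 j else 0)
  else 1 - \sum_i y 0 i.

Lemma sum_sweight S (y : 'rV[R]_#|S|.-1) : (0 < #|S|)%N ->
  \sum_(v in S) sweight y v = 1 /\ spar S y = \sum_(v in S) sweight y v *: pt m v.
Proof.
move=> S0.
pose W i : R := if i is i'.+1 then (if insub i' is Some j then y 0 j else 0)
  else 1 - \sum_i y 0 i.
have h1 := @sum_svert S R (fun i _ => W i).
have h2 := @sum_svert S _ (fun i x => W i *: x).
have sE v : sweight y v = W (index v (enum S)) by [].
rewrite (eq_bigr _ (fun v _ => sE v)) h1.
rewrite (eq_bigr (fun v => W (index v (enum S)) *: pt m v)); last by move=> v _; rewrite sE.
rewrite h2 /spar => {h1 h2 sE}.
have WE (i : 'I_#|S|.-1) : W i.+1 = y 0 i.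
  by rewrite /W; case: insubP => [j _ /val_inj ->//|]; rewrite ltn_ord.
split.
  rewrite (@sum_card_recl S R W) //.
  by under eq_bigr do rewrite WE; rewrite subrK.
rewrite (@sum_card_recl S _ (fun i => W i *: (svert S)`_i)) //.
under [in RHS]eq_bigr do rewrite WE.
rewrite scalerBl scale1r -addrA; congr (_ + _).
apply/rowP => j; rewrite !mxE !summxE mulr_suml addrC -sumrB.
by apply: eq_bigr => i _; rewrite !mxE mulrBr.
Qed.

Lemma sweight_gt0 S (y : 'rV[R]_#|S|.-1) v : v \in S -> ref_simplex R #|S|.-1 y ->
  0 < sweight y v.
Proof.
move=> vS [h1 h2]; rewrite /sweight.
have := vS; rewrite -mem_enum -index_mem -cardE.
case: (index v (enum S)) => [|i] hi; first by rewrite subr_gt0.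
by case: insubP => [j _ _|]; [exact: h1|rewrite -ltnS prednK ?hi // (leq_ltn_trans _ hi)].
Qed.

Lemma spar_osimplex S (y : 'rV[R]_#|S|.-1) : (0 < #|S|)%N ->
  ref_simplex R #|S|.-1 y -> osimplex S (spar S y).
Proof.
move=> S0 hy; have [h1 h2] := sum_sweight y S0.
by exists (sweight y); split=> // v vS; apply: sweight_gt0.
Qed.

Lemma sint_eq S f g : (0 < #|S|)%N ->
  (forall x, osimplex S x -> f x = g x) -> sint S f = sint S g.
Proof.
move=> S0 fg; rewrite !sintE; congr (_ * _); apply: rint_eq => y hy.
by apply: fg; apply: spar_osimplex.
Qed.

Lemma sintD S f g : snice S f -> snice S g ->
  sint S (fun x => f x + g x) = sint S f + sint S g.
Proof. by move=> nf ng; rewrite !sintE rintD // mulrDr. Qed.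

Lemma sintZ S c f : snice S f -> sint S (fun x => c * f x) = c * sint S f.
Proof. by move=> nf; rewrite !sintE rintZ // mulrCA. Qed.

Lemma sintB S f g : snice S f -> snice S g ->
  sint S (fun x => f x - g x) = sint S f - sint S g.
Proof. by move=> nf ng; rewrite !sintE rintB // mulrBr. Qed.

Lemma sint_sum S (I : Type) (r : seq I) (f : I -> 'rV[R]_N -> R) :
  (forall i, snice S (f i)) ->
  sint S (fun x => \sum_(i <- r) f i x) = \sum_(i <- r) sint S (f i).
Proof.
move=> nf; rewrite !sintE rint_sum // mulr_sumr.
by apply: eq_bigr => i _; rewrite sintE.
Qed.

Lemma sint_cst S c : sint S (fun=> c) = c * smeas S.
Proof. by rewrite /smeas !sintE rint_cst mulrCA. Qed.

Lemma smeas_ge0 S : 0 <= smeas S.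
Proof. by rewrite /smeas sintE mulr_ge0 ?jac_ge0 // ltW // rint1_gt0. Qed.

Lemma le_sint S f g : (0 < #|S|)%N -> snice S f -> snice S g ->
  (forall x, osimplex S x -> f x <= g x) -> sint S f <= sint S g.
Proof.
move=> S0 nf ng fg; rewrite !sintE ler_wpM2l ?jac_ge0 //.
by apply: le_rint => // y hy; apply: fg; apply: spar_osimplex.
Qed.

Lemma snice_cst S c : snice S (fun=> c).
Proof. exact: rnice_cst. Qed.

Lemma sint_abs_le S f K : (0 < #|S|)%N -> snice S f ->
  (forall x, osimplex S x -> `|f x| <= K) -> `|sint S f| <= K * smeas S.
Proof.
move=> S0 nf fK; rewrite /smeas !sintE normrM (ger0_norm (jac_ge0 _)) mulrCA.
rewrite ler_wpM2l ?jac_ge0 //; apply: rint_abs_le => // y hy.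
by apply: fK; apply: spar_osimplex.
Qed.

Lemma snice_eq S f g : (0 < #|S|)%N ->
  (forall x, osimplex S x -> f x = g x) -> snice S f -> snice S g.
Proof.
by move=> S0 fg; apply: rnice_eq => y hy; apply: fg; apply: spar_osimplex.
Qed.

Lemma peval_spar S q (y : 'rV[R]_#|S|.-1) :
  peval q (spar S y) = peval q (svert S)`_0 + dot y (q.2 *m (sedge S)^T).
Proof.
rewrite /peval /spar dotDr addrA; congr (_ + _).
by rewrite [RHS]dotC /dot trmx_mul mulmxA.
Qed.

Lemma sedge_dot S q i : (q.2 *m (sedge S)^T) 0 i =
  peval q (svert S)`_i.+1 - peval q (svert S)`_0.
Proof.
rewrite /peval opprD addrACA subrr add0r -dotBr dotE mxE.
by apply: eq_bigr => j _; rewrite !mxE.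
Qed.

Lemma snice_peval S q : snice S (peval q).
Proof.
rewrite /snice; under eq_fun do rewrite peval_spar.
by apply: rniceD; [apply: rnice_cst|apply: rnice_dot].
Qed.

Lemma snice_posp S q : snice S (fun x => posp (peval q x)).
Proof.
rewrite /snice; under eq_fun do rewrite peval_spar.
exact: rnice_posp.
Qed.

Definition savg S f : R := (smeas S)^-1 * sint S f.

Lemma savg_rint S f : smeas S != 0 ->
  savg S f = (rint (fun _ : 'rV[R]_#|S|.-1 => 1))^-1 * rint (fun y => f (spar S y)).
Proof.
rewrite /savg /smeas !sintE => h; rewrite invfM mulrA; congr (_ * _).
rewrite mulrAC mulVf ?mul1r //; apply: contra_neq h => ->; exact: mul0r.
Qed.

Definition bary S : 'rV[R]_N := #|S|%:R^-1 *: \sum_(v in S) pt m v.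

Lemma savg_peval S q : smeas S != 0 -> #|S| = 2%N \/ #|S| = 3%N ->
  savg S (peval q) = peval q (bary S).
Proof.
move=> S0 cS; rewrite savg_rint //.
have k12 : #|S|.-1 = 1%N \/ #|S|.-1 = 2%N by case: cS => ->; [left|right].
have e : #|S| = #|S|.-1.+1 by case: cS => ->.
have I0 := rint1_gt0 R #|S|.-1.
under [X in _ * rint X]eq_fun do rewrite peval_spar.
rewrite rintD; [|exact: rnice_cst|exact: rnice_dot].
under [X in _ + rint X]eq_fun do rewrite dotE.
rewrite rint_sum; last by move=> i; apply: rniceM; [apply: rnice_coord|apply: rnice_cst].
rewrite (rint_cst _ (peval q (svert S)`_0)).
have -> : \sum_(i < #|S|.-1) rint (fun y : 'rV[R]_#|S|.-1 => y 0 i * (q.2 *m (sedge S)^T) 0 i)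
  = rint (fun _ : 'rV[R]_#|S|.-1 => 1) * (#|S|%:R^-1 * \sum_(i < #|S|.-1) (q.2 *m (sedge S)^T) 0 i).
  rewrite mulrA mulr_sumr; apply: eq_bigr => i _.
  under [X in rint X]eq_fun do rewrite mulrC.
  by rewrite rintZ; [rewrite rint_moment // -e mulrC; congr (_ * _); rewrite mulrC|exact: rnice_coord].
rewrite [_ * rint _]mulrC -mulrDr mulKf ?gt_eqF //.
under eq_bigr do rewrite sedge_dot.
rewrite sumrB sumr_const card_ord.
have -> : \sum_(i < #|S|.-1) peval q (svert S)`_i.+1 =
   \sum_(v in S) peval q (pt m v) - peval q (svert S)`_0.
  rewrite (@sum_svert S R (fun _ x => peval q x)) (@sum_card_recl S R (fun i => peval q (svert S)`_i)) //; last by case: cS => ->.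
  by rewrite addrAC subrr add0r.
have -> : peval q (bary S) = #|S|%:R^-1 * \sum_(v in S) peval q (pt m v).
  rewrite /peval /bary dotZr dot_sumr big_split /= sumr_const mulrDr; congr (_ + _).
  by rewrite -[q.1 *+ _]mulr_natl mulKf // pnatr_eq0 e.
have n0 : (#|S|%:R : R) != 0 by rewrite pnatr_eq0 e.
have ek : (#|S|.-1%:R : R) = #|S|%:R - 1 by rewrite [in RHS]e -natr1 addrK.
rewrite -[peval q _ *+ _]mulr_natl ek; move: (peval q _) (\sum_(v in S) _) (#|S|%:R : R) n0 => x s n n0.
by field.
Qed.

Lemma enum2 S (a b : V) : a != b -> S = [set a; b]%SET ->
  enum S = [:: a; b] \/ enum S = [:: b; a].
Proof.
move=> ab hS; have : perm_eq (enum S) [:: a; b].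
  apply: uniq_perm; rewrite ?enum_uniq //=; first by rewrite inE ab.
  by move=> x; rewrite mem_enum hS !inE.
have : size (enum S) = 2%N by rewrite -cardE hS cards2 ab.
case: (enum S) => [|x [|y [|]]] //= _ /perm_mem h.
have hx := h x; have hy := h y; have ha := h a; have hb := h b.
move: hx hy ha hb; rewrite !inE !eqxx !orbT /=.
by move=> /esym/orP[]/eqP-> /esym/orP[]/eqP->; rewrite ?orbb ?(negPf ab) ?(eq_sym b) ?(negPf ab) //=; auto.
Qed.

(** The parametrization follows the enumeration of S; symmetry of [H1] removes the dependence on
    that order. *)
Lemma savg_posp2 S q (a b : V) : smeas S != 0 -> a != b -> S = [set a; b]%SET ->
  savg S (fun x => posp (peval q x)) = H1 (peval q (pt m a)) (peval q (pt m b)).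
Proof.
move=> S0 ab hS; rewrite savg_rint //.
have c2 : #|S| = 2%N by rewrite hS cards2 ab.
have -> : rint (fun _ : 'rV[R]_#|S|.-1 => 1) = 1.
  by rewrite c2; have [] := rint_moment1 R.
rewrite invr1 mul1r; under [X in rint X]eq_fun do rewrite peval_spar.
have key x y : enum S = [:: x; y] -> (svert S)`_0 = pt m x /\ forall i, (q.2 *m (sedge S)^T) 0 i =
   peval q (pt m y) - peval q (pt m x).
  move=> h; split=> [|i]; first by rewrite /svert h.
  rewrite sedge_dot /svert h.
  have hi : (i < 1)%N by rewrite -[X in (_ < X)%N]/(2.-1) -c2; exact: ltn_ord.
  by case: (i : nat) hi.
case: (enum2 ab hS) => /key[-> h]; first by rewrite (rint_H1 _ h) ?c2.
by rewrite (rint_H1 _ h) ?c2 // H1_sym.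
Qed.

Lemma enum3 S (a b c : V) : uniq [:: a; b; c] -> S = [set a; b; c]%SET ->
  [\/ enum S = [:: a; b; c], enum S = [:: a; c; b], enum S = [:: b; a; c] |
  [\/ enum S = [:: b; c; a], enum S = [:: c; a; b] | enum S = [:: c; b; a]]].
Proof.
move=> u hS; have p : perm_eq (enum S) [:: a; b; c].
  apply: uniq_perm; rewrite ?enum_uniq //= => x.
  by rewrite mem_enum hS !inE orbA.
have := perm_size p; have uS := enum_uniq (mem S).
have := perm_mem p; move: uS.
case: (enum S) => [|x [|y [|z [|]]]] //= uS h _.
have hx := h x; have hy := h y; have hz := h z.
move: hx hy hz uS; rewrite !inE !eqxx !orbT /= => /esym hx /esym hy /esym hz.
case/or3P: hx => /eqP->; case/or3P: hy => /eqP->; case/or3P: hz => /eqP->;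
  rewrite ?eqxx ?orbT ?andbF //= => _.
- by apply: Or41.
- by apply: Or42.
- by apply: Or43.
- by apply: Or44; apply: Or31.
- by apply: Or44; apply: Or32.
- by apply: Or44; apply: Or33.
Qed.

(** The factor 2 is the inverse measure of the reference triangle, and the symmetry of [H2] covers
    the six enumerations. *)
Lemma savg_posp3 S q (a b c : V) : smeas S != 0 -> uniq [:: a; b; c] -> S = [set a; b; c]%SET ->
  savg S (fun x => posp (peval q x)) =
  2 * H2 (peval q (pt m a)) (peval q (pt m b)) (peval q (pt m c)).
Proof.
move=> S0 u hS; rewrite savg_rint //.
have c3 : #|S| = 3%N.
  have := enum3 u hS; rewrite cardE; by case=> [||| []] ->.
have -> : rint (fun _ : 'rV[R]_#|S|.-1 => 1) = 2^-1.
  by rewrite c3; have [] := rint_moment2 R.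
rewrite invrK; congr (_ * _); under [X in rint X]eq_fun do rewrite peval_spar.
have key x y z : enum S = [:: x; y; z] -> (svert S)`_0 = pt m x /\ forall i : 'I_#|S|.-1, (q.2 *m (sedge S)^T) 0 i =
   if i == 0%N :> nat then peval q (pt m y) - peval q (pt m x)
   else peval q (pt m z) - peval q (pt m x).
  move=> h; split=> [|i]; first by rewrite /svert h.
  rewrite sedge_dot /svert h.
  have hi : (i < 2)%N by rewrite -[X in (_ < X)%N]/(3.-1) -c3; exact: ltn_ord.
  by case: (i : nat) hi => [|[|]].
have s1 (x y z : R) : H2 x y z = H2 y x z := (H2_swap x y z).1.
have s2 (x y z : R) : H2 x y z = H2 x z y := (H2_swap x y z).2.
case: (enum3 u hS) => [|||[||]] /key[-> h]; rewrite (rint_H2 _ h) ?c3 //.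
- by rewrite s2 s1.
- by rewrite s1 s2.
- by rewrite s1 s2 s1.
Qed.

End SimplexIntegrals.
Arguments spar {R N m} S y.

(** * Barycentric coordinates and volumes *)

Section Barycentric.
Variables (R : realType) (N : nat) (m : mesh R N).
Local Notation V := 'I_(nvert m).
Implicit Types (S T F : {set V}) (q : P1 R N) (x y : 'rV[R]_N).

Definition is_bary T (l : V -> P1 R N) : Prop :=
  [/\ forall a v, a \in T -> v \in T -> peval (l a) (pt m v) = (v == a)%:R,
      forall x, \sum_(a in T) peval (l a) x = 1 &
      forall x, \sum_(a in T) peval (l a) x *: pt m a = x].

Definition lam T : V -> P1 R N := xget (fun _ => (0, 0)) [set l | is_bary T l].

(** Vertices in homogeneous coordinates, one row (1, p) per vertex. The columns of the inverse are
    the coefficients of the barycentric coordinates. *)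
Definition vmx (e : 'I_(1 + N) -> V) : 'M[R]_(1 + N) :=
  \matrix_(i, j) (row_mx (1%:M : 'rV[R]_1) (pt m (e i)) : 'rV[R]_(1 + N)) 0 j.

Lemma vmx_row e i : row i (vmx e) = row_mx (1%:M : 'rV[R]_1) (pt m (e i)).
Proof. by apply/rowP => j; rewrite !mxE. Qed.

Definition enumerates (e : 'I_(1 + N) -> V) T :=
  injective e /\ forall v, (v \in T) = [exists i, e i == v].

Lemma enumeratesP e T : enumerates e T ->
  forall (E : nmodType) (G : V -> E), \sum_(v in T) G v = \sum_i G (e i).
Proof.
move=> [ie eT] E G; rewrite (reindex_omap e (fun v => [pick i | e i == v])) /=; last first.
  move=> v; rewrite eT => /existsP[i /eqP ev]; case: pickP => [j /eqP <-//|/(_ i)].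
  by rewrite ev eqxx.
apply: eq_bigl => i; rewrite eT; case: pickP => [j /eqP /ie ->|/(_ i)]; last by rewrite eqxx.
by rewrite eqxx andbT; apply/existsP; exists i.
Qed.

Lemma enumerates_ex T : #|T| = N.+1 -> exists e, enumerates e T.
Proof.
move=> cT; have e1 : (1 + N)%N = #|T| by rewrite cT.
exists (fun i => enum_val (cast_ord e1 i)); split.
  by move=> i j /enum_val_inj /cast_ord_inj.
move=> v; apply/idP/existsP => [vT|[i /eqP <-]]; last exact: enum_valP.
by exists (cast_ord (esym e1) (enum_rank_in vT v)); rewrite cast_ordKV enum_rankK_in.
Qed.

Lemma vmx_unit e T : enumerates e T -> aff_indep T -> vmx e \in unitmx.
Proof.
move=> eT aT; rewrite -row_free_unit -kermx_eq0; apply/negP => /negP.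
case/rowV0Pn => u /sub_kermxP uM u0.
have [ie eT'] := eT.
pose l v := if [pick i | e i == v] is Some i then u 0 i else 0.
have lE i : l (e i) = u 0 i.
  by rewrite /l; case: pickP => [j /eqP /ie ->//|/(_ i)]; rewrite eqxx.
have h : \sum_i u 0 i *: row i (vmx e) = 0 by rewrite -mulmx_sum_row.
have hl : forall v, v \in T -> l v = 0.
  apply: aT; rewrite (enumeratesP eT).
    under eq_bigr do rewrite lE.
    transitivity ((\sum_i u 0 i *: row i (vmx e)) 0 (lshift N 0)); last by rewrite h mxE.
    rewrite summxE; apply: eq_bigr => i _.
    by rewrite vmx_row mxE row_mxEl mxE eqxx mulr1.
  under eq_bigr do rewrite lE.
  apply/rowP => j.
  transitivity ((\sum_i u 0 i *: row i (vmx e)) 0 (rshift 1 j)); last by rewrite h !mxE.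
  rewrite !summxE; apply: eq_bigr => i _.
  by rewrite vmx_row [RHS]mxE row_mxEr mxE.
case/rV0Pn: u0 => i; rewrite -lE hl ?eqxx // eT'.
by apply/existsP; exists i.
Qed.

Lemma lam_bary T : #|T| = N.+1 -> aff_indep T -> is_bary T (lam T).
Proof.
move=> cT aT; rewrite /lam; case: xgetP => [l -> //|/(_ _)]; move=> h; exfalso.
have [e eT] := enumerates_ex cT; have [ie eT'] := eT.
have uM := vmx_unit eT aT.
pose G := invmx (vmx e).
pose l v : P1 R N := if [pick i | e i == v] is Some i then
  (G (lshift N 0) i, \row_j G (rshift 1 j) i) else (0, 0).
have lE i : l (e i) = (G (lshift N 0) i, \row_j G (rshift 1 j) i).
  by rewrite /l; case: pickP => [j /eqP /ie ->//|/(_ i)]; rewrite eqxx.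
have pE i x : peval (l (e i)) x = (row_mx (1%:M : 'rV[R]_1) x *m G) 0 i.
  rewrite lE /peval /= mxE big_split_ord /= big_ord1 row_mxEl mxE eqxx mul1r.
  rewrite dotE; congr (_ + _); apply: eq_bigr => j _.
  by rewrite row_mxEr mxE mulrC.
have hx x : \sum_i peval (l (e i)) x *: row_mx (1%:M : 'rV[R]_1) (pt m (e i)) =
    row_mx (1%:M : 'rV[R]_1) x.
  rewrite -[RHS]mulmx1 -(mulVmx uM) mulmxA mulmx_sum_row; apply: eq_bigr => i _.
  by rewrite pE vmx_row.
apply: (h l); split.
- move=> a v; rewrite !eT' => /existsP[i /eqP <-] /existsP[j /eqP <-].
  rewrite pE -vmx_row -row_mul mulmxV // !mxE (inj_eq ie); by rewrite eq_sym.
- move=> x; rewrite (enumeratesP eT).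
  transitivity ((\sum_i peval (l (e i)) x *: row_mx (1%:M : 'rV[R]_1) (pt m (e i))) 0 (lshift N 0)).
    rewrite summxE; apply: eq_bigr => i _.
    by rewrite [RHS]mxE row_mxEl mxE eqxx mulr1.
  by rewrite hx row_mxEl mxE eqxx.
- move=> x; rewrite (enumeratesP eT); apply/rowP => j.
  transitivity ((\sum_i peval (l (e i)) x *: row_mx (1%:M : 'rV[R]_1) (pt m (e i))) 0 (rshift 1 j)).
    rewrite !summxE; apply: eq_bigr => i _.
    by rewrite [RHS]mxE row_mxEr mxE.
  by rewrite hx row_mxEr.
Qed.

End Barycentric.

(** * Simplices described by barycentric coordinates *)

Section SimplexGeometry.
Variables (R : realType) (N : nat) (m : mesh R N).
Local Notation V := 'I_(nvert m).
Implicit Types (S T F : {set V}) (q : P1 R N) (x y : 'rV[R]_N) (l : V -> R).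

Definition nondeg T := #|T| = N.+1 /\ aff_indep T.

Lemma pevalB q x y : peval q x - peval q y = dot q.2 (x - y).
Proof. by rewrite /peval opprD addrACA subrr add0r dotBr. Qed.

Lemma peval_comb S l q : \sum_(v in S) l v = 1 ->
  peval q (\sum_(v in S) l v *: pt m v) = \sum_(v in S) l v * peval q (pt m v).
Proof.
move=> l1; have e : q.1 = \sum_(v in S) l v * q.1 by rewrite -mulr_suml l1 mul1r.
rewrite /peval dot_sumr {1}e -big_split /=.
by apply: eq_bigr => v _; rewrite dotZr mulrDr.
Qed.

Lemma peval_conv q t x y : peval q (x + t *: (y - x)) = peval q x + t * (peval q y - peval q x).
Proof. by rewrite pevalB /peval dotDr dotZr addrA. Qed.

Section Fixed.
Variables (T : {set V}) (hT : nondeg T).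
Let hb : is_bary T (lam T) := lam_bary hT.1 hT.2.
Local Notation L a := (peval (lam T a)).

Lemma lam_vert a v : a \in T -> v \in T -> L a (pt m v) = (v == a)%:R.
Proof. by case: hb => h _ _; apply: h. Qed.

Lemma lam_sum1 x : \sum_(a in T) L a x = 1.
Proof. by case: hb. Qed.

Lemma lam_comb x : \sum_(a in T) L a x *: pt m a = x.
Proof. by case: hb. Qed.

Lemma peval_lam q x : peval q x = \sum_(a in T) L a x * peval q (pt m a).
Proof. by rewrite -peval_comb ?lam_sum1 // lam_comb. Qed.

Lemma lam_of_comb S l a : S \subset T -> a \in T -> \sum_(v in S) l v = 1 ->
  L a (\sum_(v in S) l v *: pt m v) = if a \in S then l a else 0.
Proof.
move=> /fintype.subsetP ST aT l1; rewrite peval_comb //.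
case: ifPn => aS.
  rewrite (bigD1 a) //= lam_vert // eqxx mulr1 big1 ?addr0 // => v /andP[vS va].
  by rewrite lam_vert ?ST // (negPf va) mulr0.
rewrite big1 // => v vS; rewrite (lam_vert aT (ST _ vS)).
by case: eqP => [va|_]; rewrite ?mulr0 //; move: aS; rewrite -va vS.
Qed.

Lemma comb_subset S x : S \subset T -> (forall a, a \in T -> a \notin S -> L a x = 0) ->
  \sum_(v in S) L v x = 1 /\ \sum_(v in S) L v x *: pt m v = x.
Proof.
move=> ST h0; split; [rewrite -(lam_sum1 x)|rewrite -[RHS](lam_comb x)];
  rewrite [RHS](big_setID S) /= (finset.setIidPr ST) [X in _ = _ + X]big1 ?addr0 //.
  by move=> a; rewrite inE => /andP[? ?]; apply: h0.
by move=> a; rewrite inE => /andP[? ?]; rewrite h0 ?scale0r.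
Qed.

Lemma osimplexP S x : S \subset T -> osimplex S x <->
  (forall a, a \in S -> 0 < L a x) /\ (forall a, a \in T -> a \notin S -> L a x = 0).
Proof.
move=> ST; split=> [[l [l0 l1 ->]]|[h1 h2]].
  split=> a aS; first by rewrite lam_of_comb ?aS ?l0 // (fintype.subsetP ST).
  by move=> aS'; rewrite lam_of_comb // (negPf aS').
by have [e1 e2] := comb_subset ST h2; exists (fun a => L a x).
Qed.

Lemma csimplexP S x : S \subset T -> csimplex S x <->
  (forall a, a \in S -> 0 <= L a x) /\ (forall a, a \in T -> a \notin S -> L a x = 0).
Proof.
move=> ST; split=> [[l [l0 l1 ->]]|[h1 h2]].
  split=> a aS; first by rewrite lam_of_comb ?aS ?l0 // (fintype.subsetP ST).
  by move=> aS'; rewrite lam_of_comb // (negPf aS').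
by have [e1 e2] := comb_subset ST h2; exists (fun a => L a x).
Qed.

Lemma osimplexT x : osimplex T x <-> forall a, a \in T -> 0 < L a x.
Proof.
rewrite osimplexP //; split=> [[]//|h]; split=> // a aT; by rewrite aT.
Qed.

Lemma csimplexT x : csimplex T x <-> forall a, a \in T -> 0 <= L a x.
Proof.
rewrite csimplexP //; split=> [[]//|h]; split=> // a aT; by rewrite aT.
Qed.

Lemma lam_bounds a x : csimplex T x -> a \in T -> 0 <= L a x <= 1.
Proof.
move=> /csimplexT h aT; rewrite h //= -(lam_sum1 x) (bigD1 a) //= lerDl.
by apply: sumr_ge0 => v /andP[vT _]; apply: h.
Qed.

Lemma cell_gt0 : (0 < #|T|)%N.
Proof. by rewrite hT.1. Qed.

Lemma lam_baryc S a : S \subset T -> (0 < #|S|)%N -> a \in T ->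
  L a (bary S) = if a \in S then #|S|%:R^-1 else 0.
Proof.
move=> ST S0 aT; rewrite /bary scaler_sumr.
apply: (lam_of_comb (l := fun=> #|S|%:R^-1)) => //.
by rewrite sumr_const -[LHS]mulr_natl mulfV // pnatr_eq0 -lt0n.
Qed.

Lemma osimplex_bary S : S \subset T -> (0 < #|S|)%N -> osimplex S (bary S).
Proof.
move=> ST S0; apply/osimplexP => //; split=> a aT.
  by rewrite lam_baryc ?aT ?(fintype.subsetP ST) // invr_gt0 ltr0n.
by move=> aS; rewrite lam_baryc // (negPf aS).
Qed.

Lemma osimplex_csimplex S : osimplex S `<=` csimplex (m := m) S.
Proof. by move=> x [l [l0 l1 ->]]; exists l; split=> // v vS; apply: ltW; apply: l0. Qed.

Lemma csimplex_sub S : S \subset T -> csimplex S `<=` csimplex (m := m) T.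
Proof.
move=> ST x /(csimplexP _ ST)[h1 h2]; apply/csimplexT => a aT.
by have [aS|aS] := boolP (a \in S); [apply: h1|rewrite h2].
Qed.

Lemma vert_csimplex a : a \in T -> csimplex T (pt m a).
Proof. by move=> aT; apply/csimplexT => b bT; rewrite lam_vert //. Qed.

Lemma segment_osimplex x y t : csimplex T x -> osimplex T y -> 0 < t -> t <= 1 ->
  osimplex T (x + t *: (y - x)).
Proof.
move=> /csimplexT hx /osimplexT hy t0 t1; apply/osimplexT => a aT.
rewrite peval_conv; have := hx a aT; have := hy a aT; nra.
Qed.

Lemma osimplex_bounded : has_ubound [set d | exists x y,
  [/\ osimplex T x, osimplex T y & d = enorm (x - y)]].
Proof.
pose B := \sum_(v in T) enorm (pt m v).
have h x : csimplex T x -> enorm x <= B.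
  move=> hx; rewrite -{1}(lam_comb x).
  apply: (@le_trans _ _ (\sum_(v in T) enorm (L v x *: pt m v))).
    elim/big_rec2: _ => [|v y z _ IH]; first by rewrite enorm0.
    by apply: le_trans (enormD _ _) _; rewrite lerD2l.
  apply: ler_sum => v vT; have /andP[h0 h1] := lam_bounds hx vT.
  by rewrite enormZ ger0_norm // ler_piMl ?enorm_ge0.
exists (B + B) => _ [x [y [/osimplex_csimplex/h hx /osimplex_csimplex/h hy ->]]].
by apply: le_trans (enormB _ _) _; rewrite lerD.
Qed.

Lemma hT_osimplex x y : osimplex T x -> osimplex T y -> enorm (x - y) <= Defs.hT T.
Proof.
by move=> hx hy; apply: ub_le_sup; [exact: osimplex_bounded|exists x, y].
Qed.

(** The diameter is a supremum over the open simplex. Two points of the closed simplex are pulled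
    toward the barycenter by the factor 1 - e, and e tends to 0. *)
Lemma hT_csimplex x y : csimplex T x -> csimplex T y -> enorm (x - y) <= Defs.hT T.
Proof.
move=> hx hy; set g := bary T.
have hg : osimplex T g by apply: osimplex_bary => //; exact: cell_gt0.
rewrite -subr_le0; apply: (@le0_all_eps _ _ (enorm (x - y))) => e e0.
have [e1|e1] := leP e 1; last first.
  have h1 : 0 <= Defs.hT T by apply: le_trans (hT_osimplex hg hg); apply: enorm_ge0.
  apply: (@le_trans _ _ (enorm (x - y))); first by rewrite lerBlDr lerDl.
  by rewrite ler_peMr ?enorm_ge0 // ltW.
have := hT_osimplex (segment_osimplex hx hg e0 e1) (segment_osimplex hy hg e0 e1).
have -> : x + e *: (g - x) - (y + e *: (g - y)) = (1 - e) *: (x - y).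
  by apply/rowP => j; rewrite !mxE; ring.
rewrite enormZ ger0_norm ?subr_ge0 // => h.
by rewrite lerBlDr; apply: le_trans (lerD (lexx _) h); lra.
Qed.

Lemma hT_ge0 : 0 <= Defs.hT T.
Proof.
have hg : osimplex T (bary T) by apply: osimplex_bary => //; exact: cell_gt0.
by apply: le_trans (hT_osimplex hg hg); apply: enorm_ge0.
Qed.

Lemma hT_gt0 : (0 < N)%N -> 0 < Defs.hT T.
Proof.
move=> N0; have : (1 < #|T|)%N by rewrite hT.1.
move=> /card_gt1P[a [b [aT bT ab]]].
apply: lt_le_trans (hT_csimplex (vert_csimplex aT) (vert_csimplex bT)).
rewrite lt_neqAle enorm_ge0 andbT eq_sym enorm_eq0 subr_eq0.
apply/negP => /eqP e; have := lam_vert aT bT; rewrite -e lam_vert // eqxx.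
by rewrite eq_sym (negPf ab) => /eqP; rewrite oner_eq0.
Qed.

(* Along a diameter of a ball inside T the coordinate stays between 0 and 1. *)
Lemma grad_lam_inball a : a \in T ->
  enorm (lam T a).2 * inball_diam (osimplex T) <= 1.
Proof.
move=> aT; set g := (lam T a).2.
have [g0|g0] := eqVneq (enorm g) 0; first by rewrite g0 mul0r.
have gp : 0 < enorm g by rewrite lt_neqAle eq_sym g0 enorm_ge0.
rewrite -ler_pdivlMl // mulr1; apply: ge_sup.
  exists 0, 0, 0; split=> //; last by rewrite mulr0.
  by move=> x /=; rewrite /oball /= ltNge enorm_ge0.
move=> _ [c [r [r0 hB ->]]].
(* The inscribed ball is open, so its diameter is approached by the radius t r with t < 1. *)
have key t : 0 <= t -> t < 1 -> 2 * (t * r) * enorm g <= 1.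
  move=> t0 t1; have [->|rn0] := eqVneq r 0; first by rewrite !mulr0 mul0r.
  have rp : 0 < r by rewrite lt_neqAle eq_sym rn0.
  set u := (enorm g)^-1 *: g.
  have u1 : enorm u = 1 by rewrite enormZ ger0_norm ?invr_ge0 ?ltW // mulVf.
  have inB s : `|s| = t * r -> osimplex T (c + s *: u).
    move=> hs; apply: hB; rewrite /oball /= addrC addKr enormZ u1 mulr1 hs.
    by rewrite gtr_pMl.
  have trp : 0 <= t * r by rewrite mulr_ge0.
  have h1 := inB (t * r) (ger0_norm trp).
  have h2 : osimplex T (c + (- (t * r)) *: u) by apply: inB; rewrite normrN ger0_norm.
  have /andP[_ a1] := lam_bounds (osimplex_csimplex h1) aT.
  have /andP[a2 _] := lam_bounds (osimplex_csimplex h2) aT.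
  have : L a (c + (t * r) *: u) - L a (c + (- (t * r)) *: u) <= 1 by lra.
  rewrite pevalB opprD addrACA subrr add0r scaleNr opprK -scalerDl dotZr.
  rewrite /u dotZr -enorm_sq expr2 mulKf //; apply: le_trans.
  by rewrite le_eqVlt; apply/orP; left; apply/eqP; ring.
suff h : 2 * r * enorm g <= 1 by rewrite -(ler_pM2r gp) mulVf.
rewrite -subr_le0; apply: (@le0_all_eps _ _ (2 * r * enorm g)) => e e0.
have K0 : 0 <= 2 * r * enorm g by rewrite !mulr_ge0 // ltW.
have [e1|e1] := ltP 1 e; first by nra.
have := key (1 - e); rewrite subr_ge0 => /(_ e1); rewrite ltrBlDr ltrDl => /(_ e0).
by rewrite lerBlDr => h; lra.
Qed.

End Fixed.

Lemma det_le_fact n (A : 'M[R]_n) K : 0 <= K -> (forall i j, `|A i j| <= K) ->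
  `|\det A| <= n`!%:R * K ^+ n.
Proof.
move=> K0 hA; rewrite /determinant; apply: le_trans (ler_norm_sum _ _ _) _.
rewrite -card_Sn mulr_natl -sumr_const; apply: ler_sum => s _.
rewrite normrM normrX normrN1 expr1n mul1r normr_prod.
apply: (@le_trans _ _ (\prod_(i < n) K)); last by rewrite prodr_const card_ord.
by apply: ler_prod => i _; rewrite normr_ge0 hA.
Qed.

(** The entries of the Gram matrix are at most h^2, so its determinant is at most k! h^(2k) <= (k!
    h^k)^2. *)
Lemma jac_le S h : (0 < #|S|)%N -> 0 <= h ->
  (forall a b, a \in S -> b \in S -> enorm (pt m a - pt m b) <= h) ->
  jac S <= (#|S|.-1)`!%:R * h ^+ #|S|.-1.
Proof.
move=> S0 h0 hS; set k := #|S|.-1.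
have p0 : 0 <= k`!%:R * h ^+ k by rewrite mulr_ge0 // exprn_ge0.
rewrite /jac -[leRHS]ger0_norm // -sqrtr_sqr ler_wsqrtr //.
apply: le_trans (ler_norm _) _; apply: (@le_trans _ _ (k`!%:R * (h ^+ 2) ^+ k)).
  apply: det_le_fact => [|i j]; first by rewrite exprn_ge0.
  have -> : (sedge S *m (sedge S)^T) i j = dot (row i (sedge S)) (row j (sedge S)).
    by rewrite dotE mxE; apply: eq_bigr => l _; rewrite !mxE.
  have hr (i' : 'I_#|S|.-1) : enorm (row i' (sedge S)) <= h.
    have si : (i'.+1 < #|S|)%N by have := ltn_ord i'; rewrite -ltnS (prednK S0).
    have [v vS [e1 _]] := @svert_nth R N m S i'.+1 si.
    have [w wS [e2 _]] := svert_nth S0.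
    rewrite (_ : row i' _ = pt m v - pt m w) ?hS //.
    by apply/rowP => l; rewrite !mxE e1 e2.
  apply: le_trans (dot_cs _ _) _; rewrite expr2.
  by apply: ler_pM; rewrite ?enorm_ge0.
have -> : (h ^+ 2) ^+ k = (h ^+ k) ^+ 2 by rewrite -!exprM mulnC.
rewrite [leRHS]exprMn; apply: ler_wpM2r; first by rewrite sqr_ge0.
by rewrite -natrX ler_nat -{1}[k`!]expn1 leq_pexp2l // fact_gt0.
Qed.

Lemma det_inv_bound k (E : 'M[R]_(k, N)) (G : 'M[R]_(N, k)) K : k = N -> 0 <= K ->
  E *m G = 1%:M -> (forall i j, `|G i j| <= K) ->
  1 <= N`!%:R * K ^+ N * Num.sqrt (\det (E *m E^T)).
Proof.
move=> kN; subst k => K0 EG hG.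
rewrite det_mulmx det_tr -expr2 sqrtr_sqr.
have : \det E * \det G = 1 by rewrite -det_mulmx EG det1.
move=> /(congr1 Num.norm); rewrite normr1 normrM => h.
by rewrite -[leLHS]h mulrC; apply: ler_wpM2r => //; apply: det_le_fact.
Qed.

Lemma enorm_coord x i : `|x 0 i| <= enorm x.
Proof.
rewrite -(@ler_pXn2r _ 2) ?nnegrE ?enorm_ge0 // enorm_sq dotE (bigD1 i) //=.
rewrite real_normK ?num_real // expr2 lerDl sumr_ge0 // => j _.
by rewrite -expr2 sqr_ge0.
Qed.

(** The gradients of the barycentric coordinates form a right inverse of the edge matrix. A bound on
    them bounds the determinant of that inverse and keeps the volume away from 0. *)
Lemma jac_ge T K : nondeg T -> 0 <= K ->
  (forall a, a \in T -> enorm (lam T a).2 <= K) -> 1 <= N`!%:R * K ^+ N * jac T.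
Proof.
move=> hT K0 hK; have T0 : (0 < #|T|)%N by rewrite hT.1.
have [v0 v0T [e0 i0]] := svert_nth T0.
pose b (i : 'I_#|T|.-1) : V := nth v0 (enum T) i.+1.
have si (i : 'I_#|T|.-1) : (i.+1 < size (enum T))%N.
  by rewrite -cardE; have := ltn_ord i; rewrite -ltnS (prednK T0).
have bT i : b i \in T by rewrite -mem_enum mem_nth.
have be (i : 'I_#|T|.-1) : (svert T)`_i.+1 = pt m (b i) by rewrite (nth_map v0).
have bi : injective b.
  move=> i j /eqP; rewrite nth_uniq ?enum_uniq // => /eqP[] h; exact: val_inj.
have bv0 i : v0 != b i.
  apply/eqP => h; have := i0; rewrite h index_uniq ?enum_uniq //.
pose G : 'M[R]_(N, #|T|.-1) := \matrix_(j, i) (lam T (b i)).2 0 j.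
apply: (det_inv_bound (G := G)) => //; first by rewrite hT.1.
  apply/matrixP => i j; rewrite !mxE.
  transitivity (peval (lam T (b j)) (pt m (b i)) - peval (lam T (b j)) (pt m v0)).
    rewrite pevalB dotE; by apply: eq_bigr => l _; rewrite !mxE be e0 mulrC.
  by rewrite !lam_vert // (negPf (bv0 j)) subr0 (inj_eq bi).
by move=> i j; rewrite mxE; apply: le_trans (enorm_coord _ _) (hK _ _).
Qed.

End SimplexGeometry.

(** * Volumes as determinants in homogeneous coordinates *)

Section Volumes.
Variables (R : realType) (N : nat) (m : mesh R N).
Local Notation V := 'I_(nvert m).
Implicit Types (S T F : {set V}) (q : P1 R N) (x y : 'rV[R]_N).

Lemma det_edges k (E : 'M[R]_(k, N)) (p : nat -> 'rV[R]_N) : k = N ->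
  (forall i j, E i j = (p i.+1 - p 0%N) 0 j) ->
  Num.sqrt (\det (E *m E^T)) =
  `|\det (\matrix_(i < 1 + N, j < 1 + N) (row_mx (1%:M : 'rV[R]_1) (p i) : 'rV[R]_(1 + N)) 0 j)|.
Proof.
move=> kN; subst k => hE; rewrite det_mulmx det_tr -expr2 sqrtr_sqr.
set A := \matrix_(i, j) _.
pose U : 'M[R]_(1 + N) := block_mx 1%:M 0 (const_mx (-1)) 1%:M.
have dU : \det U = 1 by rewrite det_lblock !det1 mulr1.
have eA : A = block_mx 1%:M (p 0%N) (const_mx 1) (\matrix_(i, j) p i.+1 0 j).
  apply/matrixP => i j; rewrite [LHS]mxE -(splitK i) -(splitK j).
  case: (fintype.split i) => i'; case: (fintype.split j) => j' /=.
  - by rewrite row_mxEl block_mxEul !ord1.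
  - by rewrite row_mxEr block_mxEur !ord1.
  - by rewrite row_mxEl block_mxEdl !mxE !ord1 eqxx.
  - by rewrite row_mxEr block_mxEdr mxE.
have eUA : U *m A = block_mx 1%:M (p 0%N) 0 E.
  rewrite eA /U mulmx_block !mul1mx !mul0mx !addr0; congr block_mx.
    by apply/matrixP => i j; rewrite !mxE big_ord1 !mxE !ord1 /= mulN1r addNr.
  by apply/matrixP => i j; rewrite !mxE big_ord1 !mxE mulN1r hE !mxE addrC.
have : \det (U *m A) = \det E by rewrite eUA det_ublock det1 mul1r.
by rewrite det_mulmx dU mul1r => ->.
Qed.

Lemma vmx_perm e e' T : enumerates e T -> enumerates e' T ->
  `|\det (vmx (m := m) e)| = `|\det (vmx e')|.
Proof.
move=> [ie eT] [ie' eT'].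
have ex i : exists j, e j == e' i.
  by apply/existsP; rewrite -eT eT'; apply/existsP; exists i.
pose s i := xchoose (ex i).
have sE i : e (s i) = e' i by apply/eqP; apply: (xchooseP (ex i)).
have injs : injective s by move=> i j h; apply: ie'; rewrite -!sE h.
have -> : vmx e' = row_perm (perm injs) (vmx e).
  by apply/matrixP => i j; rewrite !mxE permE sE.
by rewrite row_permE det_mulmx det_perm normrM normrX normrN1 expr1n mul1r.
Qed.

Lemma jac_vmx T e : #|T| = N.+1 -> enumerates e T -> jac T = `|\det (vmx (m := m) e)|.
Proof.
move=> cT eT; have T0 : (0 < #|T|)%N by rewrite cT.
have [v0 v0T _] := svert_nth T0.
pose e0 (i : 'I_(1 + N)) : V := nth v0 (enum T) i.
have sz : size (enum T) = (1 + N)%N by rewrite -cardE cT.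
have eT0 : enumerates e0 T.
  split=> [i j /eqP|v].
    by rewrite nth_uniq ?enum_uniq ?sz //; move/eqP/val_inj.
  apply/idP/existsP => [vT|[i /eqP <-]]; last by rewrite -mem_enum mem_nth // sz.
  have hi : (index v (enum T) < 1 + N)%N by rewrite -sz index_mem mem_enum.
  by exists (Ordinal hi); rewrite /e0 /= nth_index ?mem_enum.
rewrite (vmx_perm eT eT0) /jac (@det_edges _ _ (fun i => (svert T)`_i)); last first.
- by move=> i j; rewrite mxE.
- by rewrite cT.
congr (`|\det _|); apply/matrixP => i j; rewrite !mxE.
by rewrite (nth_map v0) // sz.
Qed.

Lemma vmx_change T e e' : nondeg (m := m) T -> enumerates e T ->
  vmx e' = (\matrix_(i, k) peval (lam T (e k)) (pt m (e' i))) *m vmx e.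
Proof.
have vl f i k : vmx (m := m) f i (lshift N k) = 1 by rewrite mxE row_mxEl mxE !ord1 eqxx.
have vr f i k : vmx (m := m) f i (rshift 1 k) = pt m (f i) 0 k by rewrite mxE row_mxEr.
move=> nT eT; apply/matrixP => i j; rewrite [RHS]mxE.
under eq_bigr do rewrite mxE.
rewrite -(splitK j); case: (fintype.split j) => j' /=.
  rewrite vl -(lam_sum1 nT (pt m (e' i))) (enumeratesP eT).
  by apply: eq_bigr => k _; rewrite vl mulr1.
rewrite vr -[in LHS](lam_comb nT (pt m (e' i))) (enumeratesP eT) summxE.
by apply: eq_bigr => k _; rewrite vr mxE.
Qed.

(** Cramer's rule: in barycentric coordinates of the first simplex the vertices of the second form a
    block triangular matrix whose only nontrivial diagonal entry is the coordinate of a2. *)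
Lemma jac_replace F a1 a2 : nondeg (m := m) (a1 |: F) -> #|F| = N -> a1 \notin F -> a2 \notin F ->
  jac (a2 |: F) = `|peval (lam (a1 |: F) a1) (pt m a2)| * jac (a1 |: F).
Proof.
move=> nT cF a1F a2F; set T1 := (a1 |: F)%SET; set T2 := (a2 |: F)%SET.
pose f (i : 'I_N) : V := enum_val (cast_ord (esym cF) i).
have fF i : f i \in F by apply: enum_valP.
have fi : injective f by move=> i j /enum_val_inj /cast_ord_inj.
have fex v : v \in F -> exists i, f i = v.
  by move=> vF; exists (cast_ord cF (enum_rank_in vF v)); rewrite /f cast_ordK enum_rankK_in.
pose e (a : V) (i : 'I_(1 + N)) : V := if fintype.split i is inr j then f j else a.
have el a i : e a (lshift N i) = a by rewrite /e (unsplitK (inl i)).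
have er a i : e a (rshift 1 i) = f i by rewrite /e (unsplitK (inr i)).
have eE a : a \notin F -> enumerates (e a) (a |: F).
  move=> aF; split=> [i j|v].
    rewrite -(splitK i) -(splitK j); case: (fintype.split i) => i'; case: (fintype.split j) => j' /=;
      rewrite ?el ?er.
    - by rewrite !ord1.
    - by move=> h; move: aF; rewrite h fF.
    - by move=> h; move: aF; rewrite -h fF.
    - by move=> /fi ->.
  rewrite !inE; apply/idP/existsP => [/orP[/eqP ->|/fex[i <-]]|[i]].
  - by exists (lshift N ord0); rewrite el.
  - by exists (rshift 1 i); rewrite er.
  - rewrite -(splitK i); case: (fintype.split i) => i' /=; rewrite ?el ?er => /eqP <-.
      by rewrite eqxx.
    by rewrite fF orbT.
have cT a : a \notin F -> #|a |: F| = N.+1 by move=> aF; rewrite cardsU1 aF cF.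
rewrite (jac_vmx (cT _ a2F) (eE _ a2F)) (jac_vmx (cT _ a1F) (eE _ a1F)).
rewrite (vmx_change (e a2) nT (eE _ a1F)) det_mulmx normrM; congr (`|_| * _).
set W := \matrix_(i, k) _.
have -> : W = block_mx (peval (lam T1 a1) (pt m a2))%:M
   (\row_j peval (lam T1 (f j)) (pt m a2)) 0 1%:M.
  have fT i : f i \in T1 by rewrite !inE fF orbT.
  have aT : a1 \in T1 by rewrite !inE eqxx.
  apply/matrixP => i j; rewrite mxE -(splitK i) -(splitK j).
  case: (fintype.split i) => i'; case: (fintype.split j) => j' /=.
  - by rewrite !el block_mxEul mxE !ord1 eqxx mulr1n.
  - by rewrite el er block_mxEur mxE.
  - rewrite el er block_mxEdl mxE lam_vert //.
    by case: eqP => // h; move: a1F; rewrite -h fF.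
  - by rewrite !er block_mxEdr mxE lam_vert // (inj_eq fi).
by rewrite det_ublock det1 mulr1 det_mx11 mxE eqxx mulr1n.
Qed.

End Volumes.

(** * Triangulations *)

Section MeshTopology.
Variables (R : realType) (N : nat) (m : mesh R N) (A : set 'rV[R]_N).
Hypothesis N0 : (0 < N)%N.
Hypothesis hA : polyhedral_domain A.
Hypothesis hm : triangulation m A.
Local Notation V := 'I_(nvert m).
Implicit Types (S T F : {set V}) (q : P1 R N) (x y : 'rV[R]_N).

(** Finitely many strict inequalities survive one common small step. This finds points just beyond a
    face or just outside a cell. *)
Lemma small_step (I : finType) (u w : I -> R) : (forall i, 0 < u i) ->
  exists2 e, 0 < e & forall i, 0 < u i + e * w i.
Proof.
move=> u0; suff [e [e0 he]] : exists e, 0 < e /\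
    forall e', 0 <= e' -> e' <= e -> forall i, i \in enum I -> 0 < u i + e' * w i.
  by exists e => // i; apply: he; rewrite ?mem_enum // ltW.
elim: (enum I) => [|i s [e [e0 he]]]; first by exists 1.
have d0 : 0 < `|w i| + 1 by rewrite ltr_wpDl.
exists (Num.min e (u i / (2 * (`|w i| + 1)))); split.
  by rewrite lt_min e0 divr_gt0 // mulr_gt0.
move=> e' e'0; rewrite le_min => /andP[h1 h2] j; rewrite inE => /orP[/eqP ->|js]; last exact: he.
move: h2; rewrite ler_pdivlMr ?mulr_gt0 // => h2.
have : - (e' * `|w i|) <= e' * w i.
  by rewrite -mulrN ler_wpM2l // lerNl -normrN ler_norm.
have := u0 i; have : 0 <= e' * `|w i| by rewrite mulr_ge0.
nra.
Qed.

Lemma cell_nondeg T : T \in cells m -> nondeg T.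
Proof. by case: hm => h _ _; apply: h. Qed.

Lemma face_opp T F : T \in cells m -> F \in faces_of T ->
  exists a, [/\ a \in T, a \notin F & T = a |: F]%SET.
Proof.
move=> /cell_nondeg[cT _]; rewrite inE => /andP[FT /eqP cF].
have : #|T :\: F| = 1%N by rewrite cardsD (finset.setIidPr FT) cT cF subSnn.
move=> /eqP/cards1P[a ha]; have : a \in T :\: F by rewrite ha set11.
rewrite inE => /andP[aF aT]; exists a; split=> //.
apply/setP => v; move/setP: ha => /(_ v); rewrite !inE.
by have [vF|vF] := boolP (v \in F); [rewrite orbT (fintype.subsetP FT)|rewrite orbF /=].
Qed.

Lemma face_sub T F : F \in faces_of T -> F \subset T /\ #|F| = N.
Proof. by rewrite inE => /andP[FT /eqP]. Qed.

Lemma smeasE T : #|T| = N.+1 -> smeas (m := m) T = jac T * rint (fun _ : 'rV[R]_N => 1).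
Proof. by move=> cT; rewrite /smeas sintE cT. Qed.

Lemma jac_cell_gt0 T : T \in cells m -> 0 < jac T.
Proof.
move=> hT; have nT := cell_nondeg hT.
pose K := \sum_(a in T) enorm (lam T a).2.
have K0 : 0 <= K by apply: sumr_ge0 => a _; apply: enorm_ge0.
have := @jac_ge R N m T K nT K0; rewrite lt_neqAle jac_ge0 andbT eq_sym => h.
apply/eqP => j0; rewrite j0 mulr0 in h; move: h; rewrite ler10 => /(_ _)/negP; apply=> //.
move=> a aT; rewrite /K (bigD1 a) //= lerDl; apply: sumr_ge0 => b _; exact: enorm_ge0.
Qed.

Lemma smeas_cell_gt0 T : T \in cells m -> 0 < smeas (m := m) T.
Proof.
move=> hT; rewrite smeasE ?(cell_nondeg hT).1 // mulr_gt0 ?rint1_gt0 //.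
exact: jac_cell_gt0.
Qed.

Lemma csimplex_convex S x y t : csimplex (m := m) S x -> csimplex S y -> 0 <= t -> t <= 1 ->
  csimplex S (x + t *: (y - x)).
Proof.
move=> [l [l0 l1 ->]] [l' [l0' l1' ->]] t0 t1.
exists (fun v => l v + t * (l' v - l v)); split=> [v vS||].
- by have := l0 v vS; have := l0' v vS; nra.
- by rewrite big_split /= -mulr_sumr sumrB l1 l1' subrr mulr0 addr0.
- rewrite -sumrB scaler_sumr -big_split /=; apply: eq_bigr => v _.
  by rewrite scalerDl -scalerA scalerBl.
Qed.

Section TwoCells.
Variables (F : {set V}) (a1 a2 : V).
Let T1 := (a1 |: F)%SET.
Let T2 := (a2 |: F)%SET.
Hypotheses (h1 : T1 \in cells m) (h2 : T2 \in cells m).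
Hypotheses (cF : #|F| = N) (a1F : a1 \notin F) (a2F : a2 \notin F) (a12 : a1 != a2).
Let n1 := cell_nondeg h1.
Let n2 := cell_nondeg h2.

(** If the coordinate were 0, the second cell would have no volume. If it were positive, a point
    slightly off the barycenter of F toward a2 would lie in both cells but not in F, against
    conformity. *)
Lemma opposite_sides : peval (lam T1 a1) (pt m a2) < 0.
Proof.
set k := peval _ _; rewrite ltNge; apply/negP; rewrite le_eqVlt => /orP[/eqP k0|k0].
  have := jac_replace n1 cF a1F a2F; rewrite -/T1 -/k -k0 normr0 mul0r => j0.
  by have := jac_cell_gt0 h2; rewrite j0 ltxx.
have F0 : (0 < #|F|)%N by rewrite cF.
have FT1 : F \subset T1 by rewrite subsetU1.
have FT2 : F \subset T2 by rewrite subsetU1.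
have F1v v : v \in F -> v \in T1 by apply: fintype.subsetP.
(* The indices [Some v] keep the coordinates on F positive; [None] keeps the step below 1. *)
pose u (s : option V) : R := if s is Some v then #|F|%:R^-1 else 1.
pose w (s : option V) : R := if s is Some v then peval (lam T1 v) (pt m a2) - #|F|%:R^-1 else -1.
have u0 s : 0 < u s by case: s => [v|] //=; rewrite invr_gt0 ltr0n.
have [e e0 he] := @small_step _ u w u0.
have e1 : e <= 1 by have := he None; rewrite /u /w; lra.
set x := bary (m := m) F + e *: (pt m a2 - bary F).
have a1T : a1 \in T1 by rewrite !inE eqxx.
have a2T : a2 \in T2 by rewrite !inE eqxx.
have Lx v : v \in T1 -> peval (lam T1 v) x =
    (if v \in F then #|F|%:R^-1 else 0) + e * (peval (lam T1 v) (pt m a2) - (if v \in F then #|F|%:R^-1 else 0)).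
  by move=> vT; rewrite peval_conv !(lam_baryc n1 FT1 F0 vT).
have x1 : csimplex T1 x.
  apply/(csimplexT n1) => v vT; rewrite Lx //; case: ifPn => vF.
    by have := he (Some v); rewrite /u /w => /ltW.
  move: vT; rewrite !inE (negPf vF) orbF => /eqP ->.
  by rewrite add0r subr0 mulr_ge0 // ltW.
have x2 : csimplex T2 x.
  apply: csimplex_convex => //; [|exact: (vert_csimplex n2)|exact: ltW].
  by apply: (csimplex_sub n2 FT2); apply: osimplex_csimplex; apply: (osimplex_bary n2 FT2).
have T12 : (T1 :&: T2 = F)%SET.
  apply/setP => v; rewrite !inE; have [//|vF] := boolP (v \in F); rewrite ?orbT //.
  by rewrite !orbF; apply/negP => /andP[/eqP -> /eqP h]; move: a12; rewrite h eqxx.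
have [_ _ /(_ _ _ h1 h2)] := hm; rewrite T12 => eF.
have : csimplex (m := m) F x by rewrite -eF; split.
move=> /(csimplexP n1 _ FT1)[_ /(_ a1 a1T a1F)]; rewrite Lx // (negPf a1F) add0r subr0.
by move=> /eqP; rewrite mulf_eq0 !gt_eqF.
Qed.

Lemma lam_proportional x :
  peval (lam T1 a1) x = peval (lam T1 a1) (pt m a2) * peval (lam T2 a2) x.
Proof.
rewrite (peval_lam n2) (bigD1 a2) /=; last by rewrite !inE eqxx.
rewrite big1 ?addr0 1?mulrC // => v /andP[]; rewrite !inE => /orP[->//|vF] _.
by rewrite lam_vert // ?inE ?eqxx ?vF ?orbT //; case: eqP => [h|]; rewrite ?mulr0 //; move: a1F; rewrite -h vF.
Qed.

(* Up to sign each term is the volume of the simplex spanned by x and the common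
   face, on which the two cells lie on opposite sides. *)
Lemma signed_volume_cancel x :
  smeas T1 * peval (lam T1 a1) x + smeas T2 * peval (lam T2 a2) x = 0.
Proof.
rewrite !smeasE ?n1.1 ?n2.1 // (jac_replace n1 cF a1F a2F).
rewrite ltr0_norm; last exact: opposite_sides.
rewrite lam_proportional; ring.
Qed.

End TwoCells.

Lemma star_face T F : T \in cells m -> F \in faces_of T -> T \in star F.
Proof. by move=> hT /face_sub[FT _]; rewrite inE hT FT. Qed.

Lemma facesP F : F \in faces m <-> exists2 T, T \in cells m & F \in faces_of T.
Proof. by split=> [/bigcupP[T]|[T h1 h2]]; [exists T|apply/bigcupP; exists T]. Qed.

Lemma starP T F : F \in faces m -> T \in star F ->
  [/\ T \in cells m, F \in faces_of T & exists a, [/\ a \in T, a \notin F & T = a |: F]%SET].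
Proof.
move=> /facesP[T' _ /face_sub[_ cF]]; rewrite inE => /andP[hT FT].
have hF : F \in faces_of T by rewrite inE FT cF eqxx.
by split=> //; apply: face_opp.
Qed.

(** With three cells, the coordinate of a1 at a3 would be the product of two negative coordinates,
    so a1 and a3 would lie on the same side of F. *)
Lemma star_le2 F : F \in faces m -> F \in int_faces m \/ F \in bnd_faces m.
Proof.
move=> hF; have [T hT FT] := (facesP F).1 hF.
have TF := star_face hT FT; have [_ cF] := face_sub FT.
have c0 : (0 < #|star F|)%N by apply/card_gt0P; exists T.
suff c2 : (#|star F| <= 2)%N.
  by move: c0 c2; rewrite !inE hF /=; case: #|star F| => [|[|[|]]] //=; auto.
rewrite leqNgt; apply/negP => /card_gt2P[T1 [T2 [T3 [[h1 h2 h3] [n12 n23 n31]]]]].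
have [c1 _ [a1 [_ a1F e1]]] := starP hF h1.
have [c2 _ [a2 [_ a2F e2]]] := starP hF h2.
have [c3 _ [a3 [_ a3F e3]]] := starP hF h3.
have d12 : a1 != a2 by apply: contraNneq n12 => h; rewrite e1 e2 h.
have d23 : a2 != a3 by apply: contraNneq n23 => h; rewrite e2 e3 h.
have d13 : a1 != a3 by apply: contraNneq n31 => h; rewrite e1 e3 h.
rewrite e1 in c1; rewrite e2 in c2; rewrite e3 in c3.
have o12 := opposite_sides c1 c2 cF a1F a2F d12.
have o13 := opposite_sides c1 c3 cF a1F a3F d13.
have o23 := opposite_sides c2 c3 cF a2F a3F d23.
have : peval (lam (a1 |: F) a1) (pt m a3) =
    peval (lam (a1 |: F) a1) (pt m a2) * peval (lam (a2 |: F) a2) (pt m a3).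
  by apply: lam_proportional.
by move=> h; move: o13; rewrite h ltNge ltW // nmulr_rgt0.
Qed.

Lemma cell_closure T x : T \in cells m -> csimplex T x -> closure A x.
Proof. by move=> hT hx; case: hm => _ -> _; exists T. Qed.

Lemma dot_continuous (u : 'rV[R]_N) : continuous (dot u).
Proof.
have -> : dot u = fun x => \sum_i u 0 i * x 0 i by apply/funext => x; rewrite dotE.
elim: (index_enum _) => [|i r ih] x.
  have -> : (fun y : 'rV[R]_N => \sum_(i <- [::]) u 0 i * y 0 i) = fun=> 0.
    by apply/funext => y; rewrite big_nil.
  exact: cst_continuous.
have -> : (fun y : 'rV[R]_N => \sum_(j <- i :: r) u 0 j * y 0 j) =
  fun y => u 0 i * y 0 i + \sum_(j <- r) u 0 j * y 0 j.
  by apply/funext => y; rewrite big_cons.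
have c1 : continuous (fun y : 'rV[R]_N => u 0 i * y 0 i).
  move=> y; have cc : continuous (fun y : 'rV[R]_N => (y 0 i : R)) by exact: coord_continuous.
  have cu : continuous (fun _ : 'rV[R]_N => u 0 i) by apply: cst_continuous.
  exact: (cvgM (cu y) (cc y)).
exact: (cvgD (c1 x) (ih x)).
Qed.

Lemma peval_continuous q : continuous (peval q).
Proof. have -> : peval q = fun x => q.1 + dot q.2 x by [].
move=> x; have c1 : continuous (fun _ : 'rV[R]_N => q.1) by apply: cst_continuous.
exact: (cvgD (c1 x) (@dot_continuous q.2 x)). Qed.

Lemma closure_le (f : 'rV[R]_N -> R) (B : set 'rV[R]_N) b x : continuous f ->
  (forall y, B y -> f y <= b) -> closure B x -> f x <= b.
Proof.
move=> cf hB Bx; rewrite leNgt; apply/negP => h.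
have [y [By]] := Bx _ (cf x _ (open_nbhs_nbhs (conj (@open_gt R b) h))).
by rewrite /= => hy; have := hB y By; rewrite leNgt hy.
Qed.

(** The triangulation only covers the closure of A. If a defining inequality of A were an equality
    at x, a small step away from a point of A would stay in the open simplex but leave that
    closure. *)
Lemma osimplex_dom T : T \in cells m -> osimplex T `<=` A.
Proof.
move=> hT x hx; have nT := cell_nondeg hT.
have [[z Az] _ [k [a [b eA]]]] := hA; rewrite eA /= => i.
have cl y : closure A y -> dot (a i) y <= b i.
  apply: closure_le; first exact: dot_continuous.
  by move=> z'; rewrite eA => /(_ i) /ltW.
rewrite ltNge; apply/negP => h.
have Azi : dot (a i) z < b i by move: Az; rewrite eA; apply.
pose u (v : V) : R := if v \in T then peval (lam T v) x else 1.
have u0 v : 0 < u v by rewrite /u; case: ifP => // vT; apply: ((osimplexT nT x).1 hx).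
have [e e0 he] := small_step (fun v => peval (lam T v) x - peval (lam T v) z) u0.
have hy : osimplex T (x + e *: (x - z)).
  have -> : x + e *: (x - z) = x + (- e) *: (z - x) by rewrite scaleNr -scalerN opprB.
  apply/(osimplexT nT) => v vT; have := he v; rewrite /u vT peval_conv.
  by rewrite mulNr -mulrN opprB.
have := cl _ (cell_closure hT (osimplex_csimplex hy)); rewrite dotDr dotZr dotBr.
have : 0 < e * (dot (a i) x - dot (a i) z) by rewrite mulr_gt0 // subr_gt0 (lt_le_trans Azi).
lra.
Qed.

Lemma face_in_closure F x : F \in faces m -> osimplex (m := m) F x -> closure A x.
Proof.
move=> /facesP[T hT /face_sub[FT _]] hx; apply: (cell_closure hT).
by apply: (csimplex_sub (cell_nondeg hT) FT); apply: osimplex_csimplex.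
Qed.

(* A point of the open set A on F could be pushed across F inside A, but beyond a
   face that belongs to one cell only there are no cells. *)
Lemma bnd_face_not_dom F x : F \in bnd_faces m -> osimplex (m := m) F x -> ~ A x.
Proof.
rewrite inE => /andP[hF /cards1P[T sF]] hx Ax.
have TF : T \in star F by rewrite sF set11.
have [hT FT [a [aT aF eT]]] := starP hF TF.
have nT := cell_nondeg hT; have [FsT _] := face_sub FT.
have [_ _ [k [c [b eA]]]] := hA.
have xT : csimplex T x by apply: (csimplex_sub nT FsT); apply: osimplex_csimplex.
have [hx1 hx2] := (osimplexP nT x FsT).1 hx.
(* Each cell missing x has a coordinate negative at x. These strict inequalities and those defining
   A survive a small step beyond F. A cell containing the new point then contains x, hence F by
   conformity, hence is T, whose coordinate at a is negative there. *)
have neg T' : exists v, T' \in cells m -> ~ csimplex T' x ->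
    v \in T' /\ peval (lam T' v) x < 0.
  have [[h1 h2]|h] := pselect (T' \in cells m /\ ~ csimplex T' x); last first.
    by exists a => h1 h2; exfalso; apply: h.
  have [v hv] : exists v, ~ (v \in T' -> 0 <= peval (lam T' v) x).
    by apply/existsNP => h; apply: h2; apply/(csimplexT (cell_nondeg h1)) => v; apply: h.
  by exists v => _ _; move/not_implyP: hv => [-> /negP]; rewrite -ltNge.
pose vv T' := projT1 (cid (neg T')).
have hvv T' : T' \in cells m -> ~ csimplex T' x -> vv T' \in T' /\ peval (lam T' (vv T')) x < 0.
  exact: (projT2 (cid (neg T'))).
pose bad T' := `[< T' \in cells m /\ ~ csimplex T' x >].
pose y e := x + e *: (x - pt m a).
pose u (s : 'I_k + {set V}) : R := match s with
  | inl i => b i - dot (c i) x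
  | inr T' => if bad T' then - peval (lam T' (vv T')) x else 1 end.
pose w (s : 'I_k + {set V}) : R := match s with
  | inl i => dot (c i) (pt m a) - dot (c i) x
  | inr T' => if bad T' then peval (lam T' (vv T')) (pt m a) - peval (lam T' (vv T')) x else 0 end.
have u0 s : 0 < u s.
  case: s => [i|T'] /=; first by move: Ax; rewrite eA subr_gt0; apply.
  case: ifPn => // /asboolP[h1 h2]; rewrite oppr_gt0.
  by have [] := hvv _ h1 h2.
have [e e0 he] := small_step w u0.
have yE q : peval q (y e) = peval q x - e * (peval q (pt m a) - peval q x).
  have -> : y e = x + (- e) *: (pt m a - x) by rewrite scaleNr -scalerN opprB.
  by rewrite peval_conv mulNr.
have Ay : A (y e).
  rewrite eA => i; have := he (inl i); rewrite /u /w.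
  by rewrite /y dotDr dotZr dotBr; lra.
have [_ cA hcap] := hm.
have : closure A (y e) by apply: subset_closure.
rewrite cA => -[T' hT' yT'].
have xT' : csimplex T' x.
  apply: contrapT => nx; have hb : bad T' by apply/asboolP.
  have [vT' _] := hvv _ hT' nx.
  have := he (inr T'); rewrite /u /w hb.
  have := (csimplexT (cell_nondeg hT') _).1 yT' _ vT'; rewrite yE; lra.
have : csimplex (m := m) (T :&: T')%SET x by rewrite -hcap //; split.
move=> /(csimplexP nT _ (subsetIl _ _))[_ h0].
have FT' : F \subset T'.
  apply/fintype.subsetP => v vF; apply/negPn/negP => vT'.
  have vT : v \in T by rewrite (fintype.subsetP FsT).
  have := hx1 v vF; rewrite h0 ?ltxx // inE vT; exact: vT'.
have : T' \in star F by rewrite inE hT' FT'.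
rewrite sF inE => /eqP eTT; rewrite eTT in yT'.
have := (csimplexT nT _).1 yT' a aT; rewrite yE hx2 // lam_vert // eqxx /=; lra.
Qed.

End MeshTopology.

(** * The coefficient *)

Section Coefficient.
Variables (R : realType) (N : nat) (P : interface_problem R N).
Hypothesis hP : valid_problem P.
Implicit Types (x y u v : 'rV[R]_N).

Lemma within_closure_le (U : set 'rV[R]_N) (f : 'rV[R]_N -> R) b x :
  {within closure U, continuous f} -> (forall y, U y -> f y <= b) ->
  closure U x -> f x <= b.
Proof.
move=> cf hU Kx; rewrite leNgt; apply/negP => h.
have oI : open (`]b, +oo[%classic : set R) by apply: interval_open.
have oP : forall A : set R, open A -> open ((f : subspace (closure U) -> R) @^-1` A).
  by apply/continuousP.
have oS := oP `]b, +oo[%classic oI.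
have [V oV eV] := (open_subspaceP _ _).1 oS.
have Vx : V x.
  have : (f @^-1` `]b, +oo[%classic `&` closure U) x by split=> //=; rewrite in_itv /= h.
  by rewrite -eV => -[].
have [y [Uy Vy]] := Kx _ (open_nbhs_nbhs (conj oV Vx)).
have : (V `&` closure U) y by split=> //; apply: subset_closure.
rewrite eV => -[] /=; rewrite in_itv /= andbT => h' _.
by have := hU y Uy; rewrite leNgt h'.
Qed.

Lemma within_sum (K : set 'rV[R]_N) (I : Type) (r : seq I) (f : I -> 'rV[R]_N -> R) :
  (forall i, {within K, continuous (f i)}) ->
  {within K, continuous (fun x => \sum_(i <- r) f i x)}.
Proof.
move=> cf; elim: r => [|i r ih] x.
  have -> : (fun y => \sum_(i <- [::]) f i y) = fun=> 0.
    by apply/funext => y; rewrite big_nil.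
  exact: cst_continuous.
have -> : (fun y => \sum_(j <- i :: r) f j y) = fun y => f i y + \sum_(j <- r) f j y.
  by apply/funext => y; rewrite big_cons.
exact: (cvgD (cf i x) (ih x)).
Qed.

Lemma within_mul (K : set 'rV[R]_N) (f g : 'rV[R]_N -> R) :
  {within K, continuous f} -> {within K, continuous g} ->
  {within K, continuous (fun x => f x * g x)}.
Proof. by move=> cf cg x; exact: (cvgM (cf x) (cg x)). Qed.

Lemma within_cst (K : set 'rV[R]_N) (c : R) : {within K, continuous (fun _ : 'rV[R]_N => c)}.
Proof. by move=> x; apply: cst_continuous. Qed.

Lemma coef_within s i j : {within closure (sub P s), continuous (fun x => coef P s x i j)}.
Proof. by have [_ _ _ /(_ s)[_ /(_ i j)[]]] := hP. Qed.

Lemma coef_form_within s u v :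
  {within closure (sub P s), continuous (fun x => dot (mulmv (coef P s x) u) v)}.
Proof.
under eq_fun do rewrite dot_mulmvE.
apply: within_sum => i; apply: within_sum => j.
apply: within_mul; last exact: within_cst.
by apply: within_mul; [exact: within_cst|exact: coef_within].
Qed.

Lemma coef_sym s x : closure (sub P s) x -> (coef P s x)^T = coef P s x.
Proof.
move=> Kx; have [_ _ _ /(_ s)[hs _ _]] := hP.
apply/matrixP => i j; rewrite mxE.
have key k l : coef P s x k l <= coef P s x l k.
  rewrite -subr_le0.
  apply: (@within_closure_le (sub P s) (fun x => coef P s x k l - coef P s x l k)) => //.
    by move=> y; exact: (cvgB (@coef_within s k l y) (@coef_within s l k y)).
  by move=> y /hs h; rewrite -{1}h mxE subrr.
by apply/eqP; rewrite eq_le !key.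
Qed.

(** The hypotheses give ellipticity only inside the parts, whereas the flux conditions use the
    coefficient on the interface; both bounds extend by continuity to the closures. *)
Lemma coef_elliptic : exists bm bM : R, [/\ 0 < bm, 0 < bM &
  forall s x, closure (sub P s) x -> forall u,
    bm * enorm u ^+ 2 <= dot (mulmv (coef P s x) u) u <= bM * enorm u ^+ 2].
Proof.
have [_ _ _ h] := hP.
have [_ _ [m1 [M1 [m10 M10 h1]]]] := h true; have [_ _ [m2 [M2 [m20 M20 h2]]]] := h false.
exists (Num.min m1 m2), (Num.max M1 M2); split.
- by rewrite lt_min m10.
- by rewrite lt_max M10.
move=> s x Kx u; apply/andP; split.
  rewrite -lerN2.
  apply: (@within_closure_le (sub P s) (fun x => - dot (mulmv (coef P s x) u) u)) => //.
    by move=> y; exact: (cvgN (@coef_form_within s u u y)).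
  move=> y Uy; rewrite lerN2 dotC; case: s Uy {Kx} => Uy.
    have /andP[+ _] := h1 y u Uy; apply: le_trans.
    by rewrite ler_wpM2r ?exprn_ge0 ?enorm_ge0 // ge_min lexx.
  have /andP[+ _] := h2 y u Uy; apply: le_trans.
  by rewrite ler_wpM2r ?exprn_ge0 ?enorm_ge0 // ge_min lexx orbT.
apply: (@within_closure_le (sub P s) (fun x => dot (mulmv (coef P s x) u) u)) => //.
  exact: coef_form_within.
move=> y Uy; rewrite dotC; case: s Uy {Kx} => Uy.
  have /andP[_ +] := h1 y u Uy; move/le_trans; apply.
  by rewrite ler_wpM2r ?exprn_ge0 ?enorm_ge0 // le_max lexx.
have /andP[_ +] := h2 y u Uy; move/le_trans; apply.
by rewrite ler_wpM2r ?exprn_ge0 ?enorm_ge0 // le_max lexx orbT.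
Qed.

Lemma closure_sub_false : closure (sub P false) `<=` dom P.
Proof.
have [_ [oU _ UD _] [eG _ GD _] _] := hP.
move=> x Kx; have [Ux|nUx] := pselect (sub P false x); first exact: UD.
apply: GD; rewrite eG; split=> // h; apply: nUx; exact: interior_subset h.
Qed.

Lemma closure_sub_or x : closure (dom P) x ->
  closure (sub P true) x \/ closure (sub P false) x.
Proof.
have [_ [_ _ _ eT] _ _] := hP.
move=> Dx; have [?|nF] := pselect (closure (sub P false) x); [by right|left].
move=> B nB; have oC : open (~` closure (sub P false)).
  by apply: closed_openC; exact: closed_closure.
have nC : nbhs x (~` closure (sub P false)) by apply: open_nbhs_nbhs.
have [y [Dy [By Cy]]] := Dx _ (filterI nB nC).
by exists y; split=> //; rewrite eT; split.
Qed.

Lemma side_closure x : closure (dom P) x -> closure (sub P (side P x)) x.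
Proof.
by rewrite /side => /closure_sub_or; case: asboolP => // h [].
Qed.

(** The closure of the - part stays inside the domain, so a point of its boundary adheres to the +
    part only. *)
Lemma side_outside x : closure (dom P) x -> ~ dom P x -> side P x = true.
Proof.
move=> Dx nD; rewrite /side; apply/asboolP.
by case: (closure_sub_or Dx) => // /closure_sub_false.
Qed.

Lemma itf_dom x : itf P x -> dom P x.
Proof. by have [_ _ [_ _ h _] _] := hP; apply: h. Qed.

Lemma itf_closure_false x : itf P x -> closure (sub P false) x.
Proof. by have [_ _ [-> _ _ _] _] := hP; case. Qed.

(* The gradient of a defining function points into the + part. *)
Lemma itf_closure_true x : itf P x -> closure (sub P true) x.
Proof.
move=> Gx; have [_ _ [_ _ _ hC] _] := hP.
have [U [f [oU Ux [cf _] hf]]] := hC x Gx.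
have [f0 _ _ g0 _] := hf x Ux; have fx := f0.1 Gx.
have [i gi] : exists i, grad f x 0 i != 0 by apply/rV0Pn.
have [df _] := cf i x Ux.
rewrite mxE /partial in gi; set l := 'D_(evec R i) f x in gi.
move=> B nB.
have hl : (fun h : R => h^-1 *: (f (h *: evec R i + x) - f x)) @ 0^' --> l.
  exact: df.
have nBU : nbhs x (B `&` U) by apply: filterI => //; apply: open_nbhs_nbhs.
have c1 : (fun h : R => h *: evec R i + x) @ (0 : R) --> (0 : R) *: evec R i + x.
  by apply: cvgD; [apply: cvgZl; exact: cvg_id|exact: cvg_cst].
have n0 : \forall h \near (0 : R), (B `&` U) (h *: evec R i + x).
  by apply: c1; rewrite scale0r add0r.
have nl : \forall h \near (0 : R)^', `|l - h^-1 *: (f (h *: evec R i + x) - f x)| < `|l|.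
  by move/cvgrPdist_lt : hl; apply; rewrite normr_gt0.
(* The step h has the sign of the nonzero partial derivative l, so f increases from 0 to a positive
   value while the point stays in the given neighborhood. *)
have [h [hh hl' hB]] : exists h : R, [/\ h * l > 0,
   `|l - h^-1 *: (f (h *: evec R i + x) - f x)| < `|l| & (B `&` U) (h *: evec R i + x)].
  move/nbhs_ballP : nl => [e /= e0 he]; move/nbhs_ballP : n0 => [e' /= e'0 he'].
  pose d := Num.min e e' / 2.
  have d0 : 0 < d by rewrite divr_gt0 // lt_min e0.
  have de : d < e by rewrite /d ltr_pdivrMr // (le_lt_trans (_ : _ <= e)) ?ge_min ?lexx // ltr_pMr // ltrDl.
  have de' : d < e' by rewrite /d ltr_pdivrMr // (le_lt_trans (_ : _ <= e')) ?ge_min ?lexx ?orbT // ltr_pMr // ltrDl.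
  have ns : `|Num.sg l * d| = d by rewrite normrM normr_sg gi mul1r gtr0_norm.
  exists (Num.sg l * d); split.
  - by rewrite mulrAC -normrEsg mulr_gt0 // normr_gt0.
  - apply: he; first by rewrite /ball /= sub0r normrN ns.
    by rewrite mulf_neq0 ?sgr_eq0 // gt_eqF.
  - by apply: he'; rewrite /ball /= sub0r normrN ns.
exists (h *: evec R i + x); split; last by case: hB.
have [_ sT _ _ _] := hf _ hB.2; apply/sT.
move: hl'; rewrite fx subr0 /GRing.scale /=; set z := f _ => hz.
have h0 : h != 0 by apply/eqP => h0; rewrite h0 mul0r ltxx in hh.
have : 0 < l * (h^-1 * z).
  have := sqr_ge0 (h^-1 * z); move: hz; rewrite ltr_norml => /andP[a1 a2].
  have [l0|l0|l0] := ltgtP l 0; last by rewrite l0 eqxx in gi.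
    by rewrite ltr0_norm // in a1 a2; nra.
  by rewrite gtr0_norm // in a1 a2; nra.
have -> : l * (h^-1 * z) = (h * l) * z * (h^-1) ^+ 2 by field.
by rewrite pmulr_lgt0 ?exprn_even_gt0 ?invr_eq0 //= pmulr_rgt0.
Qed.

Lemma itf_closure s x : itf P x -> closure (sub P s) x.
Proof. by case: s; [exact: itf_closure_true|exact: itf_closure_false]. Qed.

End Coefficient.

(** * Integrals weighted by the coefficient *)

Section WeightedIntegrals.
Variables (R : realType) (N : nat) (P : interface_problem R N) (m : mesh R N).
Hypothesis hP : valid_problem P.
Variables (bm bM : R).
Hypotheses (bm0 : 0 < bm) (bM0 : 0 < bM).
Hypothesis ell : forall s x, closure (sub P s) x -> forall u,
    bm * enorm u ^+ 2 <= dot (mulmv (coef P s x) u) u <= bM * enorm u ^+ 2.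
Local Notation V := 'I_(nvert m).
Implicit Types (x u v : 'rV[R]_N) (S T F : {set V}) (q r : vfield m).

Lemma coef_psd s x : closure (sub P s) x -> psd_form (coef P s x).
Proof.
move=> Kx; split; first exact: (coef_sym hP).
move=> u; have /andP[h _] := ell Kx u; apply: le_trans h.
by rewrite mulr_ge0 ?(ltW bm0) // exprn_ge0 // enorm_ge0.
Qed.

Lemma coef_bound s x u v : closure (sub P s) x ->
  `|dot (mulmv (coef P s x) u) v| <= bM * enorm u * enorm v.
Proof.
move=> Kx; rewrite -(@ler_pXn2r _ 2) ?nnegrE ?mulr_ge0 ?enorm_ge0 ?(ltW bM0) //.
rewrite real_normK ?num_real //; apply: le_trans (psd_cs u v (coef_psd Kx)) _.
have -> : (bM * enorm u * enorm v) ^+ 2 = (bM * enorm u ^+ 2) * (bM * enorm v ^+ 2) by ring.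
have /andP[_ h1] := ell Kx u; have /andP[_ h2] := ell Kx v.
by apply: ler_pM => //; apply: (coef_psd Kx).2.
Qed.

Lemma rvmeas_spar S i : rvmeas (fun y : 'rV[R]_#|S|.-1 => spar (m := m) S y 0 i).
Proof.
have -> : (fun y : 'rV[R]_#|S|.-1 => spar (m := m) S y 0 i) =
  (fun y => (svert (m := m) S)`_0 0 i + \sum_j y 0 j * sedge S j i).
  by apply/funext => y; rewrite /spar !mxE.
apply: rvmeasD; first exact: rvmeas_cst.
apply: (@rvmeas_sum _ _ _ _ (fun j y => y 0 j * sedge S j i)) => j.
exact: (rvmeasM (rvmeas_coord j) (@rvmeas_cst R _ (sedge S j i))).
Qed.

Lemma snice_side S (z : bool -> 'rV[R]_N -> R) :
  (forall s, snice (m := m) S (z s)) -> snice (m := m) S (fun x => z (side P x) x).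
Proof.
move=> hz; have [mt [Kt ht]] := hz true; have [mf [Kf hf]] := hz false.
split; last first.
  exists (`|Kt| + `|Kf|) => y hy; case: (side P _).
    by apply: le_trans (ht y hy) _; apply: le_trans (ler_norm _) _; rewrite lerDl.
  by apply: le_trans (hf y hy) _; apply: le_trans (ler_norm _) _; rewrite lerDr.
have mK : rvmset ((spar (m := m) S) @^-1` closure (sub P true)).
  apply: (rvmset_comp (rvmset_closed (@closed_closure _ (sub P true)))) => i.
  exact: rvmeas_spar.
have := rvmeas_if mK mt mf; congr rvmeas; apply/funext => y.
by rewrite /side /preimage /=; case: asboolP.
Qed.

Lemma snice_coef S s u v : snice (m := m) S
  (fun x => \1_(closure (sub P s)) x * dot (mulmv (coef P s x) u) v).
Proof.
apply: (@rniceI _ _ _ (bM * enorm u * enorm v)).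
  apply: (rvmeas_comp (f := fun x => \1_(closure (sub P s)) x * dot (mulmv (coef P s x) u) v)).
    by apply: rvmeas_within; [exact: closed_closure|exact: coef_form_within].
  by move=> i; apply: rvmeas_spar.
move=> y _; rewrite indicE; case: (boolP (_ \in _)); rewrite ?mul1r ?mul0r ?normr0.
  by move=> /set_mem; apply: coef_bound.
by move=> _; rewrite !mulr_ge0 ?enorm_ge0 // ltW.
Qed.

Definition inD S := (0 < #|S|)%N /\ osimplex (m := m) S `<=` closure (dom P).

Lemma snice_form S (u v : bool -> 'rV[R]_N) : inD S ->
  snice (m := m) S (fun x => dot (mulmv (coefx P x) (u (side P x))) (v (side P x))).
Proof.
move=> [S0 SD]; apply: (snice_eq S0 _ (snice_side (fun s => snice_coef S s (u s) (v s)))).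
move=> x hx; rewrite indicE mem_set ?mul1r //.
by apply: side_closure => //; apply: SD.
Qed.

Lemma snice_bval S (z : bool -> P1 R N) :
  snice (m := m) S (fun x => peval (z (side P x)) x).
Proof. exact: (snice_side (fun s => snice_peval S (z s))). Qed.

Lemma wint_suml (I : Type) (e : seq I) (a : I -> R) (f : I -> vfield m) T r : inD T ->
  wint P T (fun T s => \sum_(i <- e) a i *: f i T s) r = \sum_(i <- e) a i * wint P T (f i) r.
Proof.
move=> hT; rewrite /wint.
transitivity (sint T (fun x => \sum_(i <- e) a i * dot (mulmv (coefx P x) (vval P (f i) T x)) (vval P r T x))).
  congr sint; apply/funext => x; rewrite /vval.
  elim: e => [|i e ih]; first by rewrite !big_nil mulmv0 dot0l.
  by rewrite !big_cons mulmvD dotDl mulmvZ dotZl ih.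
rewrite sint_sum => [|i]; last by apply: rniceZ; apply: snice_form.
by apply: eq_bigr => i _; rewrite sintZ //; apply: snice_form.
Qed.

Lemma wint_sym T q r : inD T -> wint P T q r = wint P T r q.
Proof.
move=> [T0 TD]; apply: sint_eq => // x hx; rewrite dot_mulmv.
by rewrite (coef_sym hP (side_closure hP (TD _ hx))) dotC.
Qed.

Lemma wint_sumr (I : Type) (e : seq I) (a : I -> R) (f : I -> vfield m) T r : inD T ->
  wint P T r (fun T s => \sum_(i <- e) a i *: f i T s) = \sum_(i <- e) a i * wint P T r (f i).
Proof.
move=> hT; rewrite wint_sym // wint_suml //.
by apply: eq_bigr => i _; rewrite wint_sym.
Qed.

Lemma wint_ge0 T q : inD T -> 0 <= wint P T q q.
Proof.
move=> hT; rewrite -[X in X <= _](mul0r (smeas T)) -sint_cst.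
apply: le_sint; [exact: hT.1|exact: snice_cst|exact: snice_form|].
by move=> x /hT.2 /(side_closure hP) h; apply: (coef_psd h).2.
Qed.

Lemma wint_lower T q g : inD T -> 0 <= g -> (forall s, g <= enorm (q T s)) ->
  bm * g ^+ 2 * smeas T <= wint P T q q.
Proof.
move=> hT g0 hg; rewrite -sint_cst.
apply: le_sint; [exact: hT.1|exact: snice_cst|exact: snice_form|].
move=> x /hT.2 /(side_closure hP) h; have /andP[h1 _] := ell h (vval P q T x).
apply: le_trans h1; apply: ler_wpM2l; first exact: ltW.
by rewrite ler_pXn2r ?nnegrE ?enorm_ge0 //; apply: hg.
Qed.

Lemma wint_upper T q g : inD T -> (forall s, enorm (q T s) <= g) ->
  wint P T q q <= bM * g ^+ 2 * smeas T.
Proof.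
move=> hT hg; rewrite -sint_cst.
apply: le_sint; [exact: hT.1|exact: snice_form|exact: snice_cst|].
move=> x /hT.2 /(side_closure hP) h; have /andP[_ h1] := ell h (vval P q T x).
apply: le_trans h1 _; apply: ler_wpM2l; first exact: ltW.
rewrite ler_pXn2r ?nnegrE ?enorm_ge0 //; first exact: hg.
exact: le_trans (enorm_ge0 _) (hg true).
Qed.

(** Pointwise positivity of the form at 8 q - r. The weight 8 matches the penalty factor in [sh];
    the weight 1/8, counted at most four times per element, consumes half of [ah]. *)
Lemma wint_young T q r : inD T ->
  2 * wint P T q r <= 8 * wint P T q q + 8^-1 * wint P T r r.
Proof.
move=> hT; rewrite /wint -!sintZ; try exact: snice_form.
rewrite -sintD; try by apply: rniceZ; apply: snice_form.
apply: le_sint; [exact: hT.1|by apply: rniceZ; apply: snice_form| |].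
  by apply: rniceD; apply: rniceZ; apply: snice_form.
move=> x /hT.2 /(side_closure hP) h; rewrite /coefx.
set u := vval P q T x; set v := vval P r T x; set B := coef P _ x.
have [Bs B0] := coef_psd h; have := B0 (8 *: u - v).
have e : dot (mulmv B v) u = dot (mulmv B u) v by rewrite dot_mulmv Bs dotC.
rewrite mulmvB mulmvZ dotBl !dotBr !dotZl !dotZr e.
by move: (dot (mulmv B u) u) (dot (mulmv B u) v) (dot (mulmv B v) v) => X Y Z; lra.
Qed.

Lemma wint_eq T q q' r r' : inD T -> (forall s, q T s = q' T s) -> (forall s, r T s = r' T s) ->
  wint P T q r = wint P T q' r'.
Proof.
by move=> [T0 _] h1 h2; apply: sint_eq => // x _; rewrite /vval h1 h2.
Qed.

End WeightedIntegrals.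

(** * Crouzeix-Raviart interpolation *)

Section CrouzeixRaviart.
Variables (R : realType) (N : nat) (m : mesh R N).
Hypothesis hN : N = 2%N \/ N = 3%N.
Local Notation V := 'I_(nvert m).
Implicit Types (S T F : {set V}) (q r d : P1 R N) (x y : 'rV[R]_N) (f : V -> R).

Lemma N_gt0 : (0 < N)%N.
Proof. by case: hN => ->. Qed.

Lemma NR_neq0 : (N%:R : R) != 0.
Proof. by rewrite pnatr_eq0; case: hN => ->. Qed.

Lemma card_facet T a : nondeg (m := m) T -> a \in T -> #|T :\ a| = N.
Proof. by move=> [cT _] aT; have := cardsD1 a T; rewrite aT cT add1n => -[]. Qed.

Lemma lam_facet T a b : nondeg T -> a \in T -> b \in T ->
  peval (lam T b) (bary (m := m) (T :\ a)) = if b == a then 0 else N%:R^-1.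
Proof.
move=> nT aT bT; rewrite (lam_baryc nT) ?subD1set ?(card_facet nT aT) ?N_gt0 //.
by rewrite !inE bT andbT; case: eqP.
Qed.

(* The affine function with value f a at the barycenter of the facet opposite to
   the vertex a. *)
Definition crp T f : P1 R N :=
  (\sum_(a in T) f a * (1 - N%:R * (lam T a).1),
   \sum_(a in T) (- N%:R * f a) *: (lam T a).2).

Lemma peval_crp T f x :
  peval (crp T f) x = \sum_(a in T) f a * (1 - N%:R * peval (lam T a) x).
Proof.
rewrite /peval /crp /= dot_suml -big_split /=; apply: eq_bigr => a _.
by rewrite dotZl; ring.
Qed.

Lemma crp_facet T f a : nondeg T -> a \in T -> peval (crp T f) (bary (T :\ a)) = f a.
Proof.
move=> nT aT; rewrite peval_crp (bigD1 a) //= lam_facet // eqxx mulr0 subr0 mulr1.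
rewrite big1 ?addr0 // => b /andP[bT ba]; rewrite lam_facet // (negPf ba).
by rewrite mulfV ?NR_neq0 // subrr mulr0.
Qed.

Lemma peval_facets T q x : nondeg T ->
  peval q x = \sum_(a in T) peval q (bary (T :\ a)) * (1 - N%:R * peval (lam T a) x).
Proof.
move=> nT; set S := \sum_(a in T) peval q (pt m a).
have qm a : a \in T -> peval q (bary (T :\ a)) = N%:R^-1 * (S - peval q (pt m a)).
  move=> aT; rewrite (peval_lam nT) /S (bigD1 a) //= [in RHS](bigD1 a) //= addrAC subrr add0r.
  rewrite lam_facet // eqxx mul0r add0r mulr_sumr; apply: eq_bigr => b /andP[bT ba].
  by rewrite lam_facet // (negPf ba).
transitivity (\sum_(a in T) (N%:R^-1 * S - N%:R^-1 * peval q (pt m a)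
    - S * peval (lam T a) x + peval (lam T a) x * peval q (pt m a))); last first.
  apply: eq_bigr => a aT; rewrite qm //; field; exact: NR_neq0.
rewrite big_split /= -(peval_lam nT) !sumrB -!mulr_sumr (lam_sum1 nT) mulr1 -/S.
rewrite sumr_const nT.1 -[S *+ _]mulr_natl -natr1; field; exact: NR_neq0.
Qed.

Lemma grad_eq_of_vertices T q r c : nondeg T ->
  (forall a, a \in T -> peval q (pt m a) - peval r (pt m a) = c) -> q.2 = r.2.
Proof.
move=> nT h; have hx x : peval q x - peval r x = c.
  rewrite !(peval_lam nT) -sumrB -[c]mul1r -(lam_sum1 nT x) mulr_suml.
  by apply: eq_bigr => a aT; rewrite -mulrBr h.
have h0 x : dot (q.2 - r.2) x = 0.
  have := hx x; have := hx 0; rewrite /peval !dot0r dotBl !addr0 => <-; lra.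
by apply/eqP; rewrite -subr_eq0 -dot_eq0 h0.
Qed.

(** The Crouzeix-Raviart degrees of freedom of the positive part of d. *)
Definition apos T d a : R := savg (T :\ a) (fun x => posp (peval d x)).

(* Both properties express the divergence theorem for the positive part of d; they
   are read off the explicit averages in terms of the values at the vertices. *)
Lemma apos_pair T d : nondeg T -> (forall a, a \in T -> smeas (m := m) (T :\ a) != 0) ->
  (forall a b, a \in T -> b \in T -> peval d (pt m a) <= peval d (pt m b) ->
     0 <= N%:R * (apos T d a - apos T d b) <= peval d (pt m b) - peval d (pt m a)) /\
  (forall a b c, a \in T -> b \in T -> c \in T ->
     (apos T d a - apos T d b) * (peval d (pt m c) - peval d (pt m a)) =
     (apos T d a - apos T d c) * (peval d (pt m b) - peval d (pt m a))).
Proof.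
move=> nT hm.
have c2 (a b : V) : a \in T -> b \in T -> a != b -> #|T :\ a :\ b| = N.-1.
  move=> aT bT ab; have := cardsD1 b (T :\ a); rewrite (card_facet nT aT) !inE bT eq_sym ab /=.
  by rewrite add1n => /(congr1 predn) /= ->.
case: hN => eN; have eNR := congr1 (fun n => n%:R : R) eN.
(* For N = 2 the facet opposite to a vertex is the segment of the other two, and the averages are
   values of [H1]. *)
- have third (a b : V) : a \in T -> b \in T -> a != b -> exists c, [/\ a != c, b != c & T = [set a; b; c]%SET].
    move=> aT bT ab; have /eqP/cards1P[c hc] : #|T :\ a :\ b| = 1%N by rewrite (c2 a b aT bT ab); exact: (congr1 predn eN).
    have : c \in T :\ a :\ b by rewrite hc set11.
    rewrite !inE => /and3P[cb ca cT]; exists c; split; rewrite 1?eq_sym //.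
    apply/setP => v; move/setP: hc => /(_ v); rewrite !inE.
    by case: eqP => [->|_]; case: eqP => [->|_]; rewrite ?aT ?bT //= => ->.
  have val (a b c : V) : uniq [:: a; b; c] -> T = [set a; b; c]%SET ->
      apos T d a = H1 (peval d (pt m b)) (peval d (pt m c)).
    move=> /= /and3P[]; rewrite !inE negb_or => /andP[ab ac] bc _ hT.
    have aT : a \in T by rewrite hT !inE eqxx.
    rewrite /apos (savg_posp2 _ (hm _ aT) bc) // hT; apply/setP => v; rewrite !inE.
    by case: eqP => [->|_] //=; rewrite (negPf ab) (negPf ac).
  have perm1 (a b c : V) : T = [set a; b; c]%SET -> T = [set b; a; c]%SET.
    by move=> ->; apply/setP => v; rewrite !inE [(v == a) || _]orbC.
  have perm2 (a b c : V) : T = [set a; b; c]%SET -> T = [set c; a; b]%SET.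
    by move=> ->; apply/setP => v; rewrite !inE orbC orbA.
  split=> [a b aT bT dab|a b c aT bT cT].
    have [->|ab] := eqVneq a b; first by rewrite !subrr mulr0 lexx.
    have [c [ac bc hT]] := third a b aT bT ab.
    rewrite (val a b c) // ?(val b a c) //=; last 3 first.
    - by rewrite !inE negb_or eq_sym ab bc ac.
    - exact: perm1.
    - by rewrite !inE negb_or ab ac bc.
    have /andP[h1 h2] := H1_mono (peval d (pt m c)) dab.
    move: eNR => /= ->; clear -h1 h2; apply/andP; split; lra.
  have [->|ab] := eqVneq a b; first by rewrite !subrr mul0r mulr0.
  have [->|ac] := eqVneq a c; first by rewrite !subrr mul0r mulr0.
  have [->|bc] := eqVneq b c; first by [].
  have hT : T = [set a; b; c]%SET.
    have c3 : #|T| = 3%N by rewrite nT.1; exact: (congr1 succn eN).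
    apply/esym/eqP; rewrite eqEcard c3; apply/andP; split.
      by apply/fintype.subsetP => v; rewrite !inE => /orP[/orP[]|] /eqP ->.
    by rewrite -finset.setUA cardsU1 cards2 !inE negb_or ab ac bc.
  rewrite (val a b c) ?(val b a c) ?(val c a b) //=; first exact: H1_triple.
  - by rewrite !inE negb_or ![c == _]eq_sym ac bc ab.
  - exact: perm2.
  - by rewrite !inE negb_or eq_sym ab bc ac.
  - exact: perm1.
  - by rewrite !inE negb_or ab ac bc.
(* For N = 3 the facets are triangles, and the averages are twice the values of [H2]. *)
- have fourth (a b : V) : a \in T -> b \in T -> a != b -> exists c e,
      uniq [:: a; b; c; e] /\ forall v, (v \in T) = (v \in [:: a; b; c; e]).
    move=> aT bT ab; have /eqP/cards2P[c [e [ce hc]]] : #|T :\ a :\ b| = 2%N by rewrite (c2 a b aT bT ab); exact: (congr1 predn eN).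
    have : c \in T :\ a :\ b by rewrite hc !inE eqxx.
    have : e \in T :\ a :\ b by rewrite hc !inE eqxx orbT.
    rewrite !inE => /and3P[eb ea eT] /and3P[cb ca cT]; exists c, e; split.
      by rewrite /= !inE !negb_or ab ![_ == c]eq_sym ca cb ![_ == e]eq_sym ea eb [e == c]eq_sym ce.
    move=> v; move/setP: hc => /(_ v); rewrite !inE.
    by case: eqP => [->|_]; case: eqP => [->|_]; rewrite ?aT ?bT //= => ->.
  have val (a b c e : V) : uniq [:: a; b; c; e] ->
      (forall v, (v \in T) = (v \in [:: a; b; c; e])) ->
      apos T d a = 2 * H2 (peval d (pt m b)) (peval d (pt m c)) (peval d (pt m e)).
    move=> /= /and4P[a1 b1 c1 _] hT.
    have aT : a \in T by rewrite hT !inE eqxx.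
    rewrite /apos (@savg_posp3 _ _ _ _ _ b c e (hm _ aT)) //=; first by rewrite b1 c1.
    apply/setP => v; rewrite !inE hT !inE -orbA.
    case: (eqVneq v a) => [->|_] //=.
    by apply/esym/negbTE; move: a1; rewrite !inE.
  have swp (a b c e : V) : (forall v, (v \in T) = (v \in [:: a; b; c; e])) ->
      (forall v, (v \in T) = (v \in [:: b; a; c; e])) /\
      (forall v, (v \in T) = (v \in [:: c; a; b; e])).
    move=> hT; split=> v; rewrite hT !inE; first by rewrite orbCA.
    by case: (v == a); case: (v == b); case: (v == c).
  have uswp (a b c e : V) : uniq [:: a; b; c; e] -> uniq [:: b; a; c; e] /\ uniq [:: c; a; b; e].
    move=> u; split; [rewrite -(perm_uniq (s1 := [:: a; b; c; e])) //|
                      rewrite -(perm_uniq (s1 := [:: a; b; c; e])) //].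
      by apply/seq.permP => p /=; rewrite addnCA.
    by apply/seq.permP => p /=; rewrite (addnCA (p b) (p c)) (addnCA (p a) (p c)).
  split=> [a b aT bT dab|a b c aT bT cT].
    have [->|ab] := eqVneq a b; first by rewrite !subrr mulr0 lexx.
    have [c [e [u hT]]] := fourth a b aT bT ab.
    rewrite (val a b c e) // (val b a c e) ?(swp _ _ _ _ hT).1 ?(uswp _ _ _ _ u).1 //.
      have /andP[h1 h2] := H2_mono (peval d (pt m c)) (peval d (pt m e)) dab.
      move: eNR => /= ->; clear -h1 h2; apply/andP; split; lra.
    exact: (swp _ _ _ _ hT).1.
  have [->|ab] := eqVneq a b; first by rewrite !subrr mul0r mulr0.
  have [->|ac] := eqVneq a c; first by rewrite !subrr mul0r mulr0.
  have [->|bc] := eqVneq b c; first by [].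
  have [e [u hT]] : exists e, uniq [:: a; b; c; e] /\
      forall v, (v \in T) = (v \in [:: a; b; c; e]).
    have [c' [e [u hT]]] := fourth a b aT bT ab.
    have := hT c; rewrite cT !inE eq_sym (negPf ac) eq_sym (negPf bc) /= => /esym/orP[]/eqP ->.
      by exists e.
    exists c'; split=> [|v]; last by rewrite hT !inE [(v == c') || _]orbC.
    have up : perm_eq [:: a; b; c'; e] [:: a; b; e; c'].
      by apply/seq.permP => p /=; rewrite !addn0 (addnC (p c')).
    by move: u; rewrite (perm_uniq up).
  rewrite (val a b c e) // (val b a c e) ?(uswp _ _ _ _ u).1 //; last exact: (swp _ _ _ _ hT).1.
  rewrite (val c a b e) ?(uswp _ _ _ _ u).2 //; last exact: (swp _ _ _ _ hT).2.
  have h := H2_triple (peval d (pt m a)) (peval d (pt m b)) (peval d (pt m c)) (peval d (pt m e)).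
  by rewrite -!mulrBr -!mulrA h.
Qed.

(* th is the volume fraction of the part of T where d is positive. *)
Lemma crp_posp_grad T d : nondeg T -> (forall a, a \in T -> smeas (m := m) (T :\ a) != 0) ->
  exists2 th, 0 <= th <= 1 & (crp T (apos T d)).2 = th *: d.2.
Proof.
move=> nT hm; have [h1 h2] := apos_pair d nT hm.
have [th ht hth] : exists2 th, 0 <= th <= 1 & forall a b, a \in T -> b \in T ->
    N%:R * (apos T d a - apos T d b) = th * (peval d (pt m b) - peval d (pt m a)).
  (* If d takes the same value at all vertices, all averages agree and theta = 0 serves. Otherwise
     theta is the ratio for one pair with distinct values, and the proportionality in [apos_pair]
     carries it to every vertex. *)
  have [[a [b [aT bT dab]]]|h] := pselect (exists a b, [/\ a \in T, b \in T &
      peval d (pt m a) < peval d (pt m b)]); last first.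
    exists 0; first by rewrite lexx ler01.
    move=> a b aT bT; rewrite mul0r.
    have dle c c' : c \in T -> c' \in T -> peval d (pt m c) <= peval d (pt m c').
      by move=> cT c'T; rewrite leNgt; apply/negP => lt; apply: h; exists c', c.
    apply/eqP; rewrite eq_le; have /andP[p1 p2] := h1 _ _ aT bT (dle _ _ aT bT).
    by rewrite p1 andbT (le_trans p2) // subr_le0 dle.
  have e0 : 0 < peval d (pt m b) - peval d (pt m a) by rewrite subr_gt0.
  set th := N%:R * (apos T d a - apos T d b) / (peval d (pt m b) - peval d (pt m a)).
  have hc c : c \in T -> N%:R * (apos T d a - apos T d c) = th * (peval d (pt m c) - peval d (pt m a)).
    move=> cT; have := h2 a b c aT bT cT => h.
    have e0' := lt0r_neq0 e0; apply: (mulIf e0'); rewrite /th -!mulrA -h; field; exact: e0'.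
  exists th.
    have /andP[p1 p2] := h1 _ _ aT bT (ltW dab).
    by rewrite /th divr_ge0 ?(ltW e0) //= ler_pdivrMr // mul1r.
  move=> c c' cT c'T; have := hc c cT; have := hc c' c'T.
  move: (peval d (pt m c)) (peval d (pt m c')) (peval d (pt m a)) => x y z; lra.
exists th => //.
pose r : P1 R N := (th * d.1, th *: d.2).
have rE x : peval r x = th * peval d x by rewrite /peval /r /= dotZl mulrDr.
have vE a : a \in T -> peval (crp T (apos T d)) (pt m a) =
    \sum_(c in T) apos T d c - N%:R * apos T d a.
  move=> aT; rewrite peval_crp; under eq_bigr do rewrite mulrBr mulr1.
  rewrite sumrB; congr (_ - _); rewrite (bigD1 a) //= lam_vert // eqxx mulr1 mulrC.
  rewrite big1 ?addr0 // => c /andP[cT ca].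
  by rewrite lam_vert // eq_sym (negPf ca) !mulr0.
have [a0 a0T] : exists a0, a0 \in T by apply/card_gt0P; rewrite nT.1.
apply: (@grad_eq_of_vertices T _ r
  (peval (crp T (apos T d)) (pt m a0) - peval r (pt m a0)) nT) => a aT.
rewrite !vE // !rE; have := hth _ _ a0T aT.
move: (\sum_(c in T) _) (peval d _) (peval d _) (apos T d a) (apos T d a0) => S x y u w; lra.
Qed.

End CrouzeixRaviart.

(** * Positivity of the measure of a face *)

Section FaceMeasure.
Variables (R : realType) (N : nat) (m : mesh R N).
Local Notation V := 'I_(nvert m).
Implicit Types (S T F : {set V}) (q r : P1 R N) (x y : 'rV[R]_N).

(* Adding a unit normal as an extra row does not change the Gram determinant and
   makes the matrix square. *)
Lemma det_gram_ge0 k (E : 'M[R]_(k, N)) (n : 'rV[R]_N) : (1 + k)%N = N ->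
  dot n n = 1 -> E *m n^T = 0 -> 0 <= \det (E *m E^T).
Proof.
move=> kN nn En; have sq l (G : 'M[R]_(l, N)) : l = N -> 0 <= \det (G *m G^T).
  by move=> e; move: G; rewrite e => G; rewrite det_mulmx det_tr -expr2 sqr_ge0.
have := sq _ (col_mx n E) kN.
rewrite tr_col_mx mul_col_row En.
have -> : n *m E^T = 0 by rewrite -[n]trmxK -trmx_mul En trmx0.
rewrite det_ublock; have -> : n *m n^T = 1%:M.
  by apply/matrixP => i j; rewrite !ord1 [LHS]nn mxE.
by rewrite det1 mul1r.
Qed.

(** A combination of the edges that vanishes is tested against the gradients of the coordinates of
    T, which isolate its coefficients. The normal required by [det_gram_ge0] is the gradient of the
    coordinate vanishing on the face. *)
Lemma jac_face_gt0 T a : nondeg (m := m) T -> (1 < N)%N -> a \in T -> 0 < jac (T :\ a).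
Proof.
move=> nT N1 aT; set F := T :\ a; set E := sedge F.
have cF : #|F| = N by have := cardsD1 a T; rewrite aT nT.1 add1n => -[].
have FT : F \subset T by exact: subD1set.
have sv (i : nat) : (i < #|F|)%N -> exists2 v, v \in F & (svert F)`_i = pt m v /\ index v (enum F) = i.
  exact: svert_nth.
have F0 : (0 < #|F|)%N by rewrite cF ltnW.
have sF (i : 'I_#|F|.-1) : (i.+1 < #|F|)%N by rewrite -[X in (_ < X)%N](prednK F0) ltnS.
have lamE b i : b \in T -> ((lam T b).2 *m E^T) 0 i =
    peval (lam T b) (svert F)`_i.+1 - peval (lam T b) (svert F)`_0.
  by move=> bT; rewrite sedge_dot.
have detn0 : \det (E *m E^T) != 0.
  apply/negP => /det0P[v vn0 /(congr1 (mulmx^~ v^T))]; rewrite mul0mx => h.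
  have vE0 : v *m E = 0.
    by apply/eqP; rewrite -dot_eq0 /dot trmx_mul mulmxA -(mulmxA v) h mxE.
  case/negP: vn0; apply/eqP/rowP => i; rewrite mxE.
  have [b bF [pb ib]] := sv _ (sF i); have bT := fintype.subsetP FT b bF.
  have : dot (v *m E) (lam T b).2 = 0 by rewrite vE0 dot0l.
  have -> : dot (v *m E) (lam T b).2 = dot v ((lam T b).2 *m E^T).
    by rewrite /dot trmx_mul trmxK mulmxA.
  rewrite dotE (bigD1 i) //= lamE // pb.
  have [v0 v0F [p0 i0]] := sv _ F0; rewrite p0 !(lam_vert nT) ?eqxx //; last exact: (fintype.subsetP FT).
  have -> : (v0 == b) = false by apply/eqP => e; move: ib; rewrite -e i0.
  rewrite subr0 mulr1 big1 ?addr0 // => j ji; rewrite lamE //.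
  have [w wF [pw iw]] := sv _ (sF j); rewrite pw p0 !(lam_vert nT) ?(fintype.subsetP FT) //.
  have -> : (w == b) = false.
    by apply/eqP => e; move/eqP: ji; apply; apply/val_inj/succn_inj; rewrite /= -iw -ib e.
  have -> : (v0 == b) = false by apply/eqP => e; move: ib; rewrite -e i0.
  by rewrite subrr mulr0.
rewrite /jac sqrtr_gt0 lt0r detn0 /=.
set g := (lam T a).2.
have g0 : g != 0.
  have [v0 v0F [p0 i0]] := sv _ F0.
  have := pevalB (lam T a) (pt m a) (pt m v0).
  rewrite (lam_vert nT aT aT) (lam_vert nT aT (fintype.subsetP FT _ v0F)) eqxx.
  have -> : (v0 == a) = false by apply/eqP => e; move: v0F; rewrite e !inE eqxx.
  rewrite subr0 -/g => e1; apply/eqP => g0; move: e1; rewrite g0 dot0l => /eqP.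
  by rewrite oner_eq0.
have en : enorm g != 0 by rewrite enorm_eq0.
apply: (@det_gram_ge0 _ E ((enorm g)^-1 *: g)).
- by rewrite add1n prednK // cF.
- by rewrite dotZl dotZr -enorm_sq; field.
apply/colP => i; rewrite linearZ /= -scalemxAr !mxE.
have := lamE a i aT; rewrite -/g.
have [w wF [pw _]] := sv _ (sF i); have [v0 v0F [p0 _]] := sv _ F0.
rewrite pw p0 (lam_vert nT aT (fintype.subsetP FT _ wF)) (lam_vert nT aT (fintype.subsetP FT _ v0F)).
have na v : v \in F -> (v == a) = false by move=> vF; apply/eqP => e; move: vF; rewrite e !inE eqxx.
rewrite !na // subrr !mxE => e; apply/eqP; rewrite mulf_eq0; apply/orP; right; apply/eqP.
by rewrite -[RHS]e; apply: eq_bigr => j _; rewrite !mxE mulrC.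
Qed.

Lemma smeas_face_gt0 T a : nondeg (m := m) T -> (1 < N)%N -> a \in T -> 0 < smeas (m := m) (T :\ a).
Proof.
move=> nT N1 aT; rewrite /smeas sintE mulr_gt0 ?jac_face_gt0 //; exact: rint1_gt0.
Qed.

Lemma peval_inj q r : (forall x, peval q x = peval r x) -> q = r.
Proof.
move=> h; have h1 : q.1 = r.1 by have := h 0; rewrite /peval !dot0r !addr0.
have h2 : q.2 = r.2.
  apply/eqP; rewrite -subr_eq0 -dot_eq0 dotBl.
  by have := h (q.2 - r.2); rewrite /peval h1 => /addrI ->; rewrite subrr.
by case: q r h1 h2 {h} => [? ?] [? ?] /= -> ->.
Qed.

End FaceMeasure.

(** * The local immersed space *)

Section LocalIFE.
Variables (R : realType) (N : nat) (P : interface_problem R N) (mu : R).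
Variables (m : mesh R N) (L : planes m).
Hypothesis hN : N = 2%N \/ N = 3%N.
Local Notation V := 'I_(nvert m).
Implicit Types (S F : {set V}) (q r : P1 R N) (x y g n : 'rV[R]_N) (z : bool -> P1 R N).

Lemma orthonormal_complement n (t : 'I_N.-1 -> 'rV[R]_N) g : enorm n = 1 ->
  (forall i j, dot (t i) (t j) = (i == j)%:R) -> (forall i, dot (t i) n = 0) ->
  (forall i, dot g (t i) = 0) -> g = dot g n *: n.
Proof.
move=> n1 tt tn gt; have nn : dot n n = 1 by rewrite -enorm_sq n1 expr1n.
pose O := col_mx n (\matrix_i t i); set w := g - dot g n *: n.
have OO : O *m O^T = 1%:M.
  rewrite /O tr_col_mx mul_col_row (@scalar_mx_block R 1 N.-1 1); congr block_mx.
  - by apply/matrixP => i j; rewrite !ord1 [LHS]nn mxE.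
  - apply/matrixP => i j; rewrite ord1 [RHS]mxE -[RHS](tn j) dotC /dot !mxE.
    by apply: eq_bigr => k _; rewrite !mxE.
  - apply/matrixP => i j; rewrite ord1 [RHS]mxE -[RHS](tn i) /dot !mxE.
    by apply: eq_bigr => k _; rewrite !mxE.
  - apply/matrixP => i j; rewrite [RHS]mxE -[RHS](tt i j) /dot !mxE.
    by apply: eq_bigr => k _; rewrite !mxE.
have full : row_full O.
  rewrite /row_full eqn_leq rank_leq_col /=.
  have := mxrankM_maxl O O^T; rewrite OO mxrank1.
  by apply: leq_trans; rewrite add1n (prednK (N_gt0 hN)).
have /submxP[u wu] : (w <= O)%MS by exact: submx_full.
have wO : w *m O^T = 0.
  rewrite /O tr_col_mx mul_mx_row -[RHS]row_mx0; congr row_mx.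
    by apply/matrixP => i j; rewrite !ord1 [LHS](_ : _ = dot w n) // [RHS]mxE dotBl dotZl nn mulr1 subrr.
  apply/matrixP => i j; rewrite ord1 [RHS]mxE.
  transitivity (dot w (t j)); first by rewrite /dot !mxE; apply: eq_bigr => k _; rewrite !mxE.
  by rewrite dotBl dotZl gt [dot n _]dotC tn mulr0 subrr.
have w0 : w == 0.
  by rewrite -dot_eq0 /dot {2}wu trmx_mul mulmxA wO mul0mx mxE.
by apply/eqP; rewrite -subr_eq0.
Qed.

Variable T : {set V}.
Hypothesis nT : nondeg T.
Hypothesis hn : enorm (pn L T) = 1.
Hypothesis htt : forall i j, dot (ptan L T i) (ptan L T j) = (i == j)%:R.
Hypothesis htn : forall i, dot (ptan L T i) (pn L T) = 0.
Hypothesis mu0 : 0 < mu.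
Variables (bm bM : R).
Hypotheses (bm0 : 0 < bm) (bM0 : 0 < bM).
Hypothesis hB : forall s u, bm * enorm u ^+ 2 <=
  dot (mulmv (coefT P L T s) u) u <= bM * enorm u ^+ 2.
Hypothesis hBb : forall s u v,
  `|dot (mulmv (coefT P L T s) u) v| <= bM * enorm u * enorm v.

Let n := pn L T.
Let B s := coefT P L T s.
(* The signed distance to the plane. *)
Definition pdist : P1 R N := (- dot (px L T) n, n).
Local Notation d := pdist.

Lemma pdistE x : peval d x = dot (x - px L T) n.
Proof. by rewrite /peval /= dotBl addrC (dotC n). Qed.

Lemma xbarB i : xbar mu L T i - px L T = (mu * Defs.hT T) *: ptan L T i.
Proof. by rewrite /xbar addrAC subrr add0r. Qed.

(** The point conditions make the jump vanish at a point of the plane and along N - 1 independent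
    tangent directions, so it is a multiple of the signed distance. *)
Lemma JpointsP z : (Jpoint (px L T) z = 0 /\ forall i, Jpoint (xbar mu L T i) z = 0) <->
  exists al, forall x, peval (z true) x = peval (z false) x + al * peval d x.
Proof.
split=> [[h0 h1]|[al h]]; last first.
  rewrite /Jpoint; split=> [|i]; rewrite h pdistE.
    by rewrite subrr dot0l; lra.
  by rewrite xbarB dotZl htn; lra.
exists (dot ((z true).2 - (z false).2) n) => x.
have g i : dot ((z true).2 - (z false).2) (ptan L T i) = 0.
  have := h1 i; rewrite /Jpoint.
  have := pevalB (z true) (xbar mu L T i) (px L T).
  have := pevalB (z false) (xbar mu L T i) (px L T).
  rewrite !xbarB !dotZr dotBl; move: h0; rewrite /Jpoint.
  have hh : mu * Defs.hT T != 0 by rewrite gt_eqF // mulr_gt0 // (hT_gt0 nT) //; case: hN => ->.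
  move=> e1 e2 e3 e4; apply: (mulfI hh); rewrite mulr0 mulrBr; lra.
have e := orthonormal_complement hn htt htn g.
have := pevalB (z true) x (px L T); have := pevalB (z false) x (px L T).
move: h0; rewrite /Jpoint pdistE -dotZr.
have : dot ((z true).2 - (z false).2) (x - px L T) =
  dot (dot ((z true).2 - (z false).2) n *: n) (x - px L T) by rewrite -e.
rewrite dotZl dotBl [dot n _]dotC dotZr; move: (dot _ n) (dot _ n) => a b; lra.
Qed.

Definition nbn s : R := dot (mulmv (B s) n) n.

Lemma nbn_bounds s : bm <= nbn s <= bM.
Proof. by have := hB s n; rewrite hn expr1n !mulr1. Qed.

Definition fluxjump g : R := dot (mulmv (B false) g) n - dot (mulmv (B true) g) n.

Lemma fluxjumpD g1 g2 : fluxjump (g1 + g2) = fluxjump g1 + fluxjump g2.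
Proof. by rewrite /fluxjump !mulmvD !dotDl; ring. Qed.

Lemma fluxjumpZ a g : fluxjump (a *: g) = a * fluxjump g.
Proof. by rewrite /fluxjump !mulmvZ !dotZl; ring. Qed.

Lemma fluxjump_n : fluxjump n = nbn false - nbn true.
Proof. by []. Qed.

Lemma fluxjump_bound g : `|fluxjump g| <= 2 * bM * enorm g.
Proof.
have h1 := hBb true g n; have h2 := hBb false g n.
rewrite hn mulr1 in h1; rewrite hn mulr1 in h2.
by rewrite /fluxjump (le_trans (ler_normB _ _)) //; lra.
Qed.

Lemma VT_itfP z : T \in itf_cells P m -> VT P mu L T z <->
  exists2 al, z true = ((z false).1 + al * d.1, (z false).2 + al *: n) &
    al * nbn true = fluxjump (z false).2.
Proof.
move=> iT; rewrite /VT iT.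
have fl al : (z true).2 = (z false).2 + al *: n ->
    Jflux P L T z = al * nbn true - fluxjump (z false).2.
  by move=> e; rewrite /Jflux e mulmvD mulmvZ dotDl dotZl /fluxjump /nbn; ring.
split=> [[h0 h1 h2]|[al e h]].
  have [al h] := (JpointsP z).1 (conj h0 h1); exists al.
    by apply: peval_inj => x; rewrite h /peval /= dotDl dotZl; ring.
  have e : (z true).2 = (z false).2 + al *: n.
    have -> // : z true = ((z false).1 + al * d.1, (z false).2 + al *: n).
    by apply: peval_inj => x; rewrite h /peval /= dotDl dotZl; ring.
  by apply/eqP; rewrite -subr_eq0 -(fl al e) h2.
have [h0 h1] : Jpoint (px L T) z = 0 /\ forall i, Jpoint (xbar mu L T i) z = 0.
  by apply/JpointsP; exists al => x; rewrite e /peval /= dotDl dotZl; ring.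
by split=> //; rewrite (fl al) ?e //= h subrr.
Qed.

End LocalIFE.

(** * Traces on the faces of the two sides of the plane *)

Section FaceTraces.
Variables (R : realType) (N : nat) (P : interface_problem R N).
Variables (m : mesh R N) (L : planes m).
Hypothesis hN : N = 2%N \/ N = 3%N.
Local Notation V := 'I_(nvert m).
Implicit Types (S F : {set V}) (q r : P1 R N) (x y g n : 'rV[R]_N) (z : bool -> P1 R N).

Lemma segment_closure (A : set 'rV[R]_N) x y e : 0 < e ->
  (forall t, 0 < t -> t < e -> A (x + t *: (y - x))) -> closure A x.
Proof.
move=> e0 hA B xB.
have cg : (fun t : R => x + t *: (y - x)) @ 0 --> x.
  have -> : nbhs x = nbhs (x + 0 *: (y - x)) by rewrite scale0r addr0.
  by apply: cvgD; [exact: cvg_cst|apply: cvgZr_tmp; exact: cvg_id].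
have /nbhs_ballP[r r0 hr] : nbhs (0 : R) ((fun t : R => x + t *: (y - x)) @^-1` B) by exact: cg.
pose t := Num.min (e / 2) (r / 2).
have r0' : 0 < r by exact: r0.
have t0 : 0 < t by rewrite lt_min !divr_gt0.
exists (x + t *: (y - x)); split.
  apply: hA => //; rewrite /t gt_min; apply/orP; left; lra.
apply: hr; rewrite /ball /= sub0r normrN gtr0_norm // /t gt_min; apply/orP; right; lra.
Qed.

Variable T : {set V}.
Hypothesis nT : nondeg T.
Hypothesis n0 : pn L T != 0.
Local Notation d := (pdist L T).
Local Notation sg s := (if s then 1 else -1 : R).

Let N1 : (1 < N)%N. Proof. by case: hN => ->. Qed.

Lemma cellh_sub s : cellh L T s `<=` osimplex T.
Proof. by move=> x []. Qed.

Lemma cellhE s x : cellh L T s x <-> osimplex T x /\ 0 < sg s * peval d x.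
Proof. by rewrite /cellh /= pdistE. Qed.

Lemma closure_cellh_le s x : closure (cellh L T s) x -> 0 <= sg s * peval d x.
Proof.
move=> h; have := @closure_le _ _ (fun y => peval (- sg s * d.1, - sg s *: d.2) y)
  (cellh L T s) 0 x (@peval_continuous _ _ _).
have e y : peval (- sg s * d.1, - sg s *: d.2) y = - (sg s * peval d y).
  by rewrite /peval /= dotZl; ring.
rewrite e oppr_le0; apply=> // y /cellhE[_ h']; rewrite e oppr_le0; exact: ltW.
Qed.

(** Such a point is approached along the segment to the barycenter. Strict positivity at one end
    keeps d of the right sign near x. *)
Lemma cellh_closure s x : csimplex T x -> 0 <= sg s * peval d x ->
  0 < sg s * peval d x \/ 0 < sg s * peval d (bary T) -> closure (cellh L T s) x.
Proof.
move=> xT dx h; set a := sg s * peval d x in dx h; set b := sg s * peval d (bary T) in h.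
have [e e0 [e1 he]] : exists2 e : R, 0 < e & e <= 1 /\ forall t, 0 < t -> t < e -> 0 < (1 - t) * a + t * b.
  case: h => [a0|b0].
    exists (a / (a + `|b| + 1)); first by rewrite divr_gt0 // ltr_wpDl // addr_ge0 // ltW.
    have c0 : 0 < a + `|b| + 1 by rewrite ltr_wpDl // addr_ge0 // ltW.
    have b0 : 0 <= `|b| by [].
    split; first by rewrite ler_pdivrMr //; lra.
    move=> t t0; rewrite ltr_pdivlMr // => h; have := ler_norm (- b); rewrite normrN => hb.
    have : 0 <= t * (`|b| + b) by rewrite mulr_ge0 ?(ltW t0) //; lra.
    by nra.
  exists 1; first exact: ltr01.
  by split=> // t t0 t1; nra.
apply: (segment_closure (y := bary T) e0) => t t0 te; apply/cellhE; split.
  apply: (segment_osimplex nT) => //; last by rewrite ltW // (lt_le_trans te).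
  by apply: (osimplex_bary nT) => //; rewrite nT.1.
by rewrite peval_conv; have := he t t0 te; rewrite /a /b; nra.
Qed.

Variable a : V.
Hypothesis aT : a \in T.
Local Notation F := (T :\ a).
Let FT : F \subset T := subD1set T a.
Let cF : #|F| = N := card_facet nT aT.
Let F0 : (0 < #|F|)%N. Proof. by rewrite cF ltnW. Qed.

Lemma face_csimplex x : osimplex F x -> csimplex T x.
Proof. by move=> h; apply: (csimplex_sub nT FT); apply: osimplex_csimplex. Qed.

Lemma bd_cellh_face s x : osimplex F x -> bd (cellh L T s) x <-> closure (cellh L T s) x.
Proof.
move=> hx; rewrite /bd; split=> [[]//|h]; split=> // /interior_subset/cellh_sub.
move=> /(osimplexT nT) /(_ a aT); have [_ /(_ a aT)] := (osimplexP nT x FT).1 hx.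
by rewrite !inE eqxx => -> //; rewrite ltxx.
Qed.

Lemma snice_bd_peval s q : snice (m := m) F (fun x => \1_(bd (cellh L T s)) x * peval q x).
Proof.
apply: rniceM; last exact: snice_peval.
apply: (@rniceI _ _ _ 1) => [|y _]; last by rewrite indicE; case: (_ \in _); rewrite ?normr1 ?normr0.
have ms : rvmset (bd (cellh L T s)).
  rewrite /bd setDE; apply: rvmsetI; first exact/rvmset_closed/closed_closure.
  exact/rvmsetC/rvmset_open/open_interior.
have := rvmset_indic (rvmset_comp ms (fun i => @rvmeas_spar _ _ m F i)).
by congr rvmeas; apply/funext => y; rewrite !indicE /preimage; congr (_ %:R); apply/idP/idP; rewrite !inE.
Qed.

Lemma peval_zero_face q : (forall y, osimplex F y -> peval q y = 0) ->
  forall y, peval q y = peval (lam T a) y * peval q (pt m a).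
Proof.
move=> hq y; rewrite (peval_lam nT) (bigD1 a) //= big1 ?addr0 // => v /andP[vT va].
have vF : v \in F by rewrite !inE va.
have cl : closure (osimplex F) (pt m v).
  apply: (segment_closure (y := bary F) ltr01) => t t0 t1.
  have lF w : w \in T -> peval (lam T w) (bary F) = if w \in F then #|F|%:R^-1 else 0.
    by move=> wT; rewrite (lam_baryc nT).
  apply/(osimplexP nT _ FT); split=> w; last first.
    move=> wT wnF; rewrite peval_conv lF // (negPf wnF) (lam_vert nT) //.
    have -> : (v == w) = false by apply/eqP => e; move: wnF; rewrite -e vF.
    by rewrite subrr mulr0 addr0.
  move=> wF; have wT := fintype.subsetP FT _ wF.
  rewrite peval_conv lF // wF (lam_vert nT) //.
  have h1 : 0 < (#|F|%:R^-1 : R) by rewrite invr_gt0 ltr0n.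
  have h2 : 0 <= ((v == w)%:R : R) by [].
  by move: h1 h2; move: (_^-1) ((v == w)%:R) => u w' *; nra.
apply/eqP; rewrite mulf_eq0; apply/orP; right; rewrite eq_le.
have nE w : peval (- q.1, - q.2) w = - peval q w by rewrite /peval /= dotNl; ring.
have h1 : peval q (pt m v) <= 0.
  by apply: (closure_le (@peval_continuous _ _ q) _ cl) => w /hq ->.
have h2 : peval (- q.1, - q.2) (pt m v) <= 0.
  by apply: (closure_le (@peval_continuous _ _ (- q.1, - q.2)) _ cl) => w /hq e; rewrite nE e oppr0.
by rewrite h1 /=; move: h2; rewrite nE oppr_le0.
Qed.

Lemma cellh_trace z al x : (forall y, peval (z true) y = peval (z false) y + al * peval d y) ->
  osimplex F x -> peval d x != 0 \/ (forall y, osimplex F y -> peval d y = 0) ->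
  \1_(bd (cellh L T true)) x * peval (z true) x + \1_(bd (cellh L T false)) x * peval (z false) x =
  peval (z false) x + al * posp (peval d x).
Proof.
move=> hz hx hd; have xT := face_csimplex hx.
have ind s : \1_(bd (cellh L T s)) x = (`[< closure (cellh L T s) x >]%:R : R).
  rewrite indicE; congr (_%:R); congr nat_of_bool; apply/idP/asboolP.
    by move=> /set_mem/(bd_cellh_face s hx).
  by move=> /(bd_cellh_face s hx)/mem_set.
have one s : closure (cellh L T s) x -> \1_(bd (cellh L T s)) x = 1 :> R.
  by move=> h; rewrite ind asboolT.
have zer s : ~ closure (cellh L T s) x -> \1_(bd (cellh L T s)) x = 0 :> R.
  by move=> h; rewrite ind asboolF.
have pos s : 0 < sg s * peval d x -> closure (cellh L T s) x /\ ~ closure (cellh L T (~~ s)) x.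
  move=> h; split; first by apply: cellh_closure => //; [exact: ltW|left].
  by move=> /closure_cellh_le; case: s h => /=; lra.
have [dp|dn|d0] := ltgtP 0 (peval d x).
- have [h1 h2] := pos true (ltac:(by rewrite /= mul1r)).
  by rewrite one // (zer false) // posp_id ?(ltW dp) // hz; ring.
- have [h1 h2] := pos false (ltac:(rewrite /=; lra)).
  by rewrite (one false) // (zer true) // posp_0 ?(ltW dn) //; ring.
case: hd => [|hd]; first by rewrite -d0 eqxx.
rewrite hz -d0 posp_0 // !mulr0 addr0.
suff [s [h1 h2]] : exists s, closure (cellh L T s) x /\ ~ closure (cellh L T (~~ s)) x.
  by case: s h1 h2 => h1 h2; [rewrite (one true) // (zer false) //|rewrite (one false) // (zer true) //]; ring.
(* The plane contains the face, so d is a nonzero multiple of the coordinate of the opposite vertex: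
   T lies strictly on one side of the plane, and only that side has the face in its closure. *)
have dl := peval_zero_face hd.
have da : peval d (pt m a) != 0.
  apply/negP => /eqP da; have d0' y : peval d y = 0 by rewrite dl da mulr0.
  move/eqP: n0; apply; apply/eqP; rewrite -dot_eq0.
  by have := pevalB d (pn L T) 0; rewrite !d0' subrr subr0 => <-.
suff emp s : 0 < sg s * peval d (pt m a) -> closure (cellh L T s) x /\ ~ closure (cellh L T (~~ s)) x.
  have [dp|dn|e] := ltgtP 0 (peval d (pt m a)); last by rewrite e eqxx in da.
    by exists true; apply: emp; rewrite mul1r.
  by exists false; apply: emp; rewrite mulN1r oppr_gt0.
move=> h; split.
  apply: cellh_closure => //; first by rewrite -d0 mulr0.
  right; rewrite dl (lam_baryc nT) // ?nT.1 // aT mulrCA.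
  by rewrite mulr_gt0 // invr_gt0 ltr0n.
move=> /(_ setT filterT)[y [/cellhE[yT hy] _]].
have := (osimplexT nT y).1 yT a aT; move: hy; rewrite dl.
by case: s h => /= h; nra.
Qed.

Lemma face_vertex_zero q : peval q (svert F)`_0 = 0 -> q.2 *m (sedge F)^T = 0 ->
  forall x, osimplex F x -> peval q x = 0.
Proof.
move=> c0 e0 x [l [_ l1 ->]]; rewrite peval_comb //; apply: big1 => v vF.
rewrite (pt_svert vF); have : (index v (enum F) < #|F|)%N by rewrite cardE index_mem mem_enum.
case: (index _ _) => [|i] hi; first by rewrite c0 mulr0.
have hi' : (i < #|F|.-1)%N by rewrite -ltnS prednK.
have := sedge_dot q (Ordinal hi'); rewrite e0 mxE c0 subr0 /= => <-; exact: mulr0.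
Qed.

(** Either d vanishes on the face, or its zeros are negligible by [rint_hyperplane]; in both cases
    the split average is that of the - polynomial plus al d^+. *)
Lemma Mface_val z al : (forall y, peval (z true) y = peval (z false) y + al * peval d y) ->
  Mface L F T z = peval (z false) (bary F) + al * apos T d a.
Proof.
move=> hz; have sm : smeas (m := m) F != 0 by rewrite gt_eqF // smeas_face_gt0.
have sc : #|F| = 2%N \/ #|F| = 3%N by case: hN => e; [left|right]; rewrite -[RHS]e.
rewrite -(savg_peval _ sm sc) /apos /savg.
transitivity ((smeas F)^-1 * (sint F (peval (z false)) + al * sint F (fun x => posp (peval d x)))); last by ring.
rewrite /Mface; congr (_ * _).
rewrite -sintD; try exact: snice_bd_peval.
have np := snice_posp (m := m) F d.
rewrite -(sintZ _ np) -(sintD (snice_peval _ _) (rniceZ _ np)) !sintE; congr (_ * _).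
have [e0|ne0] := boolP ((peval d (svert F)`_0 == 0) && (d.2 *m (sedge F)^T == 0)).
  have /andP[/eqP c0 /eqP e0'] := e0.
  apply: rint_eq => y hy; apply: cellh_trace => //; first exact: spar_osimplex.
  by right; apply: face_vertex_zero.
apply: (@rint_hyperplane _ _ _ _ (peval d (svert F)`_0) (d.2 *m (sedge F)^T)).
- by apply: rniceD; apply: snice_bd_peval.
- by apply: rniceD; [exact: snice_peval|apply: rniceZ].
- by rewrite -negb_and.
move=> y hy h; apply: cellh_trace => //; first exact: spar_osimplex.
by left; rewrite peval_spar dotC.
Qed.

Lemma Mface_true z al : (forall y, peval (z true) y = peval (z false) y + al * peval d y) ->
  (forall x, osimplex F x -> 0 <= peval d x) ->
  Mface L F T z = peval (z true) (bary F).
Proof.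
move=> hz hd; have sm : smeas (m := m) F != 0 by rewrite gt_eqF // smeas_face_gt0.
have sc : #|F| = 2%N \/ #|F| = 3%N by case: hN => e; [left|right]; rewrite -[RHS]e.
rewrite (Mface_val hz) hz; congr (_ + _ * _).
rewrite -(savg_peval _ sm sc) /apos /savg; congr (_ * _).
by apply: sint_eq => // x /hd; exact: posp_id.
Qed.

End FaceTraces.

(** * Comparison with the Crouzeix-Raviart interpolant on a cut element *)

Section LocalInterpolation.
Variables (R : realType) (N : nat) (P : interface_problem R N) (mu : R).
Variables (m : mesh R N) (L : planes m).
Hypothesis hN : N = 2%N \/ N = 3%N.
Local Notation V := 'I_(nvert m).
Implicit Types (S F : {set V}) (q r : P1 R N) (x y g n : 'rV[R]_N) (z : bool -> P1 R N).

Variable T : {set V}.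
Hypothesis nT : nondeg T.
Hypothesis iT : T \in itf_cells P m.
Hypothesis hn : enorm (pn L T) = 1.
Hypothesis htt : forall i j, dot (ptan L T i) (ptan L T j) = (i == j)%:R.
Hypothesis htn : forall i, dot (ptan L T i) (pn L T) = 0.
Hypothesis mu0 : 0 < mu.
Variables (bm bM : R).
Hypotheses (bm0 : 0 < bm) (bM0 : 0 < bM).
Hypothesis hB : forall s u, bm * enorm u ^+ 2 <=
  dot (mulmv (coefT P L T s) u) u <= bM * enorm u ^+ 2.
Hypothesis hBb : forall s u v,
  `|dot (mulmv (coefT P L T s) u) v| <= bM * enorm u * enorm v.
Variable kap : R.
Hypothesis hkap : forall x, csimplex T x -> `|peval (pdist L T) x| <= kap * Defs.hT T.

Local Notation d := (pdist L T).
Local Notation nrmT := (pn L T).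
Local Notation nbn := (nbn P L T).
Local Notation fluxjump := (fluxjump P L T).

Let N1 : (1 < N)%N. Proof. by case: hN => ->. Qed.
Let n0 : pn L T != 0. Proof. by rewrite -enorm_eq0 hn oner_eq0. Qed.
Let smF a : a \in T -> smeas (m := m) (T :\ a) != 0.
Proof. by move=> aT; rewrite gt_eqF // smeas_face_gt0. Qed.
Let VTP := VT_itfP hN nT hn htt htn mu0 (P := P).
Let nbnb : forall s, bm <= nbn s <= bM := nbn_bounds hn hB.

Definition crdof z : P1 R N := crp T (fun a => dofT P L (T :\ a) T z).

Lemma apos_ge0_le a : a \in T -> 0 <= apos T d a <= kap * Defs.hT T.
Proof.
move=> aT; have F0 : (0 < #|T :\ a|)%N by rewrite (card_facet nT aT) ltnW.
have sp : 0 < smeas (m := m) (T :\ a) by exact: smeas_face_gt0.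
have sn := snice_posp (m := m) (T :\ a) d.
rewrite /apos /savg mulrC; apply/andP; split.
  rewrite divr_ge0 ?(ltW sp) //.
  rewrite -[X in X <= _](mul0r (smeas (T :\ a))) -sint_cst; apply: le_sint => //; first exact: snice_cst.
  by move=> x _; case: (posp_case (peval d x)) => -[? ->].
rewrite ler_pdivrMr // -sint_cst; apply: le_sint => //; first exact: snice_cst.
move=> x hx; have xT : csimplex T x.
  by apply: (csimplex_sub nT (subD1set T a)); apply: osimplex_csimplex.
have := hkap xT; case: (posp_case (peval d x)) => -[h ->].
  by rewrite ger0_norm.
by apply: le_trans; exact: normr_ge0.
Qed.

Lemma crp_apos_bound th x : 0 <= th <= 1 -> (crp T (apos T d)).2 = th *: d.2 ->
  csimplex T x -> `|peval (crp T (apos T d)) x| <= (kap + 1) * Defs.hT T.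
Proof.
move=> /andP[t0 t1] hth xT.
have [a aT] : exists a, a \in T by apply/card_gt0P; rewrite nT.1.
have /andP[h1 h2] := apos_ge0_le aT.
have e := pevalB (crp T (apos T d)) x (bary (T :\ a)).
rewrite (crp_facet hN _ nT aT) hth dotZl in e.
have bT : csimplex T (bary (T :\ a)).
  apply: (csimplex_sub nT (subD1set T a)); apply: osimplex_csimplex.
  by apply: (osimplex_bary nT (subD1set T a)); rewrite (card_facet nT aT) ltnW.
have hd := hT_csimplex nT xT bT.
have cs := dot_cs d.2 (x - bary (T :\ a)); rewrite /= hn mul1r in cs.
have -> : peval (crp T (apos T d)) x = apos T d a + th * dot d.2 (x - bary (T :\ a)) by lra.
apply: (le_trans (ler_normD _ _)); rewrite (ger0_norm h1) mulrDl mul1r lerD //.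
by rewrite normrM (ger0_norm t0) -[leRHS]mul1r ler_pM // (le_trans cs).
Qed.

(** Interpolation is linear and reproduces affine functions, so only d^+ is changed by it. *)
Lemma crdofE z al : (forall y, peval (z true) y = peval (z false) y + al * peval d y) ->
  forall x, peval (crdof z) x = peval (z false) x + al * peval (crp T (apos T d)) x.
Proof.
move=> hz x; rewrite (peval_facets hN (z false) x nT) !(peval_crp) mulr_sumr -big_split /=.
by apply: eq_bigr => a aT; rewrite /dofT iT (Mface_val hN nT n0 aT hz); ring.
Qed.

Lemma ratio_bound al p g : bm <= p -> al * p = fluxjump g ->
  `|al| <= 2 * bM / bm * enorm g.
Proof.
move=> hp e; have := fluxjump_bound hn hBb g; rewrite -e normrM => h.
have p0 : 0 < p by exact: lt_le_trans hp.
rewrite mulrAC ler_pdivlMr //; apply: le_trans h; rewrite (gtr0_norm p0).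
by rewrite ler_wpM2l.
Qed.

(** The gradients of the interpolant and of either part differ by at most |alpha|, and |alpha| is at
    most 2 bM / bm times any of them. *)
Definition ifeK : R := 1 + 2 * bM / bm.

(** The coefficient alpha solves three scalar equations: one in terms of the gradient of the
    interpolant, one for each part. Their factors, a convex combination of n.B^+n and n.B^-n or one
    of the two, are all at least bm, wherever the plane cuts. *)
Lemma ife_crdof_itf z : VT P mu L T z ->
  [/\ forall s, enorm (z s).2 <= ifeK * enorm (crdof z).2,
      forall s, enorm (crdof z).2 <= ifeK * enorm (z s).2 &
      forall s x, csimplex T x -> `|peval (z s) x - peval (crdof z) x| <=
        ifeK * (2 * kap + 1) * Defs.hT T * enorm (crdof z).2].
Proof.
move=> /(VTP z iT)[al zt hal].
have hz y : peval (z true) y = peval (z false) y + al * peval d y.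
  by rewrite zt /peval /= dotDl dotZl; ring.
have [th t01 hth] := crp_posp_grad hN d nT smF.
have /andP[t0 t1] := t01.
set pi := crdof z; set w := crp T (apos T d).
have gpi : pi.2 = (z false).2 + (al * th) *: nrmT.
  have -> : pi = ((z false).1 + al * w.1, (z false).2 + al *: w.2).
    apply: peval_inj => x; rewrite (crdofE hz) /peval /= dotDl dotZl -/w; ring.
  by change ((z false).2 + al *: (crp T (apos T d)).2 = (z false).2 + (al * th) *: nrmT); rewrite hth scalerA.
have gpi' : pi.2 = (z true).2 - (al * (1 - th)) *: nrmT.
  rewrite gpi zt /= -addrA -scalerBl; congr (_ + _ *: _); ring.
have /andP[b1 _] := nbnb true; have /andP[b2 _] := nbnb false.
have fpi : al * ((1 - th) * nbn true + th * nbn false) = fluxjump pi.2.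
  rewrite gpi fluxjumpD fluxjumpZ fluxjump_n -hal; ring.
have ft : al * nbn false = fluxjump (z true).2.
  rewrite zt /= fluxjumpD fluxjumpZ fluxjump_n -hal; ring.
have bth : bm <= (1 - th) * nbn true + th * nbn false.
  have : 0 <= (1 - th) * (nbn true - bm) by rewrite mulr_ge0 ?subr_ge0.
  have : 0 <= th * (nbn false - bm) by rewrite mulr_ge0 ?subr_ge0.
  lra.
have api : `|al| <= 2 * bM / bm * enorm pi.2 := ratio_bound bth fpi.
have aft s : `|al| <= 2 * bM / bm * enorm (z s).2.
  by case: s; [exact: (ratio_bound b2 ft)|exact: (ratio_bound b1 hal)].
have en c : `|c| <= 1 -> enorm ((al * c) *: nrmT) <= `|al|.
  by move=> hc; rewrite enormZ hn mulr1 normrM -[leRHS]mulr1 ler_wpM2l.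
have nth : `|th| <= 1 by rewrite ger0_norm.
have n1th : `|1 - th| <= 1 by rewrite ger0_norm ?subr_ge0 // lerBlDr lerDl.
split.
- move=> s; rewrite /ifeK mulrDl mul1r.
  have -> : (z s).2 = pi.2 - (if s then - (al * (1 - th)) else al * th) *: nrmT.
    case: s; first by rewrite gpi' scaleNr opprK subrK.
    by rewrite gpi addrK.
  apply: le_trans (enormB _ _) _; rewrite lerD2l; apply: le_trans api.
  by case: s; rewrite ?scaleNr ?enormN; apply: en.
- move=> s; rewrite /ifeK mulrDl mul1r; case: s.
    by rewrite gpi'; apply: le_trans (enormB _ _) _; rewrite lerD2l (le_trans (en _ n1th)).
  by rewrite gpi; apply: le_trans (enormD _ _) _; rewrite lerD2l (le_trans (en _ nth)).
move=> s x xT; rewrite (crdofE hz) -/w.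
have hw := crp_apos_bound t01 hth xT; have hd := hkap xT.
have -> : peval (z s) x - (peval (z false) x + al * peval w x) =
    al * ((if s then peval d x else 0) - peval w x) by case: s; rewrite ?hz; ring.
have kh : 0 <= kap * Defs.hT T by apply: le_trans hd; exact: normr_ge0.
rewrite normrM; have hT0 : 0 <= Defs.hT T by exact: hT_ge0.
have hh : `|(if s then peval d x else 0) - peval w x| <= (2 * kap + 1) * Defs.hT T.
  apply: le_trans (ler_normB _ _) _.
  have : `|if s then peval d x else 0| <= kap * Defs.hT T by case: s; rewrite // normr0.
  move: hw; rewrite -/w; lra.
have -> : ifeK * (2 * kap + 1) * Defs.hT T * enorm pi.2 =
   (ifeK * enorm pi.2) * ((2 * kap + 1) * Defs.hT T) by ring.
apply: ler_pM => //; apply: le_trans api _.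
by rewrite ler_wpM2r ?enorm_ge0 // /ifeK lerDr ler01.
Qed.

(** Unisolvence. The interpolant q is known from the data, the flux condition expressed through q
    determines alpha, and the - part is q minus alpha times the interpolant of d^+. *)
Lemma ife_exists_itf (f : V -> R) : exists2 z, VT P mu L T z &
  forall a, a \in T -> dofT P L (T :\ a) T z = f a.
Proof.
have [th /andP[t0 t1] hth] := crp_posp_grad hN d nT smF.
set w := crp T (apos T d) in hth; pose q := crp T f.
have /andP[b1 _] := nbnb true; have /andP[b2 _] := nbnb false.
set D := (1 - th) * nbn true + th * nbn false.
have D0 : 0 < D.
  apply: lt_le_trans bm0 _; rewrite /D.
  have : 0 <= (1 - th) * (nbn true - bm) by rewrite mulr_ge0 ?subr_ge0.
  have : 0 <= th * (nbn false - bm) by rewrite mulr_ge0 ?subr_ge0.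
  lra.
pose al := fluxjump q.2 / D.
pose z s : P1 R N := if s then ((q.1 - al * w.1) + al * d.1, (q.2 - al *: w.2) + al *: nrmT)
  else (q.1 - al * w.1, q.2 - al *: w.2).
have hz y : peval (z true) y = peval (z false) y + al * peval d y.
  by rewrite /z /peval /= dotDl dotZl; ring.
exists z.
  apply/(VTP z iT); exists al => //=.
  have -> : q.2 - al *: w.2 = q.2 + (- al * th) *: nrmT by rewrite hth scalerA -scaleNr mulNr.
  rewrite fluxjumpD fluxjumpZ fluxjump_n.
  have -> : fluxjump q.2 = al * D by rewrite /al divfK // gt_eqF.
  by rewrite /D; ring.
move=> a aT; rewrite -[LHS](crp_facet hN (fun a => dofT P L (T :\ a) T z) nT aT).
rewrite -/(crdof z) (crdofE hz) -/w -[RHS](crp_facet hN f nT aT) -/q.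
by rewrite /z /peval /= dotBl dotZl; ring.
Qed.

End LocalInterpolation.

(** * The global method *)

Section MeshConstants.
Variables (R : realType) (N : nat) (P : interface_problem R N).
Hypothesis hN : N = 2%N \/ N = 3%N.
Hypothesis hP : valid_problem P.
Variables (mu sigma tau c D : R) (M : nat).
Hypothesis mu0 : 0 < mu.
Hypothesis hD : dom P `<=` cball 0 D.

Lemma inball_diam_ge0 (A : set 'rV[R]_N) : 0 <= inball_diam A.
Proof.
set B := [set d | exists c r, [/\ 0 <= r, oball c r `<=` A & d = 2 * r]].
have B0 : B 0.
  exists 0, 0; split=> //; last by rewrite mulr0.
  by move=> x /=; rewrite /oball /= ltNge enorm_ge0.
rewrite /inball_diam -/B; have [hs|hs] := pselect (has_sup B).
  exact: (ub_le_sup hs.2 B0).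
by rewrite sup_out.
Qed.

(** [kgrad] bounds h |grad lambda|; [kmeas] and [kmeas'] compare |T| with h^N from below and above;
    [kface] bounds |F| by h^(N-1). Absolute values appear because no sign is assumed for the mesh
    constants. *)
Definition kgrad : R := `|sigma| * `|tau|.
Definition kmeas : R := N`!%:R * kgrad ^+ N / rint (fun _ : 'rV[R]_N => 1).
Definition kmeas' : R := N`!%:R * rint (fun _ : 'rV[R]_N => 1).
Definition kface : R := (N.-1)`!%:R * rint (fun _ : 'rV[R]_N.-1 => 1).
(** The bound on |d| / h_T: 1 for the distance to the point of the interface in T, and c h_T <= 2
    |c| D for the distance from that point to the plane. *)
Definition kdist : R := 1 + `|c| * (2 * D).
Lemma D_ge0 : 0 <= D.
Proof.
have [[[x /hD hx] _ _] _ _ _] := hP.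
by apply: le_trans hx; exact: enorm_ge0.
Qed.

Lemma kgrad_ge0 : 0 <= kgrad. Proof. by rewrite mulr_ge0. Qed.
Lemma kmeas_ge0 : 0 <= kmeas.
Proof. by rewrite divr_ge0 ?mulr_ge0 ?exprn_ge0 ?kgrad_ge0 // ltW // rint1_gt0. Qed.
Lemma kmeas'_ge0 : 0 <= kmeas'. Proof. by rewrite mulr_ge0 // ltW // rint1_gt0. Qed.
Lemma kdist_ge0 : 0 <= kdist.
Proof. by rewrite addr_ge0 ?mulr_ge0 ?D_ge0. Qed.

Variables (m : mesh R N) (L : planes m) (o : face_orientation m).
Hypothesis adm : admissible P mu L o sigma tau c M.
Local Notation V := 'I_(nvert m).
Local Notation h := (mesh_size m).
Implicit Types (S T F : {set V}) (x : 'rV[R]_N) (a : V).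

Lemma adm_domain : polyhedral_domain (dom P). Proof. by have [] := hP. Qed.
Lemma adm_triangulation : triangulation m (dom P).
Proof. by have [[]] := adm. Qed.
Let hA := adm_domain.
Let hm := adm_triangulation.
Let N0 : (0 < N)%N := N_gt0 hN.

Lemma cell_enorm T x : T \in cells m -> csimplex T x -> enorm x <= D.
Proof.
move=> hT xT; apply: enorm_le_of_dot; first exact: D_ge0.
move=> v v1; rewrite dotC.
apply: (closure_le (@dot_continuous _ _ v) _ (cell_closure hm hT xT)) => y /hD.
by rewrite /cball /= subr0 => hy; apply: le_trans (dot_le _ _) _; rewrite v1 mul1r.
Qed.

Lemma hT_le_mesh T : T \in cells m -> hT T <= h.
Proof. by move=> hT; rewrite /mesh_size; apply: (le_bigmax_cond _ (fun T => Defs.hT T)). Qed.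

Lemma hT_le_D T : T \in cells m -> hT T <= 2 * D.
Proof.
move=> hT; apply: ge_sup.
  have [b bT] : exists b, b \in T by apply/card_gt0P; rewrite (cell_nondeg hm hT).1.
  exists 0, (bary T), (bary T); rewrite subrr enorm0; split=> //;
    by apply: (osimplex_bary (cell_nondeg hm hT)) => //; apply/card_gt0P; exists b.
move=> _ [x [y [/osimplex_csimplex hx /osimplex_csimplex hy ->]]].
apply: le_trans (enormB _ _) _.
by have := cell_enorm hT hx; have := cell_enorm hT hy; lra.
Qed.

Lemma mesh_size_le : h <= 2 * D.
Proof.
rewrite /mesh_size; apply: bigmax_le; last by move=> T; apply: hT_le_D.
by rewrite mulr_ge0 // D_ge0.
Qed.

Lemma cells_exist : exists T, T \in cells m.
Proof.
have [[x hx] _ _] := hA; have : closure (dom P) x by apply: subset_closure.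
by case: hm => _ -> _ [T hT _]; exists T.
Qed.

Lemma mesh_size_gt0 : 0 < h.
Proof.
have [T hT] := cells_exist.
by apply: lt_le_trans (hT_le_mesh hT); apply: (hT_gt0 (cell_nondeg hm hT)).
Qed.

(** Quasi-uniformity and shape regularity give h <= tau h_T <= tau sigma times the inscribed
    diameter, which [grad_lam_inball] compares with the gradient. *)
Lemma grad_lam_mesh T a : T \in cells m -> a \in T -> enorm (lam T a).2 * h <= kgrad.
Proof.
move=> hT aT; have nT := cell_nondeg hm hT.
have [[_ sr qu] _ _ _ _] := adm.
have g0 := enorm_ge0 (lam T a).2; have i0 := inball_diam_ge0 (osimplex T).
have gi := grad_lam_inball nT aT.
have hp := hT_ge0 nT.
have h1 : h <= `|tau| * Defs.hT T.
  by apply: le_trans (qu T hT) _; rewrite ler_wpM2r // ler_norm.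
have h2 : Defs.hT T <= `|sigma| * inball_diam (osimplex T).
  by apply: le_trans (sr T hT) _; rewrite ler_wpM2r // ler_norm.
have t0 := normr_ge0 tau; have s0 := normr_ge0 sigma.
have h3 : h <= kgrad * inball_diam (osimplex T).
  by apply: le_trans h1 _; rewrite /kgrad [_ * `|tau|]mulrC -mulrA ler_wpM2l.
apply: le_trans (ler_wpM2l g0 h3) _; rewrite mulrCA -[leRHS]mulr1.
by rewrite ler_wpM2l ?kgrad_ge0.
Qed.

Lemma cell_meas_ge T : T \in cells m -> h ^+ N <= kmeas * smeas T.
Proof.
move=> hT; have nT := cell_nondeg hm hT; have hp := mesh_size_gt0.
have gb a : a \in T -> enorm (lam T a).2 <= kgrad / h.
  by move=> aT; rewrite ler_pdivlMr // grad_lam_mesh.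
have k0 : 0 <= kgrad / h by rewrite divr_ge0 ?kgrad_ge0 // ltW.
have := jac_ge nT k0 gb.
rewrite (smeasE nT.1); set r := rint _.
have r0 : 0 < r by exact: rint1_gt0.
rewrite expr_div_n => e.
have -> : kmeas * (jac T * r) = h ^+ N * (N`!%:R * (kgrad ^+ N / h ^+ N) * jac T).
  have hN' : h ^+ N != 0 by rewrite expf_neq0 // gt_eqF.
  by rewrite /kmeas -/r; field; rewrite hN' gt_eqF.
by rewrite ler_pMr // exprn_gt0.
Qed.

Lemma cell_meas_le T : T \in cells m -> smeas T <= kmeas' * h ^+ N.
Proof.
move=> hT; have nT := cell_nondeg hm hT; have hp := mesh_size_gt0.
rewrite (smeasE nT.1) /kmeas' mulrAC ler_wpM2r //; first by rewrite ltW // rint1_gt0.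
have e : #|T|.-1 = N by rewrite nT.1.
have := @jac_le _ _ m T h; rewrite e; apply; first by rewrite nT.1.
  exact: ltW.
move=> a b aT bT; apply: le_trans (hT_le_mesh hT).
by apply: (hT_csimplex nT); apply: vert_csimplex.
Qed.

Lemma face_meas_le T a : T \in cells m -> a \in T -> smeas (T :\ a) <= kface * h ^+ N.-1.
Proof.
move=> hT aT; have nT := cell_nondeg hm hT; have hp := mesh_size_gt0.
have cF := card_facet nT aT.
have e : #|T :\ a|.-1 = N.-1 by rewrite cF.
have -> : smeas (T :\ a) = jac (T :\ a) * (fun k => rint (fun _ : 'rV[R]_k => 1)) #|T :\ a|.-1.
  by rewrite /smeas sintE.
rewrite e /kface mulrAC ler_wpM2r //; first by rewrite ltW // rint1_gt0.
have := @jac_le _ _ m (T :\ a) h; rewrite e; apply; first by rewrite cF.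
  exact: ltW.
move=> b b' /setD1P[_ bT] /setD1P[_ b'T]; apply: le_trans (hT_le_mesh hT).
by apply: (hT_csimplex nT); apply: vert_csimplex.
Qed.

Lemma itf_cells_sub T : T \in itf_cells P m -> T \in cells m.
Proof. by rewrite inE => /andP[]. Qed.

Lemma pdist_bound T x : T \in itf_cells P m -> csimplex T x ->
  `|peval (pdist L T) x| <= kdist * hT T.
Proof.
move=> iT xT; have hT := itf_cells_sub iT; have nT := cell_nondeg hm hT.
have [_ _ [_ vp] _ [_ a2 _ _ _]] := adm.
have [n1 _ _] := vp T iT; have [_ [xt [xtT _ _ hx]]] := a2 T iT.
rewrite pdistE; apply: le_trans (dot_cs _ _) _; rewrite n1 mulr1.
apply: le_trans (enormB_trans xt _ _) _.
have h1 := hT_csimplex nT xT (osimplex_csimplex xtT).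
have h2 : enorm (px L T - xt) <= c * Defs.hT T ^+ 2.
  apply: le_trans hx; rewrite lerDl mulr_ge0 ?enorm_ge0 //; exact: hT_ge0.
rewrite (enormBC xt) /kdist mulrDl mul1r lerD //; apply: le_trans h2 _.
have h0 := hT_ge0 nT; have hd := hT_le_D hT.
rewrite expr2 mulrA ler_wpM2r //.
by apply: le_trans (ler_wpM2r h0 (ler_norm c)) _; apply: ler_wpM2l.
Qed.

Lemma coefT_closure T s : T \in itf_cells P m ->
  closure (sub P s) (proj_itf P L T (px L T)).
Proof.
move=> iT; apply: (itf_closure hP); have [_ _ _ _ [_ _ a3 _ _]] := adm.
have hT := itf_cells_sub iT; have nT := cell_nondeg hm hT.
have [rho [hr _]] : exists! rho, smallest_shift P L T (px L T) rho.
  apply: (a3 T iT); exists (fun _ => 0); split=> [i|].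
    by rewrite lexx mulr_ge0 // ?(ltW mu0) //; exact: hT_ge0.
  by under eq_bigr do rewrite scale0r; rewrite sumr_const mul0rn addr0.
have := @xgetPex _ 0 [set rho | smallest_shift P L T (px L T) rho] (ex_intro _ rho hr).
by case.
Qed.

Variables (bm bM : R).
Hypotheses (bm0 : 0 < bm) (bM0 : 0 < bM).
Hypothesis ell : forall s x, closure (sub P s) x -> forall u,
    bm * enorm u ^+ 2 <= dot (mulmv (coef P s x) u) u <= bM * enorm u ^+ 2.

Let N1 : (1 < N)%N. Proof. by case: hN => ->. Qed.

Lemma inD_cell T : T \in cells m -> inD P T.
Proof.
move=> hT; split; first by rewrite (cell_nondeg hm hT).1.
by move=> x /osimplex_csimplex; apply: (cell_closure hm hT).
Qed.

Lemma inD_face F : F \in faces m -> inD P F.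
Proof.
move=> hF; split; last by move=> x; apply: (face_in_closure hm hF).
by have [T _ /face_sub[_ ->]] := (facesP F).1 hF.
Qed.

Lemma facet_face T a : T \in cells m -> a \in T -> T :\ a \in faces m /\ T \in star (T :\ a).
Proof.
move=> hT aT; have nT := cell_nondeg hm hT.
have hF : T :\ a \in faces_of T by rewrite inE subD1set (card_facet nT aT) eqxx.
by split; [apply/facesP; exists T|exact: star_face].
Qed.

Lemma card_face_23 (F : {set V}) : #|F| = N -> #|F| = 2%N \/ #|F| = 3%N.
Proof. by case: hN => e c1; [left|right]; rewrite c1. Qed.

Lemma sint_peval_facet T a q : T \in cells m -> a \in T ->
  sint (T :\ a) (peval q) = smeas (T :\ a) * peval q (bary (T :\ a)).
Proof.
move=> hT aT; have nT := cell_nondeg hm hT.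
have sm : smeas (T :\ a) != 0 by rewrite gt_eqF // smeas_face_gt0.
rewrite -(savg_peval q sm (card_face_23 (card_facet nT aT))) /savg.
by rewrite mulrA mulfV // mul1r.
Qed.

Lemma dofT_nonitf T a z : T \in cells m -> a \in T -> T \notin itf_cells P m ->
  dofT P L (T :\ a) T z = peval (z true) (bary (T :\ a)).
Proof.
move=> hT aT iT; rewrite /dofT (negPf iT) sint_peval_facet // mulrA mulVf ?mul1r //.
by rewrite gt_eqF // smeas_face_gt0 //; exact: (cell_nondeg hm hT).
Qed.

Lemma crdof_nonitf T z : T \in cells m -> T \notin itf_cells P m ->
  crdof P L T z = z true.
Proof.
move=> hT iT; have nT := cell_nondeg hm hT; apply: peval_inj => x.
rewrite (peval_facets hN (z true) x nT) peval_crp.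
by apply: eq_bigr => a aT; rewrite dofT_nonitf.
Qed.

Lemma coefT_ell T s u : T \in itf_cells P m ->
  bm * enorm u ^+ 2 <= dot (mulmv (coefT P L T s) u) u <= bM * enorm u ^+ 2.
Proof. by move=> iT; apply: ell; apply: coefT_closure. Qed.

Lemma coefT_bound T s u v : T \in itf_cells P m ->
  `|dot (mulmv (coefT P L T s) u) v| <= bM * enorm u * enorm v.
Proof. by move=> iT; apply: (coef_bound hP bm0 bM0 ell); apply: coefT_closure. Qed.

Definition kloc : R := ifeK bm bM.
Definition kval : R := kloc * (2 * kdist + 1).

Lemma kloc_ge1 : 1 <= kloc.
Proof. by rewrite /kloc /ifeK lerDl divr_ge0 ?mulr_ge0 ?(ltW bM0) ?(ltW bm0). Qed.

Lemma kval_ge0 : 0 <= kval.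
Proof.
by have := kloc_ge1; have := kdist_ge0 => h1 h2; rewrite mulr_ge0 //; lra.
Qed.

(** On an uncut element the function is affine and equals its interpolant, so the estimates of cut
    elements hold throughout with constants at least as large. *)
Lemma ife_crdof T z : T \in cells m -> VT P mu L T z ->
  [/\ forall s, enorm (z s).2 <= kloc * enorm (crdof P L T z).2,
      forall s, enorm (crdof P L T z).2 <= kloc * enorm (z s).2 &
      forall s x, csimplex T x -> `|peval (z s) x - peval (crdof P L T z) x| <=
        kval * h * enorm (crdof P L T z).2].
Proof.
move=> hT vz; have nT := cell_nondeg hm hT; have k1 := kloc_ge1.
have kv := kval_ge0; have h0 := mesh_size_gt0.
have [iT|iT] := boolP (T \in itf_cells P m).
  have [_ _ [_ vp] _ _] := adm; have [n1 tt tn] := vp T iT.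
  have [e1 e2 e3] := ife_crdof_itf hN nT iT n1 tt tn mu0 bm0
    (fun s u => coefT_ell s u iT) (fun s u v => coefT_bound s u v iT)
    (fun x => @pdist_bound T x iT) vz.
  split=> // s x xT; apply: le_trans (e3 s x xT) _.
  rewrite ler_wpM2r ?enorm_ge0 // ler_wpM2l //; exact: hT_le_mesh.
rewrite crdof_nonitf //; move: vz; rewrite /VT (negPf iT) => zz.
have zs s : z s = z true by case: s.
split=> [s|s|s x _]; rewrite zs; try by rewrite ler_peMl ?enorm_ge0.
by rewrite subrr normr0; exact: mulr_ge0 (mulr_ge0 kv (ltW h0)) (enorm_ge0 _).
Qed.

Lemma ife_exists T (f : V -> R) : T \in cells m -> exists2 z, VT P mu L T z &
  forall a, a \in T -> dofT P L (T :\ a) T z = f a.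
Proof.
move=> hT; have nT := cell_nondeg hm hT.
have [iT|iT] := boolP (T \in itf_cells P m).
  have [_ _ [_ vp] _ _] := adm; have [n1 tt tn] := vp T iT.
  exact: (ife_exists_itf hN nT iT n1 tt tn mu0 bm0
    (fun s u => coefT_ell s u iT)).
exists (fun _ => crp T f); first by rewrite /VT (negPf iT).
by move=> a aT; rewrite dofT_nonitf // crp_facet.
Qed.

(** * Linearity of the local space and of its degrees of freedom *)

Section Combination.
Variables (I : Type) (r : seq I) (x : I -> R).

Definition combP1 (q : I -> P1 R N) : P1 R N :=
  (\sum_(i <- r) x i * (q i).1, \sum_(i <- r) x i *: (q i).2).

Lemma peval_combP1 q y : peval (combP1 q) y = \sum_(i <- r) x i * peval (q i) y.
Proof.
rewrite /peval /combP1 /= dot_suml -big_split /=; apply: eq_bigr => i _.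
by rewrite dotZl mulrDr.
Qed.

Lemma VT_comb T (z : I -> bool -> P1 R N) : (forall i, VT P mu L T (z i)) ->
  VT P mu L T (fun s => combP1 (fun i => z i s)).
Proof.
move=> hz; have jp y : (forall i, Jpoint y (z i) = 0) -> Jpoint y (fun s => combP1 (fun i => z i s)) = 0.
  move=> h0; rewrite /Jpoint !peval_combP1 -sumrB big1 // => i _.
  by rewrite -mulrBr -/(Jpoint y (z i)) h0 mulr0.
rewrite /VT; case: ifP => iT; last first.
  congr pair; apply: eq_bigr => i _; have := hz i; rewrite /VT iT => ->; by [].
have hz' i : [/\ Jpoint (px L T) (z i) = 0, forall j, Jpoint (xbar mu L T j) (z i) = 0 &
    Jflux P L T (z i) = 0] by have := hz i; rewrite /VT iT.
split=> [|j|].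
- by apply: jp => i; have [] := hz' i.
- by apply: jp => i; have [] := hz' i.
rewrite /Jflux /= !dot_mulmv !dot_suml -sumrB big1 // => i _.
have [_ _] := hz' i; rewrite /Jflux !dot_mulmv => e.
by rewrite !dotZl -mulrBr e mulr0.
Qed.

(** Linearity is read off [Mface_val], where alpha is the normal component of the gradient jump and
    hence linear in the function. *)
Lemma dofT_comb T a (z : I -> bool -> P1 R N) : T \in cells m -> a \in T ->
  (forall i, VT P mu L T (z i)) ->
  dofT P L (T :\ a) T (fun s => combP1 (fun i => z i s)) =
  \sum_(i <- r) x i * dofT P L (T :\ a) T (z i).
Proof.
move=> hT aT hz; have nT := cell_nondeg hm hT.
have [iT|iT] := boolP (T \in itf_cells P m); last first.
  by rewrite dofT_nonitf // peval_combP1; apply: eq_bigr => i _; rewrite dofT_nonitf.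
have [_ _ [_ vp] _ _] := adm; have [n1 tt tn] := vp T iT.
have n0 : pn L T != 0 by rewrite -enorm_eq0 n1 oner_eq0.
have VTP := VT_itfP hN nT n1 tt tn mu0 (P := P).
have alE w : VT P mu L T w -> forall y, peval (w true) y = peval (w false) y +
    dot ((w true).2 - (w false).2) (pn L T) * peval (pdist L T) y.
  move=> /(VTP w iT)[al wt _] y; have e : (w true).2 - (w false).2 = al *: pn L T by rewrite wt addrC addKr.
  rewrite e wt dotZl -enorm_sq n1; by rewrite expr1n mulr1 /peval /= dotDl dotZl; ring.
have dE w : VT P mu L T w -> dofT P L (T :\ a) T w = peval (w false) (bary (T :\ a)) +
    dot ((w true).2 - (w false).2) (pn L T) * apos T (pdist L T) a.
  by move=> vw; rewrite /dofT iT (Mface_val hN nT n0 aT (alE w vw)).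
rewrite (dE _ (VT_comb hz)) peval_combP1 /= -sumrB dot_suml mulr_suml -big_split /=.
apply: eq_bigr => i _; rewrite dE // -scalerBr dotZl; ring.
Qed.

End Combination.

Lemma crdof_eq T z f : T \in cells m -> (forall a, a \in T -> dofT P L (T :\ a) T z = f a) ->
  crdof P L T z = crp T f.
Proof.
move=> hT hf; apply: peval_inj => x; rewrite !peval_crp; apply: eq_bigr => a aT.
by rewrite hf.
Qed.

Lemma int_face_star F : F \in int_faces m ->
  [/\ fc1 o F != fc2 o F, fc1 o F \in star F & fc2 o F \in star F].
Proof.
move=> hF; have [_ /(_ F hF)[sF _ _ _]] : valid_orientation o by have [_ ] := adm.
have : #|star F| = 2%N by move: hF; rewrite inE => /andP[_ /eqP].
rewrite sF cards2; case: eqP => // ne _.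
by split; rewrite ?sF ?inE ?eqxx ?orbT //; apply/eqP.
Qed.

Lemma bnd_face_star F : F \in bnd_faces m -> star F = [set fc1 o F]%SET.
Proof. by move=> hF; have [/(_ F hF)] : valid_orientation o by have [_ ] := adm. Qed.

Lemma int_face_starE F : F \in int_faces m -> star F = [set fc1 o F; fc2 o F]%SET.
Proof. by move=> hF; have [_ /(_ F hF)[]] : valid_orientation o by have [_ ] := adm. Qed.

Lemma star_facet T F : F \in faces m -> T \in star F ->
  T \in cells m /\ exists2 a, a \in T & F = T :\ a.
Proof.
move=> hF TF; have [hT _ [a [aT aF eT]]] := starP hm hF TF; split=> //.
by exists a => //; rewrite [in RHS]eT setU1K.
Qed.

Lemma int_face_faces F : F \in int_faces m -> F \in faces m.
Proof. by rewrite inE => /andP[]. Qed.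

Lemma bnd_face_faces F : F \in bnd_faces m -> F \in faces m.
Proof. by rewrite inE => /andP[]. Qed.

Lemma bnd_face_side F x : F \in bnd_faces m -> osimplex F x -> side P x = true.
Proof.
move=> bF hx; apply: (side_outside hP).
  exact: (face_in_closure hm (bnd_face_faces bF) hx).
exact: (bnd_face_not_dom hA hm bF hx).
Qed.

Lemma bnd_face_uncut F : F \in bnd_faces m -> ~~ Defs.cut P F.
Proof.
move=> bF; apply/asboolPn => -[x [hx /(itf_dom hP)]].
exact: (bnd_face_not_dom hA hm bF hx).
Qed.

(** A boundary face lies outside the open domain, is not cut, and adheres to the + part of T. By
    [consistent_sides] it is on the + side of the plane, so its average involves the + polynomial
    alone, as does the true trace. *)
Lemma dofT_bnd F a T z : F \in bnd_faces m -> T \in cells m -> a \in T -> F = T :\ a ->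
  VT P mu L T z -> dofT P L F T z = peval (z true) (bary F).
Proof.
move=> bF hT aT eF vz; have nT := cell_nondeg hm hT.
have [iT|iT] := boolP (T \in itf_cells P m); last by rewrite eF dofT_nonitf.
have [_ _ [_ vp] cs _] := adm; have [n1 tt tn] := vp T iT.
have n0 : pn L T != 0 by rewrite -enorm_eq0 n1 oner_eq0.
have [al zt _] := (VT_itfP hN nT n1 tt tn mu0 z iT).1 vz.
have hz y : peval (z true) y = peval (z false) y + al * peval (pdist L T) y.
  by rewrite zt /peval /= dotDl dotZl; ring.
have FT : F \in faces_of T by rewrite eF inE subD1set (card_facet nT aT) eqxx.
have Fsub : F \subset T by rewrite eF subD1set.
rewrite /dofT iT eF (Mface_true hN nT n0 aT hz) // => x; rewrite -eF => hx.
have bdp : osimplex F `<=` bd (cellpart P T true).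
  move=> y hy; have yT : csimplex T y by apply: (csimplex_sub nT Fsub); apply: osimplex_csimplex.
  have nyD := bnd_face_not_dom hA hm bF hy.
  split; last first.
    move=> /interior_subset[/(osimplexT nT)/(_ a aT)].
    have [_ /(_ a aT)] := (osimplexP nT y Fsub).1 hy.
    by rewrite eF !inE eqxx => -> //; rewrite ltxx.
  move=> B yB.
  (* Near a boundary point of the domain there is no - part, so the points of T close to y belong to
     the + part. *)
  have oC : nbhs y (~` closure (sub P false)).
    by apply: open_nbhs_nbhs; split; [exact: closed_openC (@closed_closure _ _)|move=> /(closure_sub_false hP)].
  have cT : closure (osimplex T) y.
    apply: (segment_closure (y := bary T) ltr01) => t t0 t1.
    apply: (segment_osimplex nT) => //; last exact: ltW.
    by apply: (osimplex_bary nT) => //; rewrite nT.1.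
  have [w [wT [wB wC]]] := cT _ (filterI yB oC).
  exists w; split=> //; split=> //.
  have [_ [_ _ _ ->] _ _] := hP; split=> //; exact: (osimplex_dom hA hm hT wT).
have := cs T iT F FT (bnd_face_uncut bF) true bdp x hx => -[cl _].
by have := closure_cellh_le cl; rewrite mul1r.
Qed.

Lemma sint_bnd F (v : bfun m) : F \in bnd_faces m -> VT P mu L (fc1 o F) (v (fc1 o F)) ->
  sint F (bval P v (fc1 o F)) = smeas F * dofT P L F (fc1 o F) (v (fc1 o F)).
Proof.
move=> bF vv; have hF := bnd_face_faces bF.
have sF : fc1 o F \in star F by rewrite (bnd_face_star bF) set11.
have [hT [a aT eF]] := star_facet hF sF.
have e := sint_peval_facet (v (fc1 o F) true) hT aT; rewrite -eF in e.
rewrite (dofT_bnd bF hT aT eF vv) -e.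
apply: sint_eq; first by case: (inD_face hF).
by move=> x hx; rewrite /bval (bnd_face_side bF hx).
Qed.

Local Notation phi := (ife_basis P mu L o).
Local Notation ND := (ndof m).

Lemma bnd_not_int F : F \in bnd_faces m -> F \notin int_faces m.
Proof. by rewrite !inE => /andP[_ /eqP ->]; rewrite andbF. Qed.

Lemma face_cases F : F \in faces m -> F \in int_faces m \/ F \in bnd_faces m.
Proof. exact: (star_le2 N0 hm). Qed.

(** Local functions with the prescribed face values match across interior faces by construction, and
    on boundary faces the vanishing degree of freedom is the vanishing integral. *)
Lemma Vh0_of_dofs (f : {set V} -> R) : (forall F, F \in bnd_faces m -> f F = 0) ->
  exists v : bfun m, Vh0 P mu L o v /\
    forall T a, T \in cells m -> a \in T -> dofT P L (T :\ a) T (v T) = f (T :\ a).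
Proof.
move=> f0.
have ex T : exists z, T \in cells m -> VT P mu L T z /\
    forall a, a \in T -> dofT P L (T :\ a) T z = f (T :\ a).
  have [hT|hT] := boolP (T \in cells m); last by exists (fun _ => (0, 0)).
  by have [z vz hz] := ife_exists (fun a => f (T :\ a)) hT; exists z.
pose v T := projT1 (cid (ex T)).
have hv T : T \in cells m -> VT P mu L T (v T) /\
    forall a, a \in T -> dofT P L (T :\ a) T (v T) = f (T :\ a) by rewrite /v; case: cid.
have hd F T : F \in faces m -> T \in star F -> dofT P L F T (v T) = f F.
  move=> hF sT; have [hT [a aT ->]] := star_facet hF sT; exact: (hv T hT).2.
exists v; split; last by move=> T a hT; apply: (hv T hT).2.
split.
  split; first by move=> T hT; exact: (hv T hT).1.
  move=> F iF; have [_ s1 s2] := int_face_star iF.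
  by rewrite !hd // ?int_face_faces.
move=> F bF; have hF := bnd_face_faces bF.
have s1 : fc1 o F \in star F by rewrite bnd_face_star // set11.
have [hT _] := star_facet hF s1.
by rewrite sint_bnd //; [rewrite hd // f0 // mulr0|exact: (hv _ hT).1].
Qed.

Lemma basis_spec i : Vh0 P mu L o (phi i) /\ forall F, F \in int_faces m ->
  dofT P L F (fc1 o F) (phi i (fc1 o F)) = (F == enum_val i)%:R.
Proof.
have [|v [v0 hv]] := @Vh0_of_dofs (fun F => (F == enum_val i)%:R).
  move=> F bF; case: eqP => // e.
  by have := bnd_not_int bF; rewrite e enum_valP.
rewrite /ife_basis; case: xgetP => [w _ //|/(_ v) []].
split=> // F iF; have [_ s1 _] := int_face_star iF.
by have [hT [a aT eF]] := star_facet (int_face_faces iF) s1; rewrite {1 4}eF hv // -eF.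
Qed.

Lemma basis_VT i T : T \in cells m -> VT P mu L T (phi i T).
Proof. by have [[[h _] _] _] := basis_spec i; apply: h. Qed.

Lemma basis_dof i T a : T \in cells m -> a \in T ->
  dofT P L (T :\ a) T (phi i T) = (T :\ a == enum_val i)%:R.
Proof.
move=> hT aT; have [hF sT] := facet_face hT aT.
have sm : smeas (T :\ a) != 0 by rewrite gt_eqF // smeas_face_gt0 //; exact: (cell_nondeg hm hT).
have [[[hv hi] hb] hd] := basis_spec i.
move: hF sT sm; move: (T :\ a) => F hF sT sm.
have [iF|bF] := face_cases hF.
  move: sT; rewrite (int_face_starE iF) !inE => /orP[/eqP e|/eqP e].
    by rewrite e hd.
  by rewrite e -hi // hd.
have e1 : T = fc1 o F by move: sT; rewrite (bnd_face_star bF) inE => /eqP.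
have := hb _ bF; rewrite sint_bnd -?e1 //; last exact: hv.
move=> /eqP; rewrite mulf_eq0 (negPf sm) /= => /eqP ->.
case: eqP => // e; have := bnd_not_int bF; by rewrite e enum_valP.
Qed.

(* The degree of freedom on F of the function with coefficient vector x, extended
   by zero to the boundary faces. *)
Definition fval (x : 'rV[R]_ND) (F : {set V}) : R := \sum_i x 0 i * (F == enum_val i)%:R.

Lemma fval_bnd (x : 'rV[R]_ND) F : F \in bnd_faces m -> fval x F = 0.
Proof.
move=> bF; rewrite /fval big1 // => i _; case: eqP; rewrite ?mulr0 // => e.
by have := bnd_not_int bF; rewrite e enum_valP.
Qed.

Lemma fval_enum (x : 'rV[R]_ND) i : fval x (enum_val i) = x 0 i.
Proof.
rewrite /fval (bigD1 i) //= eqxx mulr1 big1 ?addr0 // => j ji.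
by case: eqP => [/enum_val_inj e|]; rewrite ?mulr0 //; move: ji; rewrite e eqxx.
Qed.

Lemma enorm_fval (x : 'rV[R]_ND) : enorm x ^+ 2 = \sum_(F in int_faces m) fval x F ^+ 2.
Proof.
rewrite enorm_sq dotE [RHS]big_enum_val; apply: eq_bigr => i _.
by rewrite fval_enum expr2.
Qed.

Definition vcomb (x : 'rV[R]_ND) : bfun m :=
  fun T s => combP1 (index_enum 'I_ND) (fun i => x 0 i) (fun i => phi i T s).

Lemma vcomb_VT (x : 'rV[R]_ND) T : T \in cells m -> VT P mu L T (vcomb x T).
Proof. by move=> hT; apply: VT_comb => i; apply: basis_VT. Qed.

Lemma vcomb_dof (x : 'rV[R]_ND) T a : T \in cells m -> a \in T ->
  dofT P L (T :\ a) T (vcomb x T) = fval x (T :\ a).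
Proof.
move=> hT aT; rewrite dofT_comb //; last by move=> i; apply: basis_VT.
by apply: eq_bigr => i _; rewrite basis_dof.
Qed.

Definition interp (f : {set V} -> R) (T : {set V}) : P1 R N := crp T (fun a => f (T :\ a)).

Lemma interp_facet f T a : T \in cells m -> a \in T ->
  peval (interp f T) (bary (T :\ a)) = f (T :\ a).
Proof. by move=> hT aT; rewrite (crp_facet hN _ (cell_nondeg hm hT)). Qed.

(** The link between the two methods: the immersed function with coefficients x has as interpolant
    the Crouzeix-Raviart function with the same coefficients. *)
Lemma crdof_vcomb (x : 'rV[R]_ND) T : T \in cells m -> crdof P L T (vcomb x T) = interp (fval x) T.
Proof. by move=> hT; apply: crdof_eq => // a aT; apply: vcomb_dof. Qed.

Lemma crdof_basis i T : T \in cells m ->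
  crdof P L T (phi i T) = interp (fun F => (F == enum_val i)%:R) T.
Proof. by move=> hT; apply: crdof_eq => // a aT; apply: basis_dof. Qed.

Lemma interp_comb (x : 'rV[R]_ND) T : interp (fval x) T =
  combP1 (index_enum 'I_ND) (fun i => x 0 i) (fun i => interp (fun F => (F == enum_val i)%:R) T).
Proof.
apply: peval_inj => y; rewrite peval_combP1 peval_crp.
under eq_bigr do rewrite /fval mulr_suml.
rewrite exchange_big /=; apply: eq_bigr => i _.
by rewrite peval_crp mulr_sumr; apply: eq_bigr => a _; rewrite mulrA.
Qed.

(** The conditions selecting [Pihat] are satisfied by the interpolant of the face values, which also
    vanish on boundary faces. They determine the polynomial on each cell, because its facet averages
    do. *)
Lemma Pihat_basis i T s : T \in cells m ->
  Pihat P L o (phi i) T s = interp (fun F => (F == enum_val i)%:R) T.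
Proof.
move=> hT; set Q := [set w : bfun m | CR0 P o w /\
    forall T, T \in cells m ->
      if T \in itf_cells P m then
        forall F, F \in faces_of T ->
          (smeas F)^-1 * sint F (bval P w T) = dofT P L F T (phi i T)
      else w T = phi i T].
have nitf T' : T' \in cells m -> T' \notin itf_cells P m -> phi i T' true = phi i T' false.
  by move=> hT' iT'; have := basis_VT i hT'; rewrite /VT (negPf iT').
have sb (w : bfun m) T' a : T' \in cells m -> a \in T' -> w T' true = w T' false ->
    sint (T' :\ a) (bval P w T') = smeas (T' :\ a) * peval (w T' true) (bary (T' :\ a)).
  move=> hT' aT' ww; rewrite -sint_peval_facet //; apply: sint_eq.
    by case: (inD_face (facet_face hT' aT').1).
  by move=> y _; rewrite /bval; case: (side P y); rewrite ?ww.
have [[cr1 cr2] hw] : Q (Pihat P L o (phi i)).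
  suff [v hv] : exists v, Q v by rewrite /Pihat; case: xgetP => [w _ //|/(_ v) []].
  pose f F : R := (F == enum_val i)%:R.
  pose w T' (s' : bool) : P1 R N := interp f T'.
  have wb T' F : F \in faces m -> T' \in star F -> sint F (bval P w T') = smeas F * f F.
    move=> hF sT; have [hT' [a aT' ->]] := star_facet hF sT.
    by rewrite sb // interp_facet.
  exists w; split.
    split=> // F hF; have [iF|bF] := face_cases hF.
      have [_ s1 s2] := int_face_star iF.
      rewrite /jump iF sintB; try exact: snice_bval.
      by rewrite !wb // subrr.
    have s1 : fc1 o F \in star F by rewrite bnd_face_star // set11.
    rewrite /jump (negPf (bnd_not_int bF)) wb // /f.
    case: eqP; rewrite ?mulr0 // => e.
    by have := bnd_not_int bF; rewrite e enum_valP.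
  move=> T' hT'; case: ifP => iT'.
    move=> F hF; have nT' := cell_nondeg hm hT'.
    have sF := star_face hT' hF.
    have hFf : F \in faces m by apply/facesP; exists T'.
    have [_ [a aT' eF]] := star_facet hFf sF.
    have sm : smeas F != 0 by rewrite eF gt_eqF // smeas_face_gt0.
    by rewrite wb // mulrA mulVf // mul1r eF basis_dof.
  apply/funext => s'; rewrite /w -crdof_basis // crdof_nonitf ?iT' //.
  by case: s'; rewrite // nitf // iT'.
have hww := cr1 T hT; set w := Pihat P L o (phi i).
have -> : w T s = w T true by case: s; rewrite // -hww.
have [iT|iT] := boolP (T \in itf_cells P m); last first.
  by have := hw T hT; rewrite (negPf iT) /w => ->; rewrite -crdof_basis // crdof_nonitf.
apply: peval_inj => y; rewrite (peval_facets hN (w T true) y (cell_nondeg hm hT)) peval_crp.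
apply: eq_bigr => a aT; congr (_ * _).
have := hw T hT; rewrite iT => /(_ (T :\ a)).
have sm : smeas (T :\ a) != 0 by rewrite gt_eqF // smeas_face_gt0 //; exact: (cell_nondeg hm hT).
rewrite inE subD1set (card_facet (cell_nondeg hm hT) aT) eqxx => /(_ isT).
by rewrite basis_dof // sb // mulrA mulVf // mul1r.
Qed.

Lemma sum_cells_faces (G : {set V} -> {set V} -> R) :
  \sum_(T in cells m) \sum_(a in T) G T (T :\ a) =
  \sum_(F in faces m) \sum_(T in star F) G T F.
Proof.
transitivity (\sum_(T in cells m) \sum_(F in faces m | T \in star F) G T F).
  apply: eq_bigr => T hT; have nT := cell_nondeg hm hT.
  have -> : \sum_(F in faces m | T \in star F) G T F = \sum_(F in [set T :\ a | a in T]%SET) G T F.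
    apply: eq_bigl => F; apply/andP/imsetP => [[hF sF]|[a aT ->]].
      by have [_ [a aT e]] := star_facet hF sF; exists a.
    by have [] := facet_face hT aT.
  rewrite big_imset //= => a b aT bT e; apply/eqP; apply: contraT => ab.
  by have := setD11 a T; rewrite e !inE ab aT.
rewrite (exchange_big_dep (fun F => F \in faces m)) /=; last by move=> T F _ /andP[].
apply: eq_bigr => F hF; apply: eq_bigl => T.
by rewrite hF /=; case sF: (T \in star F); rewrite ?andbF // (star_facet hF sF).1.
Qed.

Lemma sum_star_int F (H : {set V} -> R) : F \in int_faces m ->
  \sum_(T in star F) H T = H (fc1 o F) + H (fc2 o F).
Proof.
move=> iF; have [ne _ _] := int_face_star iF; rewrite int_face_starE //.
by rewrite big_setU1 ?big_set1 // inE.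
Qed.

(** * The inverse estimate and the Poincare inequality *)

Section Dofs.
Variable f : {set V} -> R.
Hypothesis f0 : forall F, F \in bnd_faces m -> f F = 0.

Definition dofsq : R := \sum_(F in int_faces m) f F ^+ 2.
Definition energy : R := \sum_(T in cells m) smeas T * enorm (interp f T).2 ^+ 2.

Lemma sum_faces_int (H : {set V} -> R) :
  \sum_(F in faces m) H F * f F ^+ 2 = \sum_(F in int_faces m) H F * f F ^+ 2.
Proof.
rewrite (bigID (mem (int_faces m))) /= [X in _ + X]big1 ?addr0.
  apply: eq_bigl => F; case iF: (F \in int_faces m); rewrite ?andbF //.
  by rewrite int_face_faces.
move=> F /andP[hF nF]; case: (face_cases hF) => [iF|bF]; first by rewrite iF in nF.
by rewrite f0 // expr2 !mulr0.
Qed.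

Lemma sum_dofsq : \sum_(T in cells m) \sum_(a in T) f (T :\ a) ^+ 2 = 2 * dofsq.
Proof.
rewrite (sum_cells_faces (fun _ F => f F ^+ 2)).
transitivity (\sum_(F in faces m) (#|star F|)%:R * f F ^+ 2).
  by apply: eq_bigr => F _; rewrite sumr_const mulr_natl.
rewrite sum_faces_int /dofsq mulr_sumr; apply: eq_bigr => F.
by rewrite inE => /andP[_ /eqP ->].
Qed.

(* The terms of an interior face cancel by signed_volume_cancel with x = 0. *)
Lemma sum_signed_volumes :
  \sum_(T in cells m) smeas T * \sum_(a in T) peval (lam T a) 0 * f (T :\ a) ^+ 2 = 0.
Proof.
(* The set T minus F consists of the opposite vertex alone; this form depends only on the pair (T,
   F), as the regrouping by faces requires. *)
pose G T F := smeas T * (\sum_(a in T :\: F) peval (lam T a) 0) * f F ^+ 2.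
transitivity (\sum_(T in cells m) \sum_(a in T) G T (T :\ a)).
  apply: eq_bigr => T hT; rewrite mulr_sumr; apply: eq_bigr => a aT.
  rewrite /G; have -> : T :\: (T :\ a) = [set a]%SET.
    by apply/setP => v; rewrite !inE; case: eqP => [->|_]; rewrite ?aT //=; case: (v \in T).
  by rewrite big_set1 mulrA.
rewrite sum_cells_faces.
transitivity (\sum_(F in faces m) (\sum_(T in star F) smeas T * (\sum_(a in T :\: F) peval (lam T a) 0)) * f F ^+ 2).
  by apply: eq_bigr => F _; rewrite mulr_suml.
rewrite sum_faces_int big1 // => F iF.
rewrite sum_star_int //; have [ne s1 s2] := int_face_star iF; have hF := int_face_faces iF.
have [h1 [a1 a1T e1]] := star_facet hF s1; have [h2 [a2 a2T e2]] := star_facet hF s2.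
have n1 : a1 \notin F by rewrite e1 !inE eqxx.
have n2 : a2 \notin F by rewrite e2 !inE eqxx.
have E1 : fc1 o F = (a1 |: F)%SET by rewrite -{1}(finset.setD1K a1T) -e1.
have E2 : fc2 o F = (a2 |: F)%SET by rewrite -{1}(finset.setD1K a2T) -e2.
have ne12 : a1 != a2 by apply: contra ne => /eqP e; rewrite E1 E2 e.
have cF : #|F| = N by rewrite e1 (card_facet (cell_nondeg hm h1)).
have D1 (a : V) : a \notin F -> (a |: F) :\: F = [set a]%SET.
  move=> aF; apply/setP => v; rewrite !inE; case: eqP => [->|_]; first by rewrite aF.
  by rewrite /= andNb.
rewrite E1 in h1 *; rewrite E2 in h2 *; rewrite !D1 // !big_set1.
by rewrite (signed_volume_cancel N0 hm h1 h2 cF n1 n2 ne12) mul0r.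
Qed.

(** On each cell h |grad w| <= (N + 1) N kgrad times the root of the sum of squared face values. The
    factor 2 counts each interior face twice. *)
Definition kup : R := 2 * kmeas' * (N.+1%:R * N%:R * kgrad) ^+ 2.

Lemma energy_upper : energy * h ^+ 2 <= kup * h ^+ N * dofsq.
Proof.
have h0 := mesh_size_gt0.
have -> : kup * h ^+ N * dofsq = kmeas' * h ^+ N * (N.+1%:R * N%:R * kgrad) ^+ 2 * (2 * dofsq).
  by rewrite /kup; ring.
rewrite -sum_dofsq mulr_sumr mulr_suml; apply: ler_sum => T hT.
have nT := cell_nondeg hm hT; set S := \sum_(a in T) _.
have S0 : 0 <= S by apply: sumr_ge0 => a _; exact: sqr_ge0.
have hg : enorm (interp f T).2 * h <= N.+1%:R * N%:R * kgrad * Num.sqrt S.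
  have g1 : enorm (interp f T).2 <= \sum_(a in T) N%:R * Num.sqrt S * enorm (lam T a).2.
    rewrite /interp /crp /=; elim/big_ind2: _ => [|u1 v1 u2 v2 l1 l2|a aT].
    - by rewrite enorm0.
    - by apply: le_trans (enormD _ _) (lerD l1 l2).
    rewrite enormZ ler_wpM2r ?enorm_ge0 // normrM normrN normr_nat ler_wpM2l //.
    rewrite -sqrtr_sqr ler_wsqrtr // /S (bigD1 a) //= lerDl.
    by apply: sumr_ge0 => b _; exact: sqr_ge0.
  apply: le_trans (ler_wpM2r (ltW h0) g1) _; rewrite mulr_suml.
  apply: (le_trans (y := \sum_(a in T) N%:R * Num.sqrt S * kgrad)).
    apply: ler_sum => a aT; rewrite -[X in X <= _]mulrA.
    by apply: ler_wpM2l; [rewrite mulr_ge0 ?sqrtr_ge0|exact: grad_lam_mesh].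
  by rewrite sumr_const nT.1 -[X in X <= _]mulr_natl; lra.
have hm2 := cell_meas_le hT; have s0 := smeas_ge0 T.
rewrite -mulrA -exprMn -mulrA; apply: ler_pM => //; first exact: sqr_ge0.
rewrite -[S in leRHS]sqr_sqrtr // -exprMn ler_sqr ?nnegrE //.
  by rewrite mulr_ge0 ?enorm_ge0 // ltW.
by rewrite !mulr_ge0 ?sqrtr_ge0 // kgrad_ge0.
Qed.

(** Bounds h times the sum of |lambda_a(0)|: at the barycenter each coordinate is at most 1, and the
    origin is at distance at most D, so h |lambda_a(0)| <= h + kgrad D with h <= 2 D. *)
Definition klam : R := N.+1%:R * (2 * D + kgrad * D).
Definition kpoin : R :=
  kmeas * N.+1%:R * (4 * (2 * klam ^+ 2 + 2 * D * klam) + 2 * (2 * D) ^+ 2).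

(* In the identity sum_signed_volumes the squares of the face values are expanded
   around the value at the barycenter of each cell; as the barycentric coordinates
   of the origin sum to 1 and are O(1/h), the deviations are controlled by the
   gradients. *)
Lemma poincare : h ^+ N * (2 * dofsq) <= kpoin * energy.
Proof.
have h0 := mesh_size_gt0; have hD2 := mesh_size_le; have D0 := D_ge0; have kg := kgrad_ge0.
pose W T := peval (interp f T) (bary T); pose G T := enorm (interp f T).2.
set kl := 2 * D + kgrad * D.
have kl0 : 0 <= kl by rewrite addr_ge0 ?mulr_ge0.
have klE : klam = N.+1%:R * kl by [].
have klam0 : 0 <= klam by rewrite klE mulr_ge0.
have dl T a : T \in cells m -> a \in T -> `|f (T :\ a) - W T| <= G T * h.
  move=> hT aT; have nT := cell_nondeg hm hT; rewrite -(interp_facet f hT aT) /W pevalB.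
  apply: le_trans (dot_cs _ _) _; rewrite ler_wpM2l ?enorm_ge0 //.
  apply: le_trans (hT_le_mesh hT); apply: (hT_csimplex nT).
    apply: (csimplex_sub nT (subD1set T a)); apply: osimplex_csimplex.
    by apply: (osimplex_bary nT (subD1set T a)); rewrite (card_facet nT aT).
  by apply: osimplex_csimplex; apply: (osimplex_bary nT) => //; rewrite nT.1.
have ll T a : T \in cells m -> a \in T -> `|peval (lam T a) 0| * h <= kl.
  move=> hT aT; have nT := cell_nondeg hm hT.
  have bT : csimplex T (bary T).
    by apply: osimplex_csimplex; apply: (osimplex_bary nT) => //; rewrite nT.1.
  have e := pevalB (lam T a) 0 (bary T); have /andP[l1 l2] := lam_bounds nT bT aT.
  have -> : peval (lam T a) 0 = peval (lam T a) (bary T) + dot (lam T a).2 (0 - bary T) by lra.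
  have n1 : `|peval (lam T a) (bary T) + dot (lam T a).2 (0 - bary T)| <= 1 + enorm (lam T a).2 * D.
    apply: le_trans (ler_normD _ _) _; apply: lerD; first by rewrite ger0_norm.
    apply: le_trans (dot_cs _ _) _; rewrite ler_wpM2l ?enorm_ge0 // sub0r enormN.
    exact: cell_enorm hT bT.
  apply: le_trans (ler_wpM2r (ltW h0) n1) _; rewrite mulrDl mul1r /kl; apply: lerD => //.
  by rewrite mulrAC ler_wpM2r // grad_lam_mesh.
(* The weights sum to 1, so the expansion is W^2 + 2 W s1 + s2. The cross term is at least - W^2 / 2
   - 2 s1^2, and s1, s2 are bounded by the gradient. *)
have qT T : T \in cells m -> W T ^+ 2 / 2 - (2 * klam ^+ 2 + 2 * D * klam) * G T ^+ 2 <=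
    \sum_(a in T) peval (lam T a) 0 * f (T :\ a) ^+ 2.
  move=> hT; have nT := cell_nondeg hm hT; have G0 : 0 <= G T by exact: enorm_ge0.
  set s1 := \sum_(a in T) peval (lam T a) 0 * (f (T :\ a) - W T).
  set s2 := \sum_(a in T) peval (lam T a) 0 * (f (T :\ a) - W T) ^+ 2.
  have -> : \sum_(a in T) peval (lam T a) 0 * f (T :\ a) ^+ 2 = W T ^+ 2 + 2 * W T * s1 + s2.
    have e : W T ^+ 2 = \sum_(a in T) peval (lam T a) 0 * W T ^+ 2.
      by rewrite -mulr_suml (lam_sum1 nT) mul1r.
    rewrite [X in X + _ + _]e /s1 mulr_sumr /s2 -!big_split /=.
    by apply: eq_bigr => a _; ring.
  have b1 : `|s1| <= klam * G T.
    apply: le_trans (ler_norm_sum _ _ _) _.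
    apply: (le_trans (y := \sum_(a in T) kl * G T)).
      apply: ler_sum => a aT; rewrite normrM.
      have := ler_wpM2l (normr_ge0 (peval (lam T a) 0)) (dl T a hT aT).
      move/le_trans; apply; rewrite mulrCA mulrC ler_wpM2r //; exact: ll.
    by rewrite sumr_const nT.1 -[X in X <= _]mulr_natl klE mulrA.
  have b2 : `|s2| <= klam * (2 * D) * G T ^+ 2.
    apply: le_trans (ler_norm_sum _ _ _) _.
    apply: (le_trans (y := \sum_(a in T) kl * (2 * D) * G T ^+ 2)).
      apply: ler_sum => a aT; rewrite normrM normrX.
      have e1 : `|f (T :\ a) - W T| ^+ 2 <= (G T * h) ^+ 2.
        by rewrite ler_sqr ?nnegrE ?mulr_ge0 ?(ltW h0) //; exact: dl.
      have e2 := ler_wpM2l (normr_ge0 (peval (lam T a) 0)) e1.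
      apply: le_trans e2 _.
      have -> : `|peval (lam T a) 0| * (G T * h) ^+ 2 = (`|peval (lam T a) 0| * h) * h * G T ^+ 2 by ring.
      rewrite ler_wpM2r ?sqr_ge0 //; apply: ler_pM => //; try exact: ltW.
        by rewrite mulr_ge0 // ltW.
      exact: ll.
    by rewrite sumr_const nT.1 -[X in X <= _]mulr_natl klE; lra.
  have c1 : - (klam * (2 * D) * G T ^+ 2) <= s2.
    by have := ler_norm (- s2); rewrite normrN; lra.
  have c2 : s1 ^+ 2 <= (klam * G T) ^+ 2.
    by rewrite -[s1 ^+ 2]real_normK ?num_real // ler_sqr ?nnegrE ?mulr_ge0.
  have c3 : 0 <= (W T + 2 * s1) ^+ 2 by exact: sqr_ge0.
  have -> : (2 * klam ^+ 2 + 2 * D * klam) * G T ^+ 2 = 2 * (klam * G T) ^+ 2 + klam * (2 * D) * G T ^+ 2 by ring.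
  move: c1 c2 c3; move: (klam * G T) (klam * (2 * D) * G T ^+ 2) => u v; nra.
have wsum : \sum_(T in cells m) smeas T * W T ^+ 2 <= 2 * (2 * klam ^+ 2 + 2 * D * klam) * energy.
  have : \sum_(T in cells m) smeas T * (W T ^+ 2 / 2 - (2 * klam ^+ 2 + 2 * D * klam) * G T ^+ 2) <= 0.
    rewrite -[leRHS]sum_signed_volumes; apply: ler_sum => T hT.
    by rewrite ler_wpM2l ?smeas_ge0 // qT.
  have -> : \sum_(T in cells m) smeas T * (W T ^+ 2 / 2 - (2 * klam ^+ 2 + 2 * D * klam) * G T ^+ 2) =
     2^-1 * \sum_(T in cells m) smeas T * W T ^+ 2 - (2 * klam ^+ 2 + 2 * D * klam) * energy.
    rewrite /energy !mulr_sumr -sumrB; apply: eq_bigr => T _; rewrite /G; ring.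
  lra.
rewrite -sum_dofsq mulr_sumr.
apply: (le_trans (y := \sum_(T in cells m) kmeas * N.+1%:R *
   (2 * (smeas T * W T ^+ 2) + 2 * (2 * D) ^+ 2 * (smeas T * G T ^+ 2)))).
  apply: ler_sum => T hT; have nT := cell_nondeg hm hT.
  have G0 : 0 <= G T by exact: enorm_ge0.
  apply: (le_trans (y := (kmeas * smeas T) * (N.+1%:R * (2 * W T ^+ 2 + 2 * (2 * D) ^+ 2 * G T ^+ 2)))); last first.
    by rewrite le_eqVlt; apply/orP; left; apply/eqP; ring.
  apply: ler_pM; [by rewrite exprn_ge0 // ltW|by apply: sumr_ge0 => a _; exact: sqr_ge0|exact: cell_meas_ge|].
  apply: (le_trans (y := \sum_(a in T) (2 * W T ^+ 2 + 2 * (2 * D) ^+ 2 * G T ^+ 2))); last first.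
    by rewrite sumr_const nT.1 -[X in X <= _]mulr_natl.
  apply: ler_sum => a aT.
  have e1 : (f (T :\ a) - W T) ^+ 2 <= (G T * (2 * D)) ^+ 2.
    rewrite -[X in X <= _]real_normK ?num_real // ler_sqr ?nnegrE ?mulr_ge0 //.
    by apply: le_trans (dl T a hT aT) _; rewrite ler_wpM2l.
  have e2 : 0 <= (f (T :\ a) - 2 * W T) ^+ 2 by exact: sqr_ge0.
  move: e1 e2; rewrite exprMn => e1 e2; nra.
rewrite -mulr_sumr big_split /= -!mulr_sumr -/energy /kpoin.
have k0 : 0 <= kmeas * N.+1%:R by rewrite mulr_ge0 // kmeas_ge0.
rewrite -[leRHS]mulrA; apply: ler_wpM2l => //; lra.
Qed.

End Dofs.

Lemma wint_linl T (a : R) (q r w : vfield m) : inD P T ->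
  wint P T (fun T s => a *: q T s + r T s) w = a * wint P T q w + wint P T r w.
Proof.
move=> dT; have := wint_suml hP bm0 bM0 ell [:: true; false]
  (fun b : bool => if b then a else 1) (fun b : bool => if b then q else r) w dT.
rewrite !big_cons !big_nil /= addr0 mul1r => <-; apply: wint_eq => // s.
by rewrite !big_cons !big_nil /= addr0 scale1r.
Qed.

Lemma wint_linr T (a : R) (q r w : vfield m) : inD P T ->
  wint P T w (fun T s => a *: q T s + r T s) = a * wint P T w q + wint P T w r.
Proof.
by move=> dT; rewrite ![wint P T w _](wint_sym hP) // wint_linl.
Qed.

(** * Existence of the liftings *)

Section Lifting.
Variables (F : {set V}) (g : 'rV[R]_N -> R).
Hypothesis iF : F \in int_faces m.
Hypothesis sg : snice (m := m) F g.

(* The gradients of the local space are parametrized by their - part. *)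
Definition gfield T (p : 'rV[R]_N) : bool -> 'rV[R]_N := fun s =>
  if (T \in itf_cells P m) && s then p + (fluxjump P L T p / nbn P L T true) *: pn L T else p.

Lemma gfield_lin T (a : R) u v s : gfield T (a *: u + v) s = a *: gfield T u s + gfield T v s.
Proof.
rewrite /gfield; case: ifP => // _; rewrite fluxjumpD fluxjumpZ scalerDr scalerA addrACA.
by congr (_ + _); rewrite -scalerDl; congr (_ *: _); ring.
Qed.

Lemma gfieldP T z : T \in cells m -> VT P mu L T z -> forall s, (z s).2 = gfield T (z false).2 s.
Proof.
move=> hT vz s; have nT := cell_nondeg hm hT; rewrite /gfield.
have [iT|iT] /= := boolP (T \in itf_cells P m); last first.
  by move: vz; rewrite /VT (negPf iT); case: s => // ->.
case: s => //; have [_ _ [_ vp] _ _] := adm; have [n1 tt tn] := vp T iT.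
have [al -> /= <-] := (VT_itfP hN nT n1 tt tn mu0 z iT).1 vz.
have /andP[b0 _] := nbn_bounds n1 (fun s u => coefT_ell s u iT) true.
by rewrite mulfK // gt_eqF // (lt_le_trans bm0).
Qed.

Lemma gfield_VT T p : T \in cells m -> exists2 z, VT P mu L T z & forall s, gfield T p s = (z s).2.
Proof.
move=> hT; have nT := cell_nondeg hm hT.
have [iT|iT] := boolP (T \in itf_cells P m); last first.
  by exists (fun _ => (0, p)); rewrite /VT /gfield (negPf iT).
have [_ _ [_ vp] _ _] := adm; have [n1 tt tn] := vp T iT.
have /andP[b0 _] := nbn_bounds n1 (fun s u => coefT_ell s u iT) true.
pose al := fluxjump P L T p / nbn P L T true.
exists (fun s => if s then (0 + al * (pdist L T).1, p + al *: pn L T) else (0, p)).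
  apply/(VT_itfP hN nT n1 tt tn mu0 _ iT); exists al => //=.
  by rewrite /al divfK // gt_eqF // (lt_le_trans bm0).
by move=> s; rewrite /gfield iT; case: s.
Qed.

Lemma gfield_lower T p s : T \in cells m -> enorm p / kloc ^+ 2 <= enorm (gfield T p s).
Proof.
move=> hT; have [z vz hz] := gfield_VT p hT; have [e1 e2 _] := ife_crdof hT vz.
have k1 := kloc_ge1; have k0 : 0 < kloc by lra.
have pz : enorm p = enorm (z false).2 by rewrite -hz /gfield andbF.
rewrite hz pz ler_pdivrMr ?exprn_gt0 // mulrC expr2 -mulrA.
by apply: le_trans (e1 false) _; rewrite ler_wpM2l // ltW.
Qed.

Lemma snice_flux (q : bool -> 'rV[R]_N) n :
  snice (m := m) F (fun y => dot (mulmv (coefx P y) (q (side P y))) n).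
Proof.
exact: (snice_form hP bm0 bM0 ell q (fun _ => n) (inD_face (int_face_faces iF))).
Qed.

(** The averaged flux is half the sum of two one-sided fluxes, so the lifting equation splits into
    one Riesz problem per element, coercive by [gfield_lower]. *)
Lemma lift_part T : T \in star F -> exists r, forall p,
  wint P T (fun _ s => gfield T r s) (fun _ s => gfield T p s) =
  sint F (fun y => g y * dot (mulmv (coefx P y) (gfield T p (side P y))) (fnrm o F)) / 2.
Proof.
move=> sT; have [hT _] := star_facet (int_face_faces iF) sT; have dT := inD_cell hT.
pose b p p' := wint P T (fun _ s => gfield T p s) (fun _ s => gfield T p' s).
pose l p := sint F (fun y => g y * dot (mulmv (coefx P y) (gfield T p (side P y))) (fnrm o F)) / 2.
apply: (@riesz_rV _ _ b l).
- move=> a u v w; rewrite /b -wint_linl //.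
  by apply: wint_eq => // s; rewrite gfield_lin.
- move=> a u v w; rewrite /b -wint_linr //.
  by apply: wint_eq => // s; rewrite gfield_lin.
- move=> a u v; rewrite /l.
  have sn p := rniceM sg (snice_flux (gfield T p) (fnrm o F)).
  rewrite mulrA -mulrDl; congr (_ / _).
  rewrite -(sintZ _ (sn u)) -(sintD (rniceZ a (sn u)) (sn v)).
  apply: sint_eq; first by case: (inD_face (int_face_faces iF)).
  by move=> y _; rewrite gfield_lin mulmvD mulmvZ dotDl dotZl; ring.
move=> u u0; have k1 := kloc_ge1; have k0 : 0 < kloc by lra.
have e0 : 0 < enorm u / kloc ^+ 2.
  by rewrite divr_gt0 ?exprn_gt0 // lt_neqAle eq_sym enorm_eq0 u0 enorm_ge0.
have := wint_lower hP bm0 bM0 ell (q := fun _ s => gfield T u s) dT (ltW e0)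
  (fun s => gfield_lower u s hT).
apply: lt_le_trans; by apply: mulr_gt0; [exact: mulr_gt0 bm0 (exprn_gt0 2 e0)|exact: (smeas_cell_gt0 hm hT)].
Qed.

Lemma flux_avg_int (q : vfield m) y : flux_avg P o q F y =
  \sum_(T in star F) dot (mulmv (coefx P y) (vval P q T y)) (fnrm o F) / 2.
Proof. by rewrite /flux_avg iF sum_star_int // mulrDl. Qed.

Lemma lift_spec : QF P mu L F (Defs.lift P mu L o F g) /\ forall q, QF P mu L F q ->
  \sum_(T in star F) wint P T (Defs.lift P mu L o F g) q = sint F (fun y => g y * flux_avg P o q F y).
Proof.
rewrite /Defs.lift; case: xgetP => [r _ //|].
have ex T : exists r, T \in star F -> forall p,
  wint P T (fun _ s => gfield T r s) (fun _ s => gfield T p s) =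
  sint F (fun y => g y * dot (mulmv (coefx P y) (gfield T p (side P y))) (fnrm o F)) / 2.
  have [sT|sT] := boolP (T \in star F); last by exists 0.
  by have [r hr] := lift_part sT; exists r.
pose r T := projT1 (cid (ex T)).
have hr T : T \in star F -> forall p,
  wint P T (fun _ s => gfield T (r T) s) (fun _ s => gfield T p s) =
  sint F (fun y => g y * dot (mulmv (coefx P y) (gfield T p (side P y))) (fnrm o F)) / 2.
  by rewrite /r; case: cid.
move=> /(_ (fun T s => gfield T (r T) s)) []; split.
  by move=> T sT; have [hT _] := star_facet (int_face_faces iF) sT; apply: gfield_VT.
move=> q hq; have F0 := (inD_face (int_face_faces iF)).1.
transitivity (\sum_(T in star F) sint F (fun y => g y * dot (mulmv (coefx P y) (vval P q T y)) (fnrm o F)) / 2).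
  apply: eq_bigr => T sT; have [hT _] := star_facet (int_face_faces iF) sT.
  have [z vz hz] := hq T sT.
  have qE s : q T s = gfield T (q T false) s by rewrite !hz -gfieldP.
  rewrite /vval; have -> : (fun y => g y * dot (mulmv (coefx P y) (q T (side P y))) (fnrm o F)) =
    (fun y => g y * dot (mulmv (coefx P y) (gfield T (q T false) (side P y))) (fnrm o F)).
    by apply/funext => y; rewrite qE.
  by rewrite -hr //; apply: (wint_eq (inD_cell hT)).
rewrite -mulr_suml.
have sn T := rniceM sg (snice_flux (q T) (fnrm o F)).
rewrite !sum_star_int // -(sintD (sn _) (sn _)) mulrC -(sintZ _ (rniceD (sn _) (sn _))).
by apply: sint_eq => // y _; rewrite flux_avg_int sum_star_int // /vval; ring.
Qed.

End Lifting.

(** * The quadratic forms of the two stiffness matrices *)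

Definition combf (x : 'rV[R]_ND) (f : 'I_ND -> vfield m) : vfield m :=
  fun T s => \sum_i x 0 i *: f i T s.

Lemma wint_comb (x : 'rV[R]_ND) (f : 'I_ND -> vfield m) T : inD P T ->
  \sum_i \sum_j x 0 j * wint P T (f i) (f j) * x 0 i = wint P T (combf x f) (combf x f).
Proof.
move=> dT; rewrite (wint_suml hP bm0 bM0 ell (index_enum 'I_ND) (fun i => x 0 i) f _ dT).
apply: eq_bigr => i _.
rewrite (wint_sumr hP bm0 bM0 ell (index_enum 'I_ND) (fun i => x 0 i) f _ dT) mulr_sumr.
by apply: eq_bigr => j _; ring.
Qed.

Lemma cells_comb (x : 'rV[R]_ND) (f : 'I_ND -> vfield m) (Q : pred {set V}) :
  (forall T, Q T -> T \in cells m) ->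
  \sum_i \sum_j x 0 j * (\sum_(T | Q T) wint P T (f i) (f j)) * x 0 i =
  \sum_(T | Q T) wint P T (combf x f) (combf x f).
Proof.
move=> hQ; under [RHS]eq_bigr => T qT do rewrite -(wint_comb _ _ (inD_cell (hQ T qT))).
rewrite [RHS]exchange_big /=; apply: eq_bigr => i _.
rewrite [RHS]exchange_big /=; apply: eq_bigr => j _.
by rewrite mulr_sumr mulr_suml.
Qed.

Definition grad_std (i : 'I_ND) : vfield m := fun T _ => (interp (fun F => (F == enum_val i)%:R) T).2.

Lemma combf_std (x : 'rV[R]_ND) T s : combf x grad_std T s = (interp (fval x) T).2.
Proof. by rewrite interp_comb. Qed.

Lemma std_entry i j : stiff_std P mu L o i j =
  \sum_(T in cells m) wint P T (grad_std i) (grad_std j).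
Proof.
rewrite mxE; apply: eq_bigr => T hT.
by apply: (wint_eq (inD_cell hT)) => s; rewrite /gradh Pihat_basis.
Qed.

Lemma std_form (x : 'rV[R]_ND) : dot (mulmv (stiff_std P mu L o) x) x =
  \sum_(T in cells m) wint P T (combf x grad_std) (combf x grad_std).
Proof.
rewrite dot_mulmvE -cells_comb //.
by apply: eq_bigr => i _; apply: eq_bigr => j _; rewrite std_entry.
Qed.

Lemma std_bounds (x : 'rV[R]_ND) :
  bm * energy (fval x) <= dot (mulmv (stiff_std P mu L o) x) x <= bM * energy (fval x).
Proof.
rewrite std_form /energy !mulr_sumr; apply/andP; split; apply: ler_sum => T hT.
  rewrite mulrA mulrAC; apply: (wint_lower hP bm0 bM0 ell (inD_cell hT)).
    exact: enorm_ge0.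
  by move=> s; rewrite combf_std.
rewrite mulrA mulrAC; apply: (wint_upper hP bm0 bM0 ell (inD_cell hT)).
by move=> s; rewrite combf_std.
Qed.

Lemma energy_ge0 f : 0 <= energy f.
Proof. by apply: sumr_ge0 => T _; rewrite mulr_ge0 ?smeas_ge0 ?sqr_ge0. Qed.

Lemma std_psd : psd_form (stiff_std P mu L o).
Proof.
split.
  apply/matrixP => i j; rewrite mxE !std_entry; apply: eq_bigr => T hT.
  exact: (wint_sym hP _ _ (inD_cell hT)).
move=> x; have /andP[h1 _] := std_bounds x; apply: le_trans h1.
by rewrite mulr_ge0 ?energy_ge0 // ltW.
Qed.

Lemma itf_face_int F : F \in itf_faces P m -> F \in int_faces m.
Proof.
rewrite inE => /andP[hF cF]; case: (face_cases hF) => // /bnd_face_uncut.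
by rewrite cF.
Qed.

Lemma snice_jump (v : bfun m) F : F \in int_faces m -> snice (m := m) F (jump P o v F).
Proof.
move=> iF; have -> : jump P o v F = fun x => bval P v (fc1 o F) x - bval P v (fc2 o F) x.
  by apply/funext => x; rewrite /jump iF.
by apply: rniceB; exact: snice_bval.
Qed.

Lemma snice_flux_avg (q : vfield m) F : F \in int_faces m ->
  snice (m := m) F (flux_avg P o q F).
Proof.
move=> iF; have -> : flux_avg P o q F = fun y => 2^-1 *
   (dot (mulmv (coefx P y) (q (fc1 o F) (side P y))) (fnrm o F) +
    dot (mulmv (coefx P y) (q (fc2 o F) (side P y))) (fnrm o F)).
  by apply/funext => x; rewrite /flux_avg iF mulrC.
by apply: rniceZ; apply: rniceD; exact: snice_flux.
Qed.

Lemma jump_vcomb (x : 'rV[R]_ND) F y : F \in int_faces m ->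
  jump P o (vcomb x) F y = \sum_i x 0 i * jump P o (phi i) F y.
Proof.
move=> iF; rewrite /jump iF /bval /vcomb !peval_combP1 -sumrB.
by apply: eq_bigr => i _; rewrite mulrBr.
Qed.

Lemma flux_avg_comb (x : 'rV[R]_ND) (f : 'I_ND -> vfield m) F y : F \in int_faces m ->
  flux_avg P o (combf x f) F y = \sum_i x 0 i * flux_avg P o (f i) F y.
Proof.
move=> iF; under eq_bigr do rewrite /flux_avg iF mulrA mulrDr.
rewrite -mulr_suml big_split /= /flux_avg iF /vval /combf; congr ((_ + _) / _).
all: rewrite dot_mulmv dot_suml; apply: eq_bigr => i _; by rewrite dotZl -dot_mulmv.
Qed.

Definition lift_basis F i : vfield m := Defs.lift P mu L o F (jump P o (phi i) F).

(** The liftings are chosen, so their linearity is not appealed to: the combination of the liftings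
    of the basis jumps satisfies the lifting equation for the combined jump, and the estimates use
    only this. *)
Lemma lift_comb (x : 'rV[R]_ND) F : F \in int_faces m ->
  QF P mu L F (combf x (lift_basis F)) /\ forall q, QF P mu L F q ->
    \sum_(T in star F) wint P T (combf x (lift_basis F)) q =
    sint F (fun y => jump P o (vcomb x) F y * flux_avg P o q F y).
Proof.
move=> iF; have sp i := lift_spec iF (snice_jump (phi i) iF); split.
  move=> T sT; have [hT _] := star_facet (int_face_faces iF) sT.
  have ex i : exists z, VT P mu L T z /\ forall s, lift_basis F i T s = (z s).2.
    by have [z vz hz] := (sp i).1 T sT; exists z.
  exists (fun s => combP1 (index_enum 'I_ND) (fun i => x 0 i) (fun i => projT1 (cid (ex i)) s)).
    by apply: VT_comb => i; case: cid => z [].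
  move=> s; apply: eq_bigr => i _; congr (_ *: _).
  by case: cid => z [].
move=> q hq.
transitivity (\sum_i x 0 i * \sum_(T in star F) wint P T (lift_basis F i) q).
  rewrite sum_star_int //; under [RHS]eq_bigr do rewrite sum_star_int // mulrDr.
  have [_ s1 s2] := int_face_star iF.
  have [h1 _] := star_facet (int_face_faces iF) s1.
  have [h2 _] := star_facet (int_face_faces iF) s2.
  rewrite big_split /=.
  by rewrite !(wint_suml hP bm0 bM0 ell (index_enum 'I_ND) (fun i => x 0 i) (lift_basis F)) //; exact: inD_cell.
have sn i : snice F (fun y => jump P o (phi i) F y * flux_avg P o q F y).
  by apply: rniceM; [exact: snice_jump|exact: snice_flux_avg].
under eq_bigr => i _ do rewrite ((sp i).2 q hq) -(sintZ _ (sn i)).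
rewrite -sint_sum; last by move=> i; exact: rniceZ (sn i).
apply: sint_eq; first by case: (inD_face (int_face_faces iF)).
move=> y _; rewrite jump_vcomb // mulr_suml; apply: eq_bigr => i _; exact: mulrA.
Qed.

Definition liftsq (x : 'rV[R]_ND) F : R :=
  \sum_(T in star F) wint P T (combf x (lift_basis F)) (combf x (lift_basis F)).

Lemma star_cells F T : F \in faces m -> T \in star F -> T \in cells m.
Proof. by move=> hF sT; case: (star_facet hF sT). Qed.

(** Testing the lifting equation with the broken gradient of the function itself turns the face
    integrals of [bh] into volume integrals, where Young's inequality applies. *)
Lemma ife_form (x : 'rV[R]_ND) : dot (mulmv (stiff_ife P mu L o) x) x =
  \sum_(T in cells m) wint P T (gradh (vcomb x)) (gradh (vcomb x)) -
  2 * \sum_(F in itf_faces P m) \sum_(T in star F) wint P T (combf x (lift_basis F)) (gradh (vcomb x)) +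
  8 * \sum_(F in itf_faces P m) liftsq x F.
Proof.
rewrite dot_mulmvE.
transitivity (\sum_i \sum_j (x 0 j * ah P (phi i) (phi j) * x 0 i +
    x 0 j * bh P o (phi i) (phi j) * x 0 i + x 0 j * sh P mu L o (phi i) (phi j) * x 0 i)).
  by apply: eq_bigr => i _; apply: eq_bigr => j _; rewrite mxE /Ah; ring.
under eq_bigr do rewrite !big_split /=.
rewrite !big_split /=; congr (_ + _ + _).
- exact: (cells_comb x (fun i => gradh (phi i))).
- rewrite -mulNr mulr_sumr.
  transitivity (\sum_(F in itf_faces P m) \sum_i \sum_j x 0 j *
      (- sint F (fun y => flux_avg P o (gradh (phi i)) F y * jump P o (phi j) F y +
                       flux_avg P o (gradh (phi j)) F y * jump P o (phi i) F y)) * x 0 i).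
    rewrite [RHS]exchange_big /=; apply: eq_bigr => i _.
    rewrite [RHS]exchange_big /=; apply: eq_bigr => j _.
    by rewrite /bh -sumrN mulr_sumr mulr_suml.
  apply: eq_bigr => F /itf_face_int iF.
  have qv : QF P mu L F (gradh (vcomb x)).
    move=> T sT; exists (vcomb x T) => //; apply: vcomb_VT.
    exact: star_cells (int_face_faces iF) sT.
  rewrite ((lift_comb x iF).2 _ qv) mulNr.
  pose p i j y := flux_avg P o (gradh (phi i)) F y * jump P o (phi j) F y.
  have sp i j : snice F (p i j) by apply: rniceM; [exact: snice_flux_avg|exact: snice_jump].
  have spp i j : snice F (fun y => p i j y + p j i y) by exact: rniceD (sp i j) (sp j i).
  transitivity (- \sum_i \sum_j sint F (fun y => (x 0 j * x 0 i) * (p i j y + p j i y))).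
    rewrite -sumrN; apply: eq_bigr => i _; rewrite -sumrN; apply: eq_bigr => j _.
    by rewrite (sintZ _ (spp i j)) mulrN mulNr mulrAC.
  congr (- _).
  under eq_bigr => i _ do rewrite -(sint_sum _ (fun j => rniceZ (x 0 j * x 0 i) (spp i j))).
  have sps i : snice F (fun y => \sum_j (x 0 j * x 0 i) * (p i j y + p j i y)).
    by apply: rnice_sum => j; exact: rniceZ (spp i j).
  rewrite -(sint_sum _ sps).
  have sjf : snice F (fun y => jump P o (vcomb x) F y * flux_avg P o (gradh (vcomb x)) F y).
    by apply: rniceM; [exact: snice_jump|exact: snice_flux_avg].
  rewrite -(sintZ _ sjf); apply: sint_eq; first by case: (inD_face (int_face_faces iF)).
  move=> y _; rewrite jump_vcomb // (flux_avg_comb x (fun i => gradh (phi i)) y iF).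
  rewrite mulr2n mulrDl mul1r.
  transitivity (\sum_i \sum_j (x 0 i * jump P o (phi i) F y) * (x 0 j * flux_avg P o (gradh (phi j)) F y) +
     \sum_i \sum_j (x 0 j * jump P o (phi j) F y) * (x 0 i * flux_avg P o (gradh (phi i)) F y)).
    rewrite -big_split /=; apply: eq_bigr => i _; rewrite -big_split /=; apply: eq_bigr => j _.
    by rewrite /p; ring.
  congr (_ + _).
    by rewrite mulr_suml; apply: eq_bigr => i _; rewrite mulr_sumr.
  rewrite exchange_big /= mulr_suml; apply: eq_bigr => i _; by rewrite mulr_sumr.
rewrite mulr_sumr.
transitivity (\sum_(F in itf_faces P m) \sum_i \sum_j x 0 j *
   (8 * \sum_(T in star F) wint P T (lift_basis F i) (lift_basis F j)) * x 0 i).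
  rewrite [RHS]exchange_big /=; apply: eq_bigr => i _.
  rewrite [RHS]exchange_big /=; apply: eq_bigr => j _.
  by rewrite /sh mulr_sumr mulr_sumr mulr_suml.
apply: eq_bigr => F /itf_face_int iF.
rewrite /liftsq -(cells_comb x (lift_basis F) (Q := mem (star F))); last by move=> T; exact: star_cells (int_face_faces iF).
rewrite mulr_sumr; apply: eq_bigr => i _; rewrite mulr_sumr; apply: eq_bigr => j _; ring.
Qed.

(** The squared factor collects the constants of the jump, of the flux and of the face measure. The
    next bounds h^N times the squared lifting by its energy, and the last compares h^N with |T|. *)
Definition klift : R :=
  4 * ((kval + 1) * bM * kloc ^+ 2 * kface) ^+ 2 * (kmeas * kloc ^+ 4 / bm + 1) * kmeas.

Lemma klift_ge0 : 0 <= klift.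
Proof.
have k0 : 0 <= kloc by have := kloc_ge1; lra.
have e : 0 <= kmeas * kloc ^+ 4 / bm + 1.
  by rewrite addr_ge0 // divr_ge0 ?(ltW bm0) // mulr_ge0 ?kmeas_ge0 ?exprn_ge0.
exact: mulr_ge0 (mulr_ge0 (mulr_ge0 (ler0n _ 4) (sqr_ge0 _)) e) kmeas_ge0.
Qed.

Lemma VT_grad_ratio T z s s' : T \in cells m -> VT P mu L T z ->
  enorm (z s).2 <= kloc ^+ 2 * enorm (z s').2.
Proof.
move=> hT vz; have [e1 e2 _] := ife_crdof hT vz; have k1 := kloc_ge1.
by apply: le_trans (e1 s) _; rewrite expr2 -mulrA ler_wpM2l //; lra.
Qed.

(** Both traces are compared with the common degree of freedom on F, each through its interpolant,
    which takes that value at the barycenter of F. *)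
Lemma jump_bound (x : 'rV[R]_ND) F y : F \in int_faces m -> osimplex F y ->
  `|jump P o (vcomb x) F y| <=
  (kval + 1) * h * (enorm (interp (fval x) (fc1 o F)).2 + enorm (interp (fval x) (fc2 o F)).2).
Proof.
move=> iF hy; have hF := int_face_faces iF; have [_ s1 s2] := int_face_star iF.
have part T : T \in star F -> `|bval P (vcomb x) T y - fval x F| <=
    (kval + 1) * h * enorm (interp (fval x) T).2.
  move=> sT; have [hT [a aT eF]] := star_facet hF sT; have nT := cell_nondeg hm hT.
  have FT : F \subset T by rewrite eF subD1set.
  have yT : csimplex T y by apply: (csimplex_sub nT FT); apply: osimplex_csimplex.
  have F0 : (0 < #|F|)%N by case: (inD_face hF).
  have bT : csimplex T (bary F).
    by apply: (csimplex_sub nT FT); apply: osimplex_csimplex; apply: (osimplex_bary nT FT).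
  have [_ _ e3] := ife_crdof hT (vcomb_VT x hT); rewrite crdof_vcomb // in e3.
  have e4 : `|peval (interp (fval x) T) y - peval (interp (fval x) T) (bary F)| <=
      h * enorm (interp (fval x) T).2.
    rewrite pevalB; apply: le_trans (dot_cs _ _) _; rewrite mulrC ler_wpM2r ?enorm_ge0 //.
    by apply: le_trans (hT_le_mesh hT); apply: (hT_csimplex nT).
  have fE : peval (interp (fval x) T) (bary F) = fval x F by rewrite eF interp_facet.
  rewrite -fE mulrDl mul1r mulrDl.
  have -> : bval P (vcomb x) T y - peval (interp (fval x) T) (bary F) =
     (bval P (vcomb x) T y - peval (interp (fval x) T) y) +
     (peval (interp (fval x) T) y - peval (interp (fval x) T) (bary F)) by ring.
  by apply: le_trans (ler_normD _ _) (lerD _ e4); exact: e3.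
rewrite /jump iF mulrDr.
have -> : bval P (vcomb x) (fc1 o F) y - bval P (vcomb x) (fc2 o F) y =
  (bval P (vcomb x) (fc1 o F) y - fval x F) - (bval P (vcomb x) (fc2 o F) y - fval x F) by ring.
by apply: le_trans (ler_normB _ _) (lerD _ _); exact: part.
Qed.

(** The lifting is tested with itself. Its energy w is then bounded by face measure times jump times
    flux, of order h^(N-1) h, hence by h^N times gradients times liftings, and half of w is
    absorbed. *)
Lemma liftsq_bound (x : 'rV[R]_ND) F : F \in int_faces m ->
  liftsq x F <= klift * \sum_(T in star F) smeas T * enorm (interp (fval x) T).2 ^+ 2.
Proof.
move=> iF; have hF := int_face_faces iF; have [_ s1 s2] := int_face_star iF.
have h0 := mesh_size_gt0; have k1 := kloc_ge1; have k0 : 0 < kloc by lra.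
have hN0 : 0 <= h ^+ N by rewrite exprn_ge0 // ltW.
set r := combf x (lift_basis F); set w := liftsq x F.
have [qr hw] := lift_comb x iF; have := hw _ qr; rewrite -/r -/w => wE.
pose G T := enorm (interp (fval x) T).2; pose rho T := enorm (r T false).
have G0 T : 0 <= G T by exact: enorm_ge0.
have rho0 T : 0 <= rho T by exact: enorm_ge0.
have rr T s s' : T \in star F -> enorm (r T s) <= kloc ^+ 2 * enorm (r T s').
  move=> sT; have [z vz hz] := qr T sT.
  have hzr t : r T t = (z t).2 by exact: hz.
  rewrite !hzr; by apply: VT_grad_ratio vz; exact: star_cells hF sT.
have low T : T \in star F -> h ^+ N * rho T ^+ 2 <= kmeas * kloc ^+ 4 / bm * wint P T r r.
  move=> sT; have hT := star_cells hF sT.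
  have l1 : bm * (rho T / kloc ^+ 2) ^+ 2 * smeas T <= wint P T r r.
    apply: (wint_lower hP bm0 bM0 ell (inD_cell hT)); first by rewrite divr_ge0 ?exprn_ge0 // ltW.
    by move=> s; rewrite ler_pdivrMr ?exprn_gt0 // mulrC; exact: rr.
  have l2 := cell_meas_ge hT.
  have e : h ^+ N * rho T ^+ 2 <= kmeas * smeas T * rho T ^+ 2 by rewrite ler_wpM2r ?sqr_ge0.
  apply: le_trans e _.
  have -> : kmeas * smeas T * rho T ^+ 2 =
     kmeas * kloc ^+ 4 / bm * (bm * (rho T / kloc ^+ 2) ^+ 2 * smeas T).
    by field; rewrite !gt_eqF.
  rewrite ler_wpM2l // divr_ge0 ?(ltW bm0) // mulr_ge0 ?kmeas_ge0 ?exprn_ge0 //; exact: ltW.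
have gl T : T \in star F -> h ^+ N * G T ^+ 2 <= kmeas * (smeas T * G T ^+ 2).
  by move=> sT; rewrite mulrA ler_wpM2r ?sqr_ge0 //; apply: cell_meas_ge; exact: star_cells hF sT.
have wge T : T \in star F -> 0 <= wint P T r r.
  by move=> sT; apply: (wint_ge0 hP bm0 bM0 ell _ (inD_cell (star_cells hF sT))).
have nF1 : enorm (fnrm o F) = 1.
  by have [_ /(_ F iF)[]] : valid_orientation o by have [_ ] := adm.
have fl y : osimplex F y -> `|flux_avg P o r F y| <= bM * kloc ^+ 2 * (rho (fc1 o F) + rho (fc2 o F)).
  move=> hy; rewrite /flux_avg iF.
  have cl : closure (sub P (side P y)) y.
    by apply: (side_closure hP); apply: (face_in_closure hm hF hy).
  have b T : T \in star F -> `|dot (mulmv (coefx P y) (vval P r T y)) (fnrm o F)| <= bM * kloc ^+ 2 * rho T.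
    move=> sT; apply: le_trans (coef_bound hP bm0 bM0 ell _ _ cl) _.
    by rewrite nF1 mulr1 -mulrA ler_wpM2l ?(ltW bM0) //; exact: rr.
  have b1 := b _ s1; have b2 := b _ s2.
  rewrite normrM [`|2^-1|]ger0_norm ?invr_ge0 // ler_pdivrMr //.
  apply: le_trans (ler_normD _ _) _.
  have p1 := normr_ge0 (dot (mulmv (coefx P y) (vval P r (fc1 o F) y)) (fnrm o F)).
  have p2 := normr_ge0 (dot (mulmv (coefx P y) (vval P r (fc2 o F) y)) (fnrm o F)).
  lra.
set c1 := (kval + 1) * bM * kloc ^+ 2 * kface.
have kv := kval_ge0.
have F0 : (0 < #|F|)%N by case: (inD_face hF).
have mF : smeas F <= kface * h ^+ N.-1.
  by have [hT [a aT ->]] := star_facet hF s1; exact: face_meas_le.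
set g := G (fc1 o F) + G (fc2 o F); set rh := rho (fc1 o F) + rho (fc2 o F).
have g0 : 0 <= g by exact: addr_ge0.
have rh0 : 0 <= rh by exact: addr_ge0.
have wle : w <= h ^+ N * (c1 * g * rh).
  have jf y : osimplex F y -> `|jump P o (vcomb x) F y * flux_avg P o r F y| <=
      ((kval + 1) * h * g) * (bM * kloc ^+ 2 * rh).
    by move=> hy; rewrite normrM; apply: ler_pM => //; [exact: jump_bound|exact: fl].
  have sn : snice F (fun y => jump P o (vcomb x) F y * flux_avg P o r F y).
    by apply: rniceM; [exact: snice_jump|exact: snice_flux_avg].
  have := sint_abs_le F0 sn jf; rewrite -wE => hw'.
  apply: le_trans (ler_norm _) (le_trans hw' _).
  have C0 : 0 <= (kval + 1) * h * g * (bM * kloc ^+ 2 * rh).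
    have a1 : 0 <= (kval + 1) * h * g by apply: mulr_ge0 => //; apply: mulr_ge0; lra.
    apply: (mulr_ge0 a1); apply: mulr_ge0 => //; apply: mulr_ge0; first exact: ltW.
    by rewrite exprn_ge0 // ltW.
  apply: le_trans (ler_wpM2l C0 mF) _.
  have -> : h ^+ N = h * h ^+ N.-1 by rewrite -exprS prednK.
  by rewrite le_eqVlt; apply/orP; left; apply/eqP; rewrite /c1; ring.
(* The summand 1 keeps c2 positive, since it serves as a divisor in Young's inequality. *)
set c2 := kmeas * kloc ^+ 4 / bm + 1.
have wsplit : w = wint P (fc1 o F) r r + wint P (fc2 o F) r r by rewrite /w /liftsq sum_star_int.
have c20 : 0 < c2.
  rewrite /c2 ltr_wpDl // divr_ge0 ?(ltW bm0) // mulr_ge0 ?kmeas_ge0 ?exprn_ge0 //; exact: ltW.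
have rsum : h ^+ N * (rho (fc1 o F) ^+ 2 + rho (fc2 o F) ^+ 2) <= c2 * w.
  rewrite wsplit /c2 mulrDl mul1r mulrDr [X in _ <= X + _]mulrDr.
  have := low _ s1; have := low _ s2; have := wge _ s1; have := wge _ s2; lra.
have gsum : h ^+ N * (G (fc1 o F) ^+ 2 + G (fc2 o F) ^+ 2) <=
    kmeas * \sum_(T in star F) smeas T * enorm (interp (fval x) T).2 ^+ 2.
  by rewrite sum_star_int // mulrDr [X in _ <= X]mulrDr lerD // gl.
(* The weight is chosen so that the lifting term, multiplied by h^N, is at most w / 2 by [rsum]. *)
have young : c1 * g * rh <= (rho (fc1 o F) ^+ 2 + rho (fc2 o F) ^+ 2) / (2 * c2) +
    2 * c1 ^+ 2 * c2 * (G (fc1 o F) ^+ 2 + G (fc2 o F) ^+ 2).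
  have q0 : 0 <= (rh - 2 * c2 * (c1 * g)) ^+ 2 by exact: sqr_ge0.
  have q1 : rh ^+ 2 <= 2 * (rho (fc1 o F) ^+ 2 + rho (fc2 o F) ^+ 2).
    by have := sqr_ge0 (rho (fc1 o F) - rho (fc2 o F)); rewrite /rh; nra.
  have q2 : g ^+ 2 <= 2 * (G (fc1 o F) ^+ 2 + G (fc2 o F) ^+ 2).
    by have := sqr_ge0 (G (fc1 o F) - G (fc2 o F)); rewrite /g; nra.
  have i0 : 0 < c2^-1 by rewrite invr_gt0.
  have e1 : c1 * g * rh <= rh ^+ 2 / (4 * c2) + c2 * c1 ^+ 2 * g ^+ 2.
    have -> : rh ^+ 2 / (4 * c2) + c2 * c1 ^+ 2 * g ^+ 2 =
       c1 * g * rh + (rh - 2 * c2 * (c1 * g)) ^+ 2 / (4 * c2) by field; rewrite gt_eqF.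
    by rewrite lerDl divr_ge0 // mulr_ge0 // ltW.
  apply: le_trans e1 _; apply: lerD.
    have -> : (rho (fc1 o F) ^+ 2 + rho (fc2 o F) ^+ 2) / (2 * c2) =
      2 * (rho (fc1 o F) ^+ 2 + rho (fc2 o F) ^+ 2) / (4 * c2) by field; rewrite gt_eqF.
    by rewrite ler_wpM2r // invr_ge0 mulr_ge0 // ltW.
  have -> : 2 * c1 ^+ 2 * c2 * (G (fc1 o F) ^+ 2 + G (fc2 o F) ^+ 2) =
    c2 * c1 ^+ 2 * (2 * (G (fc1 o F) ^+ 2 + G (fc2 o F) ^+ 2)) by ring.
  by rewrite ler_wpM2l // mulr_ge0 ?sqr_ge0 // ltW.
have y2 := ler_wpM2l hN0 young; rewrite [X in _ <= X]mulrDr in y2.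
have t1 : h ^+ N * ((rho (fc1 o F) ^+ 2 + rho (fc2 o F) ^+ 2) / (2 * c2)) <= w / 2.
  have -> : h ^+ N * ((rho (fc1 o F) ^+ 2 + rho (fc2 o F) ^+ 2) / (2 * c2)) =
    h ^+ N * (rho (fc1 o F) ^+ 2 + rho (fc2 o F) ^+ 2) / (2 * c2) by rewrite mulrA.
  rewrite ler_pdivrMr ?mulr_gt0 //.
  have -> : w / 2 * (2 * c2) = c2 * w by field.
  exact: rsum.
set S := \sum_(T in star F) _ in gsum *.
have cc : 0 <= 2 * c1 ^+ 2 * c2 by exact: mulr_ge0 (mulr_ge0 (ler0n _ 2) (sqr_ge0 _)) (ltW c20).
have t2 : h ^+ N * (2 * c1 ^+ 2 * c2 * (G (fc1 o F) ^+ 2 + G (fc2 o F) ^+ 2)) <=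
   2 * c1 ^+ 2 * c2 * (kmeas * S) by rewrite mulrCA; apply: ler_wpM2l.
have -> : klift * S = 2 * (2 * c1 ^+ 2 * c2 * (kmeas * S)) by rewrite /klift -/c1 -/c2; ring.
lra.
Qed.

Lemma sum_itf_star (H : {set V} -> R) : (forall T, T \in cells m -> 0 <= H T) ->
  \sum_(F in itf_faces P m) \sum_(T in star F) H T <= 4 * \sum_(T in cells m) H T.
Proof.
move=> H0.
apply: (le_trans (y := \sum_(F in faces m) \sum_(T in star F) H T)).
  rewrite [leRHS](bigID (mem (itf_faces P m))) /=.
  have -> : \sum_(F in faces m | F \in itf_faces P m) \sum_(T in star F) H T =
      \sum_(F in itf_faces P m) \sum_(T in star F) H T.
    apply: eq_bigl => F; case iF: (F \in itf_faces P m); rewrite ?andbF // andbT.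
    by rewrite (int_face_faces (itf_face_int iF)).
  rewrite lerDl; apply: sumr_ge0 => F /andP[hF _]; apply: sumr_ge0 => T sT.
  by apply: H0; exact: star_cells hF sT.
rewrite -(sum_cells_faces (fun T _ => H T)) mulr_sumr; apply: ler_sum => T hT.
rewrite sumr_const (cell_nondeg hm hT).1 -[X in X <= _]mulr_natl ler_wpM2r ?H0 //.
by rewrite ler_nat; case: hN => ->.
Qed.

(** The cross term is at most S + 4 a in size, so the form is at most 5 a + 9 S, with a <= bM kloc^2
    and S <= 4 klift times the energy. *)
Definition kife : R := 5 * bM * kloc ^+ 2 + 36 * klift.

Lemma ife_bounds (x : 'rV[R]_ND) :
  bm / (2 * kloc ^+ 2) * energy (fval x) <= dot (mulmv (stiff_ife P mu L o) x) x <=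
  kife * energy (fval x).
Proof.
have k1 := kloc_ge1; have k0 : 0 < kloc by lra.
set v := gradh (vcomb x).
set a := \sum_(T in cells m) wint P T v v.
set S := \sum_(F in itf_faces P m) liftsq x F.
set X := \sum_(F in itf_faces P m) \sum_(T in star F) wint P T (combf x (lift_basis F)) v.
have e : dot (mulmv (stiff_ife P mu L o) x) x = a - 2 * X + 8 * S by exact: ife_form.
have w0 T : T \in cells m -> 0 <= wint P T v v.
  by move=> hT; apply: (wint_ge0 hP bm0 bM0 ell _ (inD_cell hT)).
have a4 := sum_itf_star w0; rewrite -/a in a4.
have hc F T : F \in itf_faces P m -> T \in star F -> T \in cells m.
  by move=> iF; exact: star_cells (int_face_faces (itf_face_int iF)).
have S0 : 0 <= S.
  apply: sumr_ge0 => F iF; apply: sumr_ge0 => T sT.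
  by apply: (wint_ge0 hP bm0 bM0 ell _ (inD_cell (hc F T iF sT))).
have lo : 2 * X <= 8 * S + 8^-1 * (\sum_(F in itf_faces P m) \sum_(T in star F) wint P T v v).
  rewrite /X /S !mulr_sumr -big_split /=; apply: ler_sum => F iF.
  rewrite /liftsq !mulr_sumr -big_split /=; apply: ler_sum => T sT.
  exact: (wint_young hP bm0 bM0 ell _ _ (inD_cell (hc F T iF sT))).
have hi : - (2 * X) <= S + \sum_(F in itf_faces P m) \sum_(T in star F) wint P T v v.
  rewrite /X /S !mulr_sumr -sumrN -big_split /=; apply: ler_sum => F iF.
  rewrite /liftsq !mulr_sumr -sumrN -big_split /=; apply: ler_sum => T sT.
  have dT := inD_cell (hc F T iF sT); set r := combf x (lift_basis F).
  have := wint_ge0 hP bm0 bM0 ell (fun T s => 1 *: r T s + v T s) dT.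
  by rewrite wint_linl // !wint_linr // (wint_sym hP v r dT); lra.
have aE : bm / kloc ^+ 2 * energy (fval x) <= a <= bM * kloc ^+ 2 * energy (fval x).
  rewrite /a /energy !mulr_sumr; apply/andP; split; apply: ler_sum => T hT.
    have [e1 e2 _] := ife_crdof hT (vcomb_VT x hT); rewrite crdof_vcomb // in e1 e2.
    have -> : bm / kloc ^+ 2 * (smeas T * enorm (interp (fval x) T).2 ^+ 2) =
      bm * (enorm (interp (fval x) T).2 / kloc) ^+ 2 * smeas T by field; rewrite gt_eqF.
    apply: (wint_lower hP bm0 bM0 ell (inD_cell hT)); first by rewrite divr_ge0 ?enorm_ge0 // ltW.
    by move=> s; rewrite ler_pdivrMr // mulrC; exact: e2.
  have [e1 e2 _] := ife_crdof hT (vcomb_VT x hT); rewrite crdof_vcomb // in e1 e2.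
  have -> : bM * kloc ^+ 2 * (smeas T * enorm (interp (fval x) T).2 ^+ 2) =
    bM * (kloc * enorm (interp (fval x) T).2) ^+ 2 * smeas T by ring.
  exact: (wint_upper hP bm0 bM0 ell (inD_cell hT)).
have SE : S <= 4 * klift * energy (fval x).
  apply: (le_trans (y := \sum_(F in itf_faces P m) klift * \sum_(T in star F) smeas T * enorm (interp (fval x) T).2 ^+ 2)).
    by apply: ler_sum => F iF; apply: liftsq_bound; exact: itf_face_int.
  rewrite -mulr_sumr.
  have -> : 4 * klift * energy (fval x) = klift * (4 * energy (fval x)) by ring.
  apply: ler_wpM2l; first exact: klift_ge0.
  by apply: sum_itf_star => T hT; rewrite mulr_ge0 ?smeas_ge0 ?sqr_ge0.
have /andP[aE1 aE2] := aE.
have -> : bm / (2 * kloc ^+ 2) * energy (fval x) = 2^-1 * (bm / kloc ^+ 2 * energy (fval x)).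
  by field; rewrite gt_eqF.
rewrite e /kife mulrDl; apply/andP; split; lra.
Qed.

Lemma ife_psd : psd_form (stiff_ife P mu L o).
Proof.
split; last first.
  move=> x; have /andP[h1 _] := ife_bounds x; apply: le_trans h1.
  apply: mulr_ge0 (energy_ge0 _); rewrite divr_ge0 ?(ltW bm0) // mulr_ge0 ?exprn_ge0 //.
  by have := kloc_ge1; lra.
apply/matrixP => i j.
have e1 : ah P (phi j) (phi i) = ah P (phi i) (phi j).
  by apply: eq_bigr => T hT; exact: (wint_sym hP _ _ (inD_cell hT)).
have e2 : bh P o (phi j) (phi i) = bh P o (phi i) (phi j).
  rewrite /bh; apply: (congr1 -%R); apply: eq_bigr => F _; apply: (congr1 (sint F)).
  by apply/funext => y; rewrite addrC.
have e3 : sh P mu L o (phi j) (phi i) = sh P mu L o (phi i) (phi j).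
  rewrite /sh; apply: (congr1 (fun t => 8 * t)); apply: eq_bigr => F iF; apply: eq_bigr => T sT.
  apply: (wint_sym hP _ _ (inD_cell _)).
  exact: star_cells (int_face_faces (itf_face_int iF)) sT.
by rewrite mxE [LHS]mxE [RHS]mxE /Ah e1 e2 e3.
Qed.

(** Eliminating the energy between [std_bounds] and [ife_bounds] compares the two forms; the
    condition numbers then differ by the ratio of the comparison constants. *)
Lemma cond_comparison :
  [/\ (cond2 (stiff_ife P mu L o) <= (kife / bm / (bm / (2 * kloc ^+ 2) / bM))%:E * cond2 (stiff_std P mu L o))%E,
      (cond2 (stiff_std P mu L o) <= (bM / (bm / (2 * kloc ^+ 2)) / (bm / kife))%:E * cond2 (stiff_ife P mu L o))%E &
      (cond2 (stiff_std P mu L o) <= (bM * kup * (kpoin + 1) / (2 * bm) * h ^- 2)%:E)%E].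
Proof.
have k1 := kloc_ge1; have k0 : 0 < kloc by lra.
have ki : 0 < kife.
  rewrite /kife ltr_pwDl //; last by rewrite mulr_ge0 // klift_ge0.
  by rewrite mulr_gt0 ?exprn_gt0 // mulr_gt0.
have kb : 0 < bm / (2 * kloc ^+ 2) by rewrite divr_gt0 // mulr_gt0 // exprn_gt0.
have h0 := mesh_size_gt0.
have kp : 0 <= kpoin.
  have kl : 0 <= klam by rewrite /klam mulr_ge0 // addr_ge0 ?mulr_ge0 ?kgrad_ge0 ?D_ge0.
  have D0 := D_ge0.
  rewrite /kpoin; apply: mulr_ge0; first by rewrite mulr_ge0 // kmeas_ge0.
  have := sqr_ge0 klam; have := sqr_ge0 (2 * D); have := mulr_ge0 D0 kl; lra.
have rle (k b p E : R) : 0 <= k -> 0 < b -> p <= b * E -> k / b * p <= k * E.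
  by move=> k0' b0 hp; rewrite -mulrA ler_wpM2l // mulrC ler_pdivrMr // mulrC.
have rge (k b p E : R) : 0 <= k -> 0 < b -> b * E <= p -> k * E <= k / b * p.
  by move=> k0' b0 hp; rewrite -mulrA ler_wpM2l // [leRHS]mulrC ler_pdivlMr // mulrC.
have s0 (x : 'rV[R]_ND) := std_bounds x; have i0 (x : 'rV[R]_ND) := ife_bounds x.
split.
- apply: cond2_le; [exact: divr_gt0|exact: divr_gt0|exact: ife_psd|exact: std_psd| |] => x.
    have /andP[_ s2] := s0 x; have /andP[i1 _] := i0 x; apply: le_trans i1.
    exact: rle (ltW kb) bM0 s2.
  have /andP[s1 _] := s0 x; have /andP[_ i2] := i0 x; apply: (le_trans i2).
  exact: rge (ltW ki) bm0 s1.
- apply: cond2_le; [exact: divr_gt0|exact: divr_gt0|exact: std_psd|exact: ife_psd| |] => x.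
    have /andP[s1 _] := s0 x; have /andP[_ i2] := i0 x; apply: le_trans s1.
    exact: rle (ltW bm0) ki i2.
  have /andP[_ s2] := s0 x; have /andP[i1 _] := i0 x; apply: (le_trans s2).
  exact: rge (ltW bM0) kb i1.
have hN0 : 0 < h ^+ N by rewrite exprn_gt0.
(* The upper form bound, from [energy_upper], over the lower one, from [poincare]: the powers h^N
   cancel and h^-2 remains. Here 1 is added to [kpoin] to make the divisor positive. *)
have -> : bM * kup * (kpoin + 1) / (2 * bm) * h ^- 2 =
   (bM * kup * h ^+ N / h ^+ 2) / (bm * (2 * h ^+ N / (kpoin + 1))).
  have kp1 : kpoin + 1 != 0 by rewrite gt_eqF // ltr_wpDl.
  by field; rewrite (gt_eqF hN0) (gt_eqF bm0) kp1 (gt_eqF h0).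
have kp1 : 0 < kpoin + 1 by rewrite ltr_wpDl.
have dE (x : 'rV[R]_ND) : dofsq (fval x) = enorm x ^+ 2 by rewrite enorm_fval.
apply: cond2_bound.
- by rewrite mulr_gt0 // divr_gt0 // mulr_gt0.
- rewrite divr_ge0 ?exprn_ge0 ?(ltW h0) //; apply: mulr_ge0; last exact: ltW.
  by rewrite mulr_ge0 ?(ltW bM0) // /kup mulr_ge0 ?sqr_ge0 // mulr_ge0 // kmeas'_ge0.
- exact: std_psd.
- move=> x; have /andP[s1 _] := s0 x; apply: le_trans s1; rewrite -[X in X <= _]mulrA; apply: (ler_wpM2l (ltW bm0)).
  rewrite mulrAC ler_pdivrMr //.
  have := poincare (@fval_bnd x); rewrite dE => p.
  have -> : 2 * h ^+ N * enorm x ^+ 2 = h ^+ N * (2 * enorm x ^+ 2) by ring.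
  apply: le_trans p _; rewrite mulrC ler_wpM2l ?energy_ge0 //; lra.
move=> x; have /andP[_ s2] := s0 x; apply: (le_trans s2).
have := energy_upper (@fval_bnd x); rewrite dE => p.
have -> : bM * kup * h ^+ N / h ^+ 2 * enorm x ^+ 2 = bM * ((kup * h ^+ N * enorm x ^+ 2) / h ^+ 2).
  by ring.
apply: (ler_wpM2l (ltW bM0)).
by rewrite ler_pdivlMr // exprn_gt0.
Qed.

End MeshConstants.

Theorem mainTheorem4 (R : realType) (N : nat) (hN : N = 2%N \/ N = 3%N)
    (P : interface_problem R N) (hP : valid_problem P)
    (mu sigma tau c : R) (M : nat) (hmu : 0 < mu) :
  exists C : R, 0 < C /\
    forall (m : mesh R N) (L : planes m) (o : face_orientation m),
      admissible P mu L o sigma tau c M ->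
      let A := stiff_ife P mu L o in
      let Astd := stiff_std P mu L o in
      [/\ (cond2 A <= C%:E * cond2 Astd)%E,
          (cond2 Astd <= C%:E * cond2 A)%E &
          (cond2 Astd <= (C * (mesh_size m) ^- 2)%:E)%E].
Proof.
have [bm [bM [bm0 bM0 ell]]] := coef_elliptic hP.
have [[_ [D hD] _] _ _ _] := hP.
pose c1 := kife N sigma tau c D bm bM / bm / (bm / (2 * kloc bm bM ^+ 2) / bM).
pose c2 := bM / (bm / (2 * kloc bm bM ^+ 2)) / (bm / kife N sigma tau c D bm bM).
pose c3 := bM * kup N sigma tau * (kpoin N sigma tau D + 1) / (2 * bm).
(* One positive constant dominating all three, fixed before the mesh, the planes and the orientation
   are introduced. *)
exists (`|c1| + `|c2| + `|c3| + 1).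
have n1 := normr_ge0 c1; have n2 := normr_ge0 c2; have n3 := normr_ge0 c3.
have l1 := ler_norm c1; have l2 := ler_norm c2; have l3 := ler_norm c3.
split; first lra.
move=> m L o adm A Astd.
have [h1 h2 h3] := cond_comparison hN hP hmu hD adm bm0 bM0 ell.
have cond_ge0 n (B : 'M[R]_n) : (0 <= cond2 B)%E.
  rewrite /cond2; case: ifP => // _.
  by rewrite lee_fin mulr_ge0 ?opnorm2_ge0.
split.
- by apply: le_trans h1 _; rewrite lee_wpmul2r // lee_fin -/c1; lra.
- by apply: le_trans h2 _; rewrite lee_wpmul2r // lee_fin -/c2; lra.
apply: le_trans h3 _; rewrite lee_fin; apply: ler_wpM2r; last by rewrite -/c3; lra.
by rewrite invr_ge0 exprn_ge0 // ltW // (mesh_size_gt0 hN hP adm).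
Qed.
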